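(* Let $1<p<5$ and let $f:\mathbb{R}\to\mathbb{R}$ satisfy $|f(s)|\lesssim s^{\frac{p-1}{2}}$ for $s\ge 0$, with $s\mapsto f(s^2)$ locally Lipschitz continuous. Let $V:\mathbb{R}\to\mathbb{R}$, $V\neq 0$, be an even Schwartz function such that $$\int_{\mathbb{R}}\big(|V(x)|+|V'(x)|\big)\cosh(2x)\,dx<+\infty .$$ Then there exist $\varepsilon>0$ (small) and $\mu_0>0$ such that for all $\mu\in(0,\mu_0)$ the following holds. If $u$ is a global odd solution in $H^1(\mathbb{R})$ of $$iu_t+u_{xx}=\mu V(x)u+f(|u|^2)u,\qquad (t,x)\in\mathbb{R}\times\mathbb{R},$$ with $\|u(0)\|_{H^1(\mathbb{R})}\le\varepsilon$, then for every bounded interval $I\subset\mathbb{R}$, $$\lim_{t\to\infty}\Big(\|u(t)\|_{L^2(I)}+\|u(t)\|_{L^\infty(I)}\Big)=0.$$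
   Context: $u$ is complex-valued. A global odd solution in $H^1(\mathbb{R})$ is a function $u\in C(\mathbb{R};H^1(\mathbb{R}))$ satisfying the equation (in $H^{-1}(\mathbb{R})$) for all $t\in\mathbb{R}$, such that $u(t,-x)=-u(t,x)$ for all $t,x$. *)

(* Defs.v *)
From mathcomp Require Export all_boot all_order all_algebra.
From mathcomp Require Export all_classical all_reals all_analysis.
From mathcomp Require Export complex.
Export numFieldNormedType.Exports.

Set Implicit Arguments.
Unset Strict Implicit.
Unset Printing Implicit Defensive.

Import Order.TTheory GRing.Theory Num.Theory.

Local Open Scope classical_set_scope.
Local Open Scope ring_scope.
Local Open Scope complex_scope.

Section RealFunctions.
Context {R : realType}.
Implicit Types g V : R -> R.

Definition smooth g : Prop := forall n x, derivable (g^`(n))%classic x 1.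

Definition schwartz g : Prop :=
  smooth g /\
  forall k n : nat, exists C : R, forall x, `|x| ^+ k * `|(g^`(n))%classic x| <= C.

Definition test_function g : Prop :=
  smooth g /\ exists M : R, forall x, M < `|x| -> g x = 0.

Definition locally_lipschitz g : Prop :=
  [locally [lipschitz (g : R^o -> R^o) x | x in setT]].

Definition cosh (x : R) : R := (expR x + expR (- x)) / 2.

End RealFunctions.

(* Elements of L^2, H^1 are represented by functions R -> R[i]; all the norms
   and pairings below depend only on the a.e. class of the representative. *)
Section SobolevSpaces.
Context {R : realType}.
Implicit Types u v w phi : R -> R[i].

Local Notation mu := (@lebesgue_measure R).

Definition cmodulus (z : R[i]) : R := Normc.normc z.

Definition cmeasurable u : Prop :=
  measurable_fun setT (fun x => complex.Re (u x)) /\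
  measurable_fun setT (fun x => complex.Im (u x)).

Definition cintegral u : R[i] :=
  Complex (\int[mu]_x complex.Re (u x)) (\int[mu]_x complex.Im (u x)).

Definition Lnorm_on (p : \bar R) (I : set R) u : \bar R :=
  'N[mu]_p[(fun x => (cmodulus (u x))%:E) \_ I].

Definition L2norm u : \bar R := Lnorm_on 2%:E setT u.

Definition L2 u : Prop := cmeasurable u /\ (L2norm u < +oo)%E.

(* By complex linearity, real-valued test functions suffice. *)
Definition weak_deriv u v : Prop := forall phi : R -> R, test_function phi ->
  cintegral (fun x => u x * ((phi^`())%classic x)%:C) =
  - cintegral (fun x => v x * (phi x)%:C).

Definition H1 u : Prop := L2 u /\ exists v, L2 v /\ weak_deriv u v.

Definition wderiv u : R -> R[i] :=
  xget (fun _ => 0) [set v | L2 v /\ weak_deriv u v].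

(* Only meaningful for [H1 u]: otherwise [wderiv u] is a junk value. *)
Definition H1norm u : \bar R :=
  ((L2norm u `^ 2 + L2norm (wderiv u) `^ 2) `^ 2^-1)%E.

(* H^{-1} is the space of bounded C-linear functionals on H^1; an L^2 function
   acts through the bilinear pairing (no complex conjugation). *)
Definition Hm1 (F : (R -> R[i]) -> R[i]) : Prop :=
  (forall (c : R[i]) phi psi, H1 phi -> H1 psi ->
     F (fun x => c * phi x + psi x) = c * F phi + F psi) /\
  exists M : R, forall phi, H1 phi ->
     ((cmodulus (F phi))%:E <= M%:E * H1norm phi)%E.

Definition Hm1norm (F : (R -> R[i]) -> R[i]) : \bar R :=
  ereal_sup [set (cmodulus (F phi))%:E |
             phi in [set phi | H1 phi /\ (H1norm phi <= 1)%E]].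

Definition pairing u : (R -> R[i]) -> R[i] :=
  fun phi => cintegral (fun x => u x * phi x).

Definition Hm1_dxx u : (R -> R[i]) -> R[i] :=
  fun phi => - cintegral (fun x => wderiv u x * wderiv phi x).

End SobolevSpaces.

Section Schrodinger.
Context {R : realType}.

Definition continuous_H1 (u : R -> R -> R[i]) : Prop :=
  (forall t, H1 (u t)) /\
  forall t0, H1norm (fun x => u t x - u t0 x) @[t --> t0] --> 0%E.

Definition Hm1_time_derivative (u : R -> R -> R[i]) (t : R)
    (F : (R -> R[i]) -> R[i]) : Prop :=
  Hm1 F /\
  Hm1norm (fun phi =>
    (h^-1)%:C * (pairing (u (t + h)) phi - pairing (u t) phi) - F phi)
    @[h --> 0^'] --> 0%E.

(* i u_t + u_xx = m V u + f(|u|^2) u *)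
Definition global_odd_solution (m : R) (V f : R -> R) (u : R -> R -> R[i])
    : Prop :=
  [/\ continuous_H1 u,
      forall t, exists2 u_t, Hm1_time_derivative u t u_t &
        forall phi, H1 phi ->
          'i%C * u_t phi + Hm1_dxx (u t) phi =
          pairing (fun x => (m * V x)%:C * u t x +
                            (f (cmodulus (u t x) ^+ 2))%:C * u t x) phi
    & forall t x, u t (- x) = - u t x].

End Schrodinger.

(* Main.v *)
(** Write u = A + iB with real A, B; oddness gives A = B = 0 at the origin.
    With phi(x) = sgn(x) (1 - e^{-|x|}), the virial M = int phi (A B_x - B A_x)
    satisfies M' = 2 D + (potential and nonlinear terms), where
    D = int e^{-|x|} ((A_x - sgn A / 2)^2 + (B_x - sgn B / 2)^2): the boundary
    terms at the origin, where phi' has a corner, vanish because A and B do.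
    Sign-weighted integrations by parts show that D controls int e^{-2|x|} |u|^2,
    the supremum of e^{-2|x|} |u|^2, hence int |V'| |u|^2, and
    int e^{-|x|} |u|^{p+1} up to the factor |u|_oo^{p-1}. Mass and energy
    conservation keep the H^1 norm small, so M' >= D for small mu and eps.
    As M is bounded, and y = int e^{-2|x|} |u|^2 satisfies y <= 4 D and is
    Lipschitz in time, |(y^2)'| <= C M'; hence y tends to 0, and with the H^1
    bound so do the local norms. Since u is only in H^1, the virial and the
    energy are differentiated in time after replacing A_x, B_x by difference
    quotients, which converge uniformly on compact time intervals. *)
Require Import Defs.
From HB Require Import structures.
From mathcomp Require Import measurable_realfun ess_sup_inf.
From mathcomp Require Import ring lra.

Set Implicit Arguments.
Unset Strict Implicit.
Unset Printing Implicit Defensive.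

Import Order.TTheory GRing.Theory Num.Theory.

Local Open Scope classical_set_scope.
Local Open Scope ring_scope.

(** * Square-integrable functions and absolute continuity *)

Section L2.
Context {R : realType}.
Local Notation mu := (@lebesgue_measure R).
Implicit Types f g h : R -> R.

(** Writing A = e^{|x|/2} g turns the contribution of A to D into int g_x^2 with g(0) = 0. Its only
    degeneracy is a constant g, which the vanishing at the origin excludes; but on an unbounded
    half-line int g^2 = int e^{-|x|} A^2 is not controlled by int g_x^2. This is why the estimates
    pass to the faster decaying weight e^{-2|x|}; V' is then paired with e^{2|x|}, which the
    hypothesis with cosh(2x) allows. Two losses of regularity shape the proof. The time derivative
    lives in H^{-1}, while the natural multipliers phi B_x (virial) and A_xx (energy) are not in
    H^1. Difference quotients are in H^1, obey exact discrete product rules and exact summation by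
    parts, and their errors vanish with the step. Moreover f need not be differentiable: only f(s^2)
    is locally Lipschitz, so each use of the derivative of f(|u|^2) is replaced by a bound on
    increments, with a remainder quadratic in the increments of A and B. Smallness is measured by
    one number E bounding the initial squared H^1 norm; the supremum of |u|^2 at later times is at
    most a fixed multiple of E. *)

Lemma aeS (P Q : set R) : (forall x, P x -> Q x) ->
  {ae mu, forall x, P x} -> {ae mu, forall x, Q x}.
Proof.
by move=> PQ [N [mN N0 PN]]; exists N; split => // x /= nQ; apply: PN => /PQ.
Qed.

Lemma aeI (P Q : set R) : {ae mu, forall x, P x} -> {ae mu, forall x, Q x} ->
  {ae mu, forall x, P x /\ Q x}.
Proof.
move=> hP hQ; have [N [mN N0 PN]] := hP; have [M [mM M0 QM]] := hQ.
exists (N `|` M); split; first exact: measurableU.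
  by rewrite measureU0.
move=> x /= nPQ; have [Px|nP] := pselect (P x); last by left; exact: PN.
by right; apply: QM => Qx; apply: nPQ.
Qed.

Lemma aeT (P : set R) : (forall x, P x) -> {ae mu, forall x, P x}.
Proof. by move=> hP; exists set0; split => // x /=. Qed.

Definition igr f : Prop := mu.-integrable setT (EFin \o f).

Lemma igr_meas f : igr f -> measurable_fun setT f.
Proof. by move=> /integrableP[/measurable_EFinP]. Qed.

Lemma igrD f g : igr f -> igr g -> igr (fun x => f x + g x).
Proof. by move=> hf hg; exact: (integrableD measurableT hf hg). Qed.

Lemma igrZ c f : igr f -> igr (fun x => c * f x).
Proof. by move=> hf; exact: (integrableZl measurableT c hf). Qed.

Lemma igrN f : igr f -> igr (fun x => - f x).
Proof.
move=> hf; have := igrZ (-1) hf; congr (igr _).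
by apply/funext => x; rewrite mulN1r.
Qed.

Lemma igrB f g : igr f -> igr g -> igr (fun x => f x - g x).
Proof. by move=> hf hg; exact: (igrD hf (igrN hg)). Qed.

Lemma igr0 : igr (fun=> 0).
Proof. exact: integrable0. Qed.

Lemma igr_le f g : measurable_fun setT f -> (forall x, `|f x| <= g x) ->
  igr g -> igr f.
Proof.
move=> mf fg ig; apply: (le_integrable measurableT _ _ ig).
  exact/measurable_EFinP.
move=> x _ /=; rewrite lee_fin (le_trans (fg x))// ler_norm//.
Qed.

Lemma igr_norm f : igr f -> igr (fun x => `|f x|).
Proof.
move=> hf; have mf := igr_meas hf.
apply: (le_integrable measurableT _ _ hf).
  by apply/measurable_EFinP; exact: measurableT_comp.
by move=> x _ /=; rewrite lee_fin normr_id.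
Qed.

Lemma igr_mulb C f h : igr f -> measurable_fun setT h ->
  (forall x, `|h x| <= C) -> igr (fun x => f x * h x).
Proof.
move=> hf mh hC; apply: (igr_le (g := fun x => C * `|f x|)).
- by apply: measurable_funM => //; exact: igr_meas.
- by move=> x; rewrite normrM mulrC ler_wpM2r.
- exact/igrZ/igr_norm.
Qed.

Lemma intD f g : igr f -> igr g ->
  \int[mu]_x (f x + g x) = \int[mu]_x f x + \int[mu]_x g x.
Proof. by move=> *; rewrite RintegralD. Qed.

Lemma intB f g : igr f -> igr g ->
  \int[mu]_x (f x - g x) = \int[mu]_x f x - \int[mu]_x g x.
Proof. by move=> *; rewrite RintegralB. Qed.

Lemma intZ c f : igr f -> \int[mu]_x (c * f x) = c * \int[mu]_x f x.
Proof. by move=> *; rewrite RintegralZl. Qed.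

Lemma intN f : igr f -> \int[mu]_x (- f x) = - \int[mu]_x f x.
Proof.
move=> hf; rewrite -mulN1r -intZ//; apply: eq_Rintegral => x _.
by rewrite mulN1r.
Qed.

Lemma int_ext f g : (forall x, f x = g x) -> \int[mu]_x f x = \int[mu]_x g x.
Proof. by move=> fg; apply: eq_Rintegral => x _. Qed.

Lemma int_le f g : igr f -> igr g -> (forall x, f x <= g x) ->
  \int[mu]_x f x <= \int[mu]_x g x.
Proof. by move=> hf hg fg; apply: le_Rintegral => // x _. Qed.

Lemma int_ge0 f : (forall x, 0 <= f x) -> 0 <= \int[mu]_x f x.
Proof. by move=> f0; apply: Rintegral_ge0. Qed.

Lemma int_norm f : igr f -> `|\int[mu]_x f x| <= \int[mu]_x `|f x|.
Proof. by move=> hf; apply: le_normr_Rintegral. Qed.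

Lemma int_norm_le f g : igr f -> igr g -> (forall x, `|f x| <= g x) ->
  `|\int[mu]_x f x| <= \int[mu]_x g x.
Proof.
move=> hf hg fg; apply: le_trans (int_norm hf) _.
by apply: int_le => //; exact: igr_norm.
Qed.

Lemma int_ae f g : measurable_fun setT f -> measurable_fun setT g ->
  {ae mu, forall x, f x = g x} -> \int[mu]_x f x = \int[mu]_x g x.
Proof.
move=> mf mg fg; congr fine; apply: ae_eq_integral => //.
- exact/measurable_EFinP.
- exact/measurable_EFinP.
- by apply: aeS fg => x -> _.
Qed.

Lemma igr_ae f g : measurable_fun setT f -> 
  {ae mu, forall x, f x = g x} -> igr g -> igr f.
Proof.
move=> mf fg hg; have mg := igr_meas hg.
apply/integrableP; split; first exact/measurable_EFinP.
have /integrableP[_] := hg; apply: le_lt_trans.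
rewrite (@ge0_ae_eq_integral _ _ _ mu setT (fun x => `|(EFin \o f) x|)%E
  (fun x => `|(EFin \o g) x|)%E)//.
- by apply: measurableT_comp => //; exact/measurable_EFinP.
- by apply: measurableT_comp => //; exact/measurable_EFinP.
- by apply: aeS fg => x /= -> _.
Qed.

Definition L2R f : Prop := measurable_fun setT f /\ igr (fun x => f x ^+ 2).

Lemma L2R_igrM f g : L2R f -> L2R g -> igr (fun x => f x * g x).
Proof.
move=> [mf hf] [mg hg]; apply: (igr_le (g := fun x => f x ^+ 2 + g x ^+ 2)).
- exact: measurable_funM.
- move=> x; rewrite ler_norml.
  by apply/andP; split; have := sqr_ge0 (f x); have := sqr_ge0 (g x);
    have := sqr_ge0 (f x - g x); have := sqr_ge0 (f x + g x); nra.
- exact: igrD.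
Qed.

Lemma L2RD f g : L2R f -> L2R g -> L2R (fun x => f x + g x).
Proof.
move=> hf hg; split; first exact: measurable_funD hf.1 hg.1.
have -> : (fun x => (f x + g x) ^+ 2) =
  (fun x => (f x ^+ 2 + 2 * (f x * g x)) + g x ^+ 2).
  by apply/funext => x; ring.
apply: igrD; last exact: hg.2.
apply: igrD; first exact: hf.2.
exact/igrZ/L2R_igrM.
Qed.

Lemma L2R_mulb C f h : L2R f -> measurable_fun setT h ->
  (forall x, `|h x| <= C) -> L2R (fun x => h x * f x).
Proof.
move=> [mf hf] mh hC; split; first exact: measurable_funM.
have -> : (fun x => (h x * f x) ^+ 2) = (fun x => f x ^+ 2 * (h x ^+ 2)).
  by apply/funext => x; ring.
apply: (igr_mulb (C := C ^+ 2)) => //; first exact: measurable_funX.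
move=> x; rewrite normrX lerXn2r// ?nnegrE//.
exact: le_trans (hC x).
Qed.

Lemma L2RZ c f : L2R f -> L2R (fun x => c * f x).
Proof. by move=> hf; apply: (L2R_mulb (C := `|c|) (h := fun=> c)). Qed.

Lemma L2RN f : L2R f -> L2R (fun x => - f x).
Proof.
move=> hf; have := L2RZ (-1) hf; congr (L2R _).
by apply/funext => x; rewrite mulN1r.
Qed.

Lemma L2RB f g : L2R f -> L2R g -> L2R (fun x => f x - g x).
Proof. by move=> hf hg; exact: (L2RD hf (L2RN hg)). Qed.

Lemma L2R0 : L2R (fun=> 0).
Proof.
split=> //; have -> : (fun=> 0 ^+ 2) = (fun=> 0) :> (R -> R).
  by apply/funext => x; rewrite expr0n.
exact: igr0.
Qed.

Lemma L2R_ae f g : measurable_fun setT f -> 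
  {ae mu, forall x, f x = g x} -> L2R g -> L2R f.
Proof.
move=> mf fg [mg hg]; split => //; apply: igr_ae hg.
  exact: measurable_funX.
by apply: aeS fg => x ->.
Qed.

Lemma L2R_le f g : measurable_fun setT f -> (forall x, `|f x| <= g x) ->
  L2R g -> L2R f.
Proof.
move=> mf fg [mg hg]; split => //; apply: (igr_le _ _ hg).
  exact: measurable_funX.
move=> x; rewrite normrX lerXn2r// ?nnegrE//.
by apply: le_trans (fg x).
Qed.

Lemma L2R_norm f : L2R f -> L2R (fun x => `|f x|).
Proof.
move=> [mf hf]; split; first exact: measurableT_comp.
by have := hf; congr igr; apply/funext => x; rewrite real_normK// num_real.
Qed.

Definition ip f g : R := \int[mu]_x (f x * g x).

Lemma ipC f g : ip f g = ip g f.
Proof. by apply: int_ext => x; rewrite mulrC. Qed.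

Lemma ipDl f g h : L2R f -> L2R g -> L2R h ->
  ip (fun x => f x + g x) h = ip f h + ip g h.
Proof.
move=> hf hg hh; rewrite /ip -intD; try exact: L2R_igrM.
by apply: int_ext => x; rewrite mulrDl.
Qed.

Lemma ipBl f g h : L2R f -> L2R g -> L2R h ->
  ip (fun x => f x - g x) h = ip f h - ip g h.
Proof.
move=> hf hg hh; rewrite /ip -intB; try exact: L2R_igrM.
by apply: int_ext => x; rewrite mulrBl.
Qed.

Lemma ipZl c f h : L2R f -> L2R h -> ip (fun x => c * f x) h = c * ip f h.
Proof.
move=> hf hh; rewrite /ip -intZ; try exact: L2R_igrM.
by apply: int_ext => x; rewrite mulrA.
Qed.

Lemma ipNl f h : L2R f -> L2R h -> ip (fun x => - f x) h = - ip f h.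
Proof.
move=> hf hh; rewrite /ip -intN; try exact: L2R_igrM.
by apply: int_ext => x; rewrite mulNr.
Qed.

Lemma ipDr f g h : L2R f -> L2R g -> L2R h ->
  ip h (fun x => f x + g x) = ip h f + ip h g.
Proof. by move=> *; rewrite ipC ipDl// !(ipC h). Qed.

Lemma ipBr f g h : L2R f -> L2R g -> L2R h ->
  ip h (fun x => f x - g x) = ip h f - ip h g.
Proof. by move=> *; rewrite ipC ipBl// !(ipC h). Qed.

Lemma ipZr c f h : L2R f -> L2R h -> ip h (fun x => c * f x) = c * ip h f.
Proof. by move=> *; rewrite ipC ipZl// (ipC h). Qed.

Lemma ip_ge0 f : 0 <= ip f f.
Proof. by apply: int_ge0 => x; rewrite -expr2 sqr_ge0. Qed.

Definition nrm f : R := Num.sqrt (ip f f).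

Lemma nrm_ge0 f : 0 <= nrm f. Proof. exact: sqrtr_ge0. Qed.

Lemma nrm_sq f : nrm f ^+ 2 = ip f f.
Proof. by rewrite sqr_sqrtr// ip_ge0. Qed.

Lemma ip_int f : ip f f = \int[mu]_x (f x ^+ 2).
Proof. by apply: int_ext => x; rewrite expr2. Qed.

(** The square of [a f - b g] has nonnegative integral; the weights [a = nrm g], [b = nrm f] give
    the bound when both norms are positive. If one norm vanishes, a large weight on that function
    contradicts a nonzero pairing. *)
Lemma CS f g : L2R f -> L2R g -> `|ip f g| <= nrm f * nrm g.
Proof.
move=> hf hg.
have H (a b : R) : 2 * a * b * ip f g <= a ^+ 2 * ip f f + b ^+ 2 * ip g g.
  have := ip_ge0 (fun x => a * f x - b * g x).
  rewrite ipBl; [|exact: L2RZ|exact: L2RZ|by apply: L2RB; exact: L2RZ].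
  rewrite !ipBr; [|exact: L2RZ..].
  rewrite !ipZl; [|by [|exact: L2RZ]..].
  rewrite !ipZr// (ipC g f); lra.
have H' a b : 2 * a * b * `|ip f g| <= a ^+ 2 * ip f f + b ^+ 2 * ip g g.
  have [h|h] := leP 0 (ip f g); first by rewrite ger0_norm.
  rewrite ltr0_norm//; have := H a (- b); rewrite sqrrN; lra.
rewrite -!nrm_sq in H'.
have [f0|f0] := eqVneq (nrm f) 0; last first.
  have [g0|g0] := eqVneq (nrm g) 0; last first.
    have fp : 0 < nrm f by rewrite lt_neqAle eq_sym f0 nrm_ge0.
    have gp : 0 < nrm g by rewrite lt_neqAle eq_sym g0 nrm_ge0.
    have := H' (nrm g) (nrm f).
    have := mulr_gt0 fp gp; nra.
  rewrite g0 mulr0 leNgt; apply/negP => h.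
  have := H' 1 ((1 + nrm f ^+ 2) / `|ip f g|).
  rewrite g0 expr0n/= mulr0 addr0 mulr1 expr1n mul1r.
  rewrite -!mulrA mulVf ?gt_eqF//; have := sqr_ge0 (nrm f); lra.
rewrite f0 mul0r leNgt; apply/negP => h.
have := H' ((1 + nrm g ^+ 2) / `|ip f g|) 1.
rewrite f0 expr0n/= mulr0 add0r mulr1 expr1n mul1r.
rewrite -!mulrA mulVf ?gt_eqF//; have := sqr_ge0 (nrm g); lra.
Qed.

Lemma nrmD f g : L2R f -> L2R g -> nrm (fun x => f x + g x) <= nrm f + nrm g.
Proof.
move=> hf hg.
rewrite -(@ler_pXn2r _ 2) ?nnegrE ?nrm_ge0 ?addr_ge0 ?nrm_ge0//.
rewrite nrm_sq ipDl// ?ipDr//; try exact: L2RD.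
rewrite (ipC g f).
have := CS hf hg; rewrite ler_norml => /andP[_]; rewrite sqrrD !nrm_sq; lra.
Qed.

Lemma nrmZ c f : L2R f -> nrm (fun x => c * f x) = `|c| * nrm f.
Proof.
move=> hf; rewrite /nrm ipZl ?ipZr//; last exact: L2RZ.
by rewrite mulrA -expr2 sqrtrM ?sqr_ge0// sqrtr_sqr.
Qed.

Lemma nrmN f : nrm (fun x => - f x) = nrm f.
Proof. by congr Num.sqrt; apply: int_ext => x; rewrite mulrNN. Qed.

Lemma nrmB f g : L2R f -> L2R g -> nrm (fun x => f x - g x) <= nrm f + nrm g.
Proof.
move=> hf hg; have := nrmD hf (L2RN hg); rewrite nrmN; exact.
Qed.

Lemma nrm_le f g : L2R f -> L2R g -> (forall x, `|f x| <= `|g x|) ->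
  nrm f <= nrm g.
Proof.
move=> [mf hf] [mg hg] fg; rewrite /nrm ler_wsqrtr// !ip_int; apply: int_le => // x.
rewrite -[X in X <= _]real_normK ?num_real// -[leRHS]real_normK ?num_real//.
by rewrite lerXn2r// ?nnegrE.
Qed.

Lemma nrm_norm f : nrm (fun x => `|f x|) = nrm f.
Proof.
by rewrite /nrm !ip_int; congr Num.sqrt; apply: int_ext => x; rewrite real_normK ?num_real.
Qed.

Lemma nrm_ext f g : (forall x, f x = g x) -> nrm f = nrm g.
Proof. by move=> /funext ->. Qed.

Lemma nrm_mulb C f h : L2R f -> measurable_fun setT h -> 
  (forall x, `|h x| <= C) -> nrm (fun x => h x * f x) <= C * nrm f.
Proof.
move=> hf mh hC.
have C0 : 0 <= C by apply: le_trans (hC 0).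
rewrite -[C]ger0_norm// -nrmZ//; apply: nrm_le.
- exact: L2R_mulb hf mh hC.
- exact: L2RZ.
- by move=> x; rewrite !normrM ler_wpM2r// (le_trans (hC x))// ler_norm.
Qed.

Lemma nrm_ae f g : measurable_fun setT f -> measurable_fun setT g ->
  {ae mu, forall x, f x = g x} -> nrm f = nrm g.
Proof.
move=> mf mg fg; congr Num.sqrt; apply: int_ae; try exact: measurable_funM.
by apply: aeS fg => x ->.
Qed.

Lemma meas_shift (a : R) : measurable_fun setT (fun x : R => x + a).
Proof. exact: measurable_funD. Qed.

Lemma measurable_shift f a : measurable_fun setT f ->
  measurable_fun setT (fun x : R => f (x + a)).
Proof. by move=> mf; exact: (measurableT_comp mf (meas_shift a)). Qed.

(** The pushforward under the translation agrees with Lebesgue measure on half-open intervals, which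
    determines it. The reflection below is treated in the same way, up to the exchange of open and
    closed ends. *)
Lemma lebesgue_measure_shift (a : R) (A : set R) : measurable A ->
  mu [set x | A (x + a)] = mu A.
Proof.
move=> mA.
have ms : measurable_fun (setT : set (measurableTypeR R))
   ((fun x : R => x + a) : measurableTypeR R -> measurableTypeR R).
  exact: meas_shift.
pose phi : measurableTypeR R -> measurableTypeR R := fun x => x + a.
rewrite [RHS](lebesgue_measure_unique (mu := pushforward mu phi))//.
move=> X [[b c]] _ <- /=.
rewrite /pushforward /=.
have -> : (fun x : R => x + a) @^-1` `]b, c] = `]b - a, c - a]%classic.
  by apply/seteqP; split => x /=; rewrite !in_itv/= ltrBlDr lerBrDr.
rewrite !lebesgue_measure_itv/= !lte_fin ltrD2r.
case: ifP => // _; congr EFin; ring.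
Qed.

Lemma lebesgue_measure_opp (A : set R) : measurable A ->
  mu [set x | A (- x)] = mu A.
Proof.
move=> mA.
have ms : measurable_fun (setT : set (measurableTypeR R))
   ((fun x : R => - x) : measurableTypeR R -> measurableTypeR R).
  exact: oppr_measurable.
pose phi : measurableTypeR R -> measurableTypeR R := fun x => - x.
rewrite [RHS](lebesgue_measure_unique (mu := pushforward mu phi))//.
move=> X [[b c]] _ <- /=.
rewrite /pushforward /=.
have -> : (fun x : R => - x) @^-1` `]b, c] = `[- c, - b[%classic.
  by apply/seteqP; split => x /=; rewrite !in_itv/= ltrNr lerNl andbC.
rewrite !lebesgue_measure_itv/= !lte_fin ltrN2.
case: ifP => // _; congr EFin; ring.
Qed.

Lemma ae_opp (P : set R) : {ae mu, forall x, P x} -> {ae mu, forall x, P (- x)}.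
Proof.
move=> [N [mN N0 PN]]; exists [set x | N (- x)]; split.
- by rewrite -[X in measurable X]setTI; exact: oppr_measurable.
- by rewrite lebesgue_measure_opp.
- by move=> x /= nP; exact: PN.
Qed.

Lemma ge0_integral_shift (F : R -> \bar R) a : measurable_fun setT F ->
  (forall x, 0 <= F x)%E -> (\int[mu]_x F (x + a)%R = \int[mu]_x F x)%E.
Proof.
move=> mF F0.
have ms : measurable_fun (setT : set (measurableTypeR R))
   ((fun x : R => x + a) : measurableTypeR R -> measurableTypeR R).
  exact: meas_shift.
have := @ge0_integral_pushforward _ _ _ _ _ _ ms mu setT F measurableT mF (fun x _ => F0 x).
rewrite preimage_setT => <-.
apply: eq_measure_integral => A mA _.
by rewrite -[RHS](lebesgue_measure_shift a mA).
Qed.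

Lemma igr_shift f a : igr f -> igr (fun x => f (x + a)).
Proof.
move=> hf; apply/integrableP; split.
  by apply/measurable_EFinP; apply: measurable_shift; exact: igr_meas.
rewrite (ge0_integral_shift (F := fun x => `|(EFin \o f) x|%E))//.
  by have /integrableP[] := hf.
by apply: measurableT_comp => //; apply/measurable_EFinP; exact: igr_meas.
Qed.

Lemma int_shift f a : igr f -> \int[mu]_x f (x + a) = \int[mu]_x f x.
Proof.
move=> hf; congr fine.
have ms : measurable_fun (setT : set (measurableTypeR R))
   ((fun x : R => x + a) : measurableTypeR R -> measurableTypeR R).
  exact: meas_shift.
have h1 : measurable_fun setT (EFin \o f) by apply/measurable_EFinP; exact: igr_meas.
have h2 : mu.-integrable ((fun x : R => x + a) @^-1` setT)
   ((EFin \o f) \o (fun x : R => x + a)).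
  by rewrite preimage_setT; exact: (igr_shift a hf).
have := @integral_pushforward _ _ _ _ _ _ ms mu setT (EFin \o f) h1 h2 measurableT.
rewrite preimage_setT => <-.
apply: eq_measure_integral => A mA _.
by rewrite -[RHS](lebesgue_measure_shift a mA).
Qed.

Lemma L2R_shift f a : L2R f -> L2R (fun x => f (x + a)).
Proof.
move=> [mf hf]; split; first exact: measurable_shift.
exact: (igr_shift a hf).
Qed.

Lemma ip_shift f g a : L2R f -> L2R g ->
  ip (fun x => f (x + a)) (fun x => g (x + a)) = ip f g.
Proof.
by move=> hf hg; rewrite /ip (int_shift (f := fun x => f x * g x))//; exact: L2R_igrM.
Qed.

Lemma nrm_shift f a : L2R f -> nrm (fun x => f (x + a)) = nrm f.
Proof. by move=> hf; rewrite /nrm ip_shift. Qed.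

End L2.

(** * Integrals over segments and absolutely continuous functions *)

Section intervals.
Context {R : realType}.
Local Notation mu := (@lebesgue_measure R).
Implicit Types f g h : R -> R.

Definition itg (a b : R) f : R := \int[mu]_(x in `[a, b]) f x.

Definition lig f : Prop :=
  measurable_fun setT f /\ forall a b : R, mu.-integrable `[a, b] (EFin \o f).

Definition ind (a b x : R) : R := if a <= x <= b then 1 else 0.

Lemma indE a b : ind a b = \1_(`[a, b] : set R).
Proof.
apply/funext => x; rewrite /ind indicE.
have -> : (x \in `[a, b]%classic) = (a <= x <= b).
  by apply/idP/idP; rewrite inE/= in_itv/=.
by case: ifP.
Qed.

Lemma ind_meas a b : measurable_fun setT (ind a b).
Proof. by rewrite indE; apply: measurable_indic. Qed.

Lemma ind_ge0 a b x : 0 <= ind a b x.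
Proof. by rewrite /ind; case: ifP. Qed.

Lemma ind_le1 a b x : ind a b x <= 1.
Proof. by rewrite /ind; case: ifP. Qed.

Lemma ind_norm a b x : `|ind a b x| <= 1.
Proof. by rewrite ger0_norm ?ind_ge0 ?ind_le1. Qed.

Lemma ind_sq a b x : ind a b x ^+ 2 = ind a b x.
Proof. by rewrite /ind; case: ifP; rewrite ?expr1n ?expr0n. Qed.

Lemma patch_ind a b f : f \_ `[a, b] = (fun x => f x * ind a b x).
Proof.
apply/funext => x; rewrite patchE /ind.
have -> : (x \in `[a, b]%classic) = (a <= x <= b).
  by apply/idP/idP; rewrite inE/= in_itv/=.
by case: ifP; rewrite ?mulr1 ?mulr0.
Qed.

Lemma itgE a b f : itg a b f = \int[mu]_x (f x * ind a b x).
Proof. by rewrite /itg Rintegral_mkcond patch_ind. Qed.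

Lemma integrable_ind a b f : 
  mu.-integrable `[a, b] (EFin \o f) <-> igr (fun x => f x * ind a b x).
Proof.
by rewrite integrable_mkcond// restrict_EFin patch_ind.
Qed.

Lemma lig_ind f a b : lig f -> igr (fun x => f x * ind a b x).
Proof. by move=> [_ hf]; exact/integrable_ind. Qed.

Lemma igr_lig f : igr f -> lig f.
Proof.
move=> hf; split; first exact: igr_meas.
by move=> a b; apply: integrableS hf.
Qed.

Lemma igr_ind1 a b : igr (ind a b).
Proof.
by rewrite indE; exact: (@integrable_indic_itv R a b true false).
Qed.

Lemma lig_cst (c : R) : lig (fun=> c).
Proof.
split=> // a b; apply/integrable_ind.
exact: (igrZ c (igr_ind1 a b)).
Qed.

Lemma L2R_ind a b : L2R (ind a b).
Proof.
split; first exact: ind_meas.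
by have := igr_ind1 a b; congr igr; apply/funext => x; rewrite ind_sq.
Qed.

Lemma L2R_lig f : L2R f -> lig f.
Proof.
move=> hf; split; first exact: hf.1.
by move=> a b; apply/integrable_ind; apply: L2R_igrM => //; exact: L2R_ind.
Qed.

Lemma ligD f g : lig f -> lig g -> lig (fun x => f x + g x).
Proof.
move=> [mf hf] [mg hg]; split; first exact: measurable_funD.
by move=> a b; exact: (integrableD _ (hf a b) (hg a b)).
Qed.

Lemma lig_le f g : measurable_fun setT f -> lig g -> (forall x, `|f x| <= g x) ->
  lig f.
Proof.
move=> mf [mg hg] fg; split => // a b.
apply: (le_integrable _ _ _ (hg a b)) => //.
  by apply: measurable_funTS; exact/measurable_EFinP.
by move=> x _ /=; rewrite lee_fin (le_trans (fg x))// ler_norm.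
Qed.

Lemma lig_norm f : lig f -> lig (fun x => `|f x|).
Proof.
move=> [mf hf]; split; first exact: measurableT_comp.
by move=> a b; exact: (integrable_norm (hf a b)).
Qed.

Lemma ligM C f h : lig f -> measurable_fun setT h -> (forall x, `|h x| <= C) ->
  lig (fun x => f x * h x).
Proof.
move=> hf mh hC; split; first by apply: measurable_funM => //; exact: hf.1.
move=> a b; apply/integrable_ind.
have := igr_mulb (lig_ind a b hf) mh hC; congr igr.
by apply/funext => x; rewrite mulrAC.
Qed.

Lemma lig_itg_ge0 a b f : (forall x, 0 <= f x) -> 0 <= itg a b f.
Proof. by move=> f0; apply: Rintegral_ge0 => x _. Qed.

Lemma itg_ext a b f g : (forall x, a <= x <= b -> f x = g x) ->
  itg a b f = itg a b g.
Proof.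
move=> fg; apply: eq_Rintegral => x; rewrite inE/= in_itv/=; exact: fg.
Qed.

Lemma itg_ae a b f g : measurable_fun setT f -> measurable_fun setT g ->
  {ae mu, forall x, a <= x <= b -> f x = g x} ->
  itg a b f = itg a b g.
Proof.
move=> mf mg fg; rewrite !itgE; apply: int_ae.
- by apply: measurable_funM => //; exact: ind_meas.
- by apply: measurable_funM => //; exact: ind_meas.
apply: aeS fg => x; rewrite /ind; case: ifP; last by rewrite !mulr0.
by move=> _ -> .
Qed.

Lemma itgD a b f g : lig f -> lig g ->
  itg a b (fun x => f x + g x) = itg a b f + itg a b g.
Proof. by move=> [_ hf] [_ hg]; rewrite /itg RintegralD. Qed.

Lemma itgB a b f g : lig f -> lig g ->
  itg a b (fun x => f x - g x) = itg a b f - itg a b g.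
Proof. by move=> [_ hf] [_ hg]; rewrite /itg RintegralB. Qed.

Lemma itgZ a b c f : lig f -> itg a b (fun x => c * f x) = c * itg a b f.
Proof. by move=> [_ hf]; rewrite /itg RintegralZl. Qed.

Lemma itg_le a b f g : lig f -> lig g -> (forall x, a <= x <= b -> f x <= g x) ->
  itg a b f <= itg a b g.
Proof.
by move=> [_ hf] [_ hg] fg; apply: le_Rintegral => // x /=; rewrite in_itv/=; exact: fg.
Qed.

Lemma itg_norm a b f : lig f -> `|itg a b f| <= itg a b (fun x => `|f x|).
Proof. by move=> [_ hf]; apply: le_normr_Rintegral. Qed.

Lemma itg_cst a b c : a <= b -> itg a b (fun=> c) = c * (b - a).
Proof.
move=> ab; rewrite /itg Rintegral_cst//= lebesgue_measure_itv/= lte_fin.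
case: ltP => [_|ba]; first by rewrite -EFinB.
have -> : a = b by apply/eqP; rewrite eq_le ab ba.
by rewrite subrr.
Qed.

Lemma itg_refl a f : itg a a f = 0.
Proof. by rewrite /itg set_itv1 Rintegral_set1. Qed.

Lemma itg_cat a b c f : lig f -> a <= b -> b <= c ->
  itg a c f = itg a b f + itg b c f.
Proof.
move=> [_ hf] ab bc; rewrite /itg.
have H := @Rintegral_itvB R f (BLeft a) (BRight c) b (hf a c) ab bc.
rewrite -(@Rintegral_itv_obnd_cbnd R b (BRight c) f).
  by rewrite -H addrC subrK.
by apply: integrableS (hf b c) => // x /=; rewrite !in_itv/= => /andP[/ltW -> ->].
Qed.

Lemma itg_sub a b c d f : lig f -> (forall x, 0 <= f x) ->
  a <= b -> b <= c -> c <= d -> itg b c f <= itg a d f.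
Proof.
move=> hf f0 ab bc cd; rewrite (itg_cat hf ab (le_trans bc cd)).
rewrite (itg_cat hf bc cd).
by have := lig_itg_ge0 a b f0; have := lig_itg_ge0 c d f0; lra.
Qed.

Lemma itg_int_le a b f : igr f -> (forall x, 0 <= f x) ->
  itg a b f <= \int[mu]_x f x.
Proof.
move=> hf f0; rewrite itgE; apply: int_le => //.
  exact: lig_ind (igr_lig hf).
by move=> x; rewrite ler_piMr// ind_le1.
Qed.

Lemma itg_small f : igr f -> (forall x, 0 <= f x) -> forall e, 0 < e ->
  exists2 d, 0 < d & forall a b, a <= b -> b - a < d -> itg a b f < e.
Proof.
move=> hf f0 e e0.
have [d [d0 H]] := integral_normr_continuous hf e0.
exists d => // a b ab bad.
have lt : (mu `[a, b]%classic < d%:E)%E.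
  by rewrite lebesgue_measure_itv/= lte_fin; case: ifP.
have := H `[a, b]%classic (measurable_itv _) lt.
have -> : \int[mu]_(x in `[a, b]) `|f x| = itg a b f.
  by apply: eq_Rintegral => x _; rewrite ger0_norm.
by [].
Qed.

Lemma itg_sq a b f : L2R f -> a <= b ->
  itg a b f ^+ 2 <= (b - a) * itg a b (fun x => f x ^+ 2).
Proof.
move=> hf ab.
have hfi : L2R (fun x => ind a b x * f x).
  by apply: (L2R_mulb hf (ind_meas a b) (ind_norm a b)).
have := CS hfi (L2R_ind a b).
have -> : ip (fun x => ind a b x * f x) (ind a b) = itg a b f.
  rewrite itgE; apply: int_ext => x.
  by rewrite mulrAC -expr2 ind_sq mulrC.
have e1 : nrm (ind a b) ^+ 2 = b - a.
  rewrite nrm_sq ip_int -[RHS]mul1r -itg_cst// itgE.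
  by apply: int_ext => x; rewrite ind_sq mul1r.
have e2 : nrm (fun x => ind a b x * f x) ^+ 2 = itg a b (fun x => f x ^+ 2).
  rewrite nrm_sq ip_int itgE.
  by apply: int_ext => x; rewrite exprMn ind_sq mulrC.
rewrite -e1 -e2 -exprMn mulrC => H.
by rewrite -[leLHS]real_normK ?num_real// lerXn2r// nnegrE mulr_ge0// nrm_ge0.
Qed.

(** Local absolute continuity, with the density as an explicit second argument: it is determined by
    [U] only almost everywhere, and later formulas fix a convenient representative of it. *)
Definition ac (U u : R -> R) : Prop :=
  lig u /\ forall a b, a <= b -> U b - U a = itg a b u.

Definition prim u (x : R) : R := if 0 <= x then itg 0 x u else - itg x 0 u.

Lemma ac_prim u : lig u -> ac (prim u) u.
Proof.
move=> hu; split => // a b ab; rewrite /prim.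
case: leP => b0; case: leP => a0.
- by rewrite (itg_cat hu a0 ab) addrAC subrr add0r.
- by rewrite opprK addrC (itg_cat hu (ltW a0) b0).
- by have := lt_le_trans b0 (le_trans a0 ab); rewrite ltxx.
- by rewrite opprK (itg_cat hu ab (ltW b0)) addrC addrK.
Qed.

Definition dat (U : R -> R) (x l : R) : Prop := is_derive x 1 U l.

Lemma lig_locally u : lig u -> locally_integrable setT u.
Proof.
move=> hu; split; [exact: hu.1|exact: openT|move=> K _ cK].
have [M [_ KM]] := compact_bounded cK.
have KM1 : K `<=` `[- (M + 1), M + 1].
  move=> x Kx /=; rewrite in_itv/= -ler_norml.
  by apply: (KM (M + 1)) => //; rewrite ltrDl.
have mK : measurable K.
  exact: closed_measurable (compact_closed (@Rhausdorff R) cK).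
have : mu.-integrable K (EFin \o u).
  apply: (@integrableS _ _ _ mu `[- (M + 1), M + 1]%classic K (EFin \o u)) => //.
  exact: hu.2.
by move=> /integrableP[].
Qed.

(** Lebesgue's differentiation theorem is applied on the half-lines starting at [- n], since it
    requires a left endpoint; the countably many exceptional sets are then united. *)
Lemma ac_derive U u : ac U u -> {ae mu, forall x, dat U x (u x)}.
Proof.
move=> [hu HU].
have H (n : nat) : {ae mu, forall x, - n%:R < x -> dat U x (u x)}.
  have loc := lig_locally hu.
  have := @FTC1 R u (BLeft (- n%:R)) (fun y => hu.2 _ _) loc.
  apply: aeS => x hx nx.
  move: hx; rewrite (@lte_fin R) => /(_ nx) [d1 d2].
  have H1 : dat (fun y => U y - U (- n%:R)) x (u x).
    apply: (@near_eq_is_derive _ _ _ (fun y : R => \int[mu]_(t in `[(- n%:R : R), y]) u t)).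
      near=> y; rewrite HU//; apply/ltW; near: y.
      exact: lt_nbhsr.
    rewrite -d2 derive1E; exact: DeriveDef.
  have := is_deriveD H1 (is_derive_cst (U (- n%:R)) x 1).
  rewrite addr0; apply: near_eq_is_derive.
  by near=> y; rewrite /= /GRing.add /= addrNK.
have : mu.-negligible (\bigcup_n ~` [set x | - n%:R < x -> dat U x (u x)]).
  by apply: negligible_bigcup => n; exact: H.
apply: negligibleS => x /= nx; exists (Num.truncn `|x|).+1 => //= h; apply: nx.
apply: h; rewrite ltrNl (le_lt_trans (ler_norm _))// normrN.
by have /andP[] := truncn_itv (normr_ge0 x).
Unshelve. all: by end_near. Qed.

End intervals.

(** * Functions whose increments are dominated by an integral *)

Section density.
Context {R : realType}.
Local Notation mu := (@lebesgue_measure R).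
Implicit Types f g h : R -> R.

Lemma continuity_of_dominated (G k : R -> R) : igr k -> (forall x, 0 <= k x) ->
  (forall a b, a <= b -> `|G b - G a| <= itg a b k) -> continuous G.
Proof.
move=> hk k0 Gk x; apply/cvgrPdist_lt => e e0.
have [d d0 H] := itg_small hk k0 e0.
near=> y; have [xy|yx] := leP x y.
  rewrite distrC (le_lt_trans (Gk _ _ xy))//; apply: H => //.
  have : `|x - y| < d by near: y; exists d.
  by rewrite ltr_norml => /andP[]; lra.
rewrite (le_lt_trans (Gk _ _ (ltW yx)))//; apply: H; first exact: ltW.
have : `|x - y| < d by near: y; exists d.
by rewrite ltr_norml => /andP[]; lra.
Unshelve. all: by end_near. Qed.

Lemma LS_itv (F : cumulative R R) (a b : R) : a <= b ->
  lebesgue_stieltjes_measure F (`]a, b]%classic : set R) = (F b - F a)%:E.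
Proof.
move=> ab; rewrite -(wlength_itv_bnd F false false ab).
rewrite /lebesgue_stieltjes_measure /measure_extension/=.
by rewrite measurable_mu_extE//=; exact: is_ocitv.
Qed.

Lemma itg_oc a b f : lig f -> (\int[mu]_(x in `]a, b]) (f x)%:E)%E = (itg a b f)%:E.
Proof.
move=> [mf hf].
have h : mu.-integrable `]a, b] (EFin \o f).
  by apply: integrableS (hf a b) => // x /=; rewrite !in_itv/= => /andP[/ltW -> ->].
rewrite -[LHS]fineK; last exact: integrable_fin_num.
congr EFin; rewrite /itg -(@Rintegral_itv_obnd_cbnd R a (BRight b) f)//.
Qed.

(* The Stieltjes measures of [K + G] and [K - G], with [K] a primitive of [k],
   add up to the measure of density [2 k]: both are absolutely continuous. *)
Lemma dominated_density (G k : R -> R) : igr k -> (forall x, 0 <= k x) ->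
  (forall a b, a <= b -> `|G b - G a| <= itg a b k) ->
  exists g, ac G g.
Proof.
move=> hk k0 Gk; have lk := igr_lig hk.
pose K := prim k; have [_ HK] : ac K k := ac_prim lk.
have cG := continuity_of_dominated hk k0 Gk.
have cK : continuous K.
  apply: (continuity_of_dominated hk k0) => a b ab.
  by rewrite HK// ger0_norm// lig_itg_ge0.
pose F1 x := K x + G x; pose F2 x := K x - G x; pose F3 x := F1 x + F2 x.
have nd1 : {homo F1 : x y / x <= y}.
  move=> x y xy; have := Gk _ _ xy; rewrite -(HK _ _ xy) ler_norml /F1; lra.
have nd2 : {homo F2 : x y / x <= y}.
  move=> x y xy; have := Gk _ _ xy; rewrite -(HK _ _ xy) ler_norml /F2; lra.
have nd3 : {homo F3 : x y / x <= y}.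
  by move=> x y xy; rewrite /F3 lerD ?nd1 ?nd2.
have c1 : continuous F1 by move=> x; apply: cvgD; [exact: cK|exact: cG].
have c2 : continuous F2 by move=> x; apply: cvgB; [exact: cK|exact: cG].
have c3 : continuous F3 by move=> x; apply: cvgD; [exact: c1|exact: c2].
pose C1 : cumulative R R := HB.pack F1
  (isCumulative.Build R _ R F1 nd1 (right_continuousW c1)).
pose C2 : cumulative R R := HB.pack F2
  (isCumulative.Build R _ R F2 nd2 (right_continuousW c2)).
pose C3 : cumulative R R := HB.pack F3
  (isCumulative.Build R _ R F3 nd3 (right_continuousW c3)).
pose nu1 := lebesgue_stieltjes_measure C1.
pose nu2 := lebesgue_stieltjes_measure C2.
pose nu3 := lebesgue_stieltjes_measure C3.
have ik2 : mu.-integrable setT (EFin \o (fun x => 2 * k x)) by exact: igrZ.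
have pos (E : set _) : (0 <= induced_charge ik2 E)%E.
  by apply: integral_ge0 => x _ /=; rewrite lee_fin mulr_ge0.
pose la := measure_of_charge (induced_charge ik2) pos.
have E1 A : measurable A -> nu3 A = la A.
  move=> mA; apply: lebesgue_stieltjes_measure_unique => // X [[a b]] _ <- /=.
  have [ab|ba] := leP a b; last by rewrite set_itv_ge ?measure0// bnd_simp -leNgt ltW.
  rewrite [LHS]LS_itv// /la /measure_of_charge /induced_charge.
  rewrite (@itg_oc a b (fun x => 2 * k x)); last exact: igr_lig (igrZ _ hk).
  by congr EFin; rewrite itgZ// -HK//= /F3 /F1 /F2; ring.
have E2 A : measurable A -> nu3 A = measure_add nu1 nu2 A.
  move=> mA; apply: lebesgue_stieltjes_measure_unique => // X hX.
  transitivity (nu1 X + nu2 X)%E; last by rewrite -measure_addE.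
  case: hX => -[a b] _ <- /=.
  have [ab|ba] := leP a b.
    rewrite [LHS]LS_itv// [X in (X + _)%E]LS_itv//.
    by rewrite [X in (_ + X)%E]LS_itv//= -EFinD; congr EFin; rewrite /F3; ring.
  have -> : `]a, b]%classic = set0 :> set R.
    by apply: set_itv_ge; rewrite bnd_simp -leNgt ltW.
  transitivity (0 : \bar R); first exact: measure0.
  by rewrite /nu1 /nu2 [X in (X + _)%E]measure0 [X in (_ + X)%E]measure0 adde0.
have le1 A : measurable A -> (nu1 A <= la A)%E.
  by move=> mA; rewrite -E1// E2// measure_addE leeDl.
have lafin A : measurable A -> la A \is a fin_num.
  by move=> mA; apply: fin_num_measure.
have nufin : fin_num_fun nu1.
  move=> A mA; rewrite ge0_fin_numE//; apply: le_lt_trans (le1 A mA) _.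
  by rewrite -ge0_fin_numE ?lafin//; exact: pos.
pose nuF : {finite_measure set _ -> \bar R} := HB.pack nu1
  (Measure_isFinite.Build _ _ _ nu1 nufin).
have dom : nuF `<< mu.
  apply/null_content_dominatesP => A mA muA.
  apply/eqP; rewrite eq_le measure_ge0 andbT.
  apply: (le_trans (le1 A mA)); rewrite /la /measure_of_charge /induced_charge.
  by rewrite null_set_integral//; apply: measurable_funTS; exact: measurable_int ik2.
have [f [f0 ff fi fE]] := radon_nikodym_sigma_finite dom.
pose g x := fine (f x).
have fg : f = EFin \o g by apply/funext => x; rewrite /= fineK.
have ig : igr g by rewrite /igr -fg.
exists (fun x => g x - k x); split; first exact: igr_lig (igrB ig hk).
move=> a b ab; rewrite itgB//; last exact: igr_lig.
have : (F1 b - F1 a)%:E = (itg a b g)%:E.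
  rewrite -itg_oc; last exact: igr_lig.
  have := fE `]a, b]%classic (measurable_itv _); rewrite fg => <-.
  by rewrite -[LHS](LS_itv C1 ab).
by move=> [] <-; rewrite -HK// /F1; ring.
Qed.

Lemma ae_bigcup (P : nat -> set R) : (forall n, {ae mu, forall x, P n x}) ->
  {ae mu, forall x, forall n, P n x}.
Proof.
move=> H; have : mu.-negligible (\bigcup_n ~` P n).
  by apply: negligible_bigcup => n; exact: H.
apply: negligibleS => x /= /existsNP[n nP]; exists n => //.
Qed.

Lemma nat_gt (x : R) : exists n : nat, `|x| < n%:R.
Proof.
exists (Num.truncn `|x|).+1.
by have /andP[] := truncn_itv (normr_ge0 x).
Qed.

Definition dominated (G k : R -> R) : Prop :=
  [/\ lig k, (forall x, 0 <= k x) &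
  forall a b, a <= b -> `|G b - G a| <= itg a b k].

(** Projection onto [[- n, n]]. Composing with it on the right freezes a function outside the
    segment, so that a locally integrable dominating function may be cut off there. *)
Definition clamp (n x : R) : R := if x < - n then - n else if n < x then n else x.

Lemma clamp_bounds (n x : R) : 0 <= n -> - n <= clamp n x <= n.
Proof. by rewrite /clamp; case: (ltP x (- n)); case: (ltP n x); lra. Qed.

Lemma clamp_nd (n a b : R) : 0 <= n -> a <= b -> clamp n a <= clamp n b.
Proof.
rewrite /clamp; case: (ltP a (- n)); case: (ltP n a);
  case: (ltP b (- n)); case: (ltP n b); lra.
Qed.

Lemma clamp_inside (n a b : R) : 0 <= n -> a <= b -> clamp n a != clamp n b ->
  a <= clamp n a /\ clamp n b <= b.
Proof.
move=> n0 ab; rewrite /clamp; case: (ltP a (- n)) => h1; last first.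
  case: (ltP n a) => h2; last first.
    by case: (ltP b (- n)) => h3; [lra|]; case: (ltP n b) => h4; split; lra.
  by rewrite ifF; [rewrite ifT ?eqxx//; lra|apply/negbTE; rewrite -leNgt; lra].
case: (ltP b (- n)) => h3; first by rewrite eqxx.
by case: (ltP n b) => h4; split; lra.
Qed.

(** After clamping, the increments are dominated by [k] restricted to [[- n, n]], which is
    integrable over the whole line, and [dominated_density] applies. *)
Lemma dominated_local (G k : R -> R) (n : nat) : dominated G k ->
  exists g, ac (fun x => G (clamp n%:R x)) g.
Proof.
move=> [lk k0 Gk].
apply: (@dominated_density _ (fun x => k x * ind (- n%:R) n%:R x)).
- exact: lig_ind.
- by move=> x; rewrite mulr_ge0// ind_ge0.
move=> a b ab.
have n0 : - (n%:R : R) <= n%:R by rewrite (@le_trans _ _ 0)// oppr_le0.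
have nn0 : 0 <= n%:R :> R by [].
have cl x := clamp_bounds x nn0.
have clm := clamp_nd nn0 ab.
have L : lig (fun x => k x * ind (- n%:R) n%:R x) by exact: igr_lig (lig_ind _ _ lk).
have [e|ne] := eqVneq (clamp n%:R a) (clamp n%:R b).
  by rewrite e subrr normr0 lig_itg_ge0// => x; rewrite mulr_ge0// ind_ge0.
have [ca cb] := clamp_inside nn0 ab ne.
apply: le_trans (Gk _ _ clm) _.
have -> : itg (clamp n%:R a) (clamp n%:R b) k =
   itg (clamp n%:R a) (clamp n%:R b) (fun x => k x * ind (- n%:R) n%:R x).
  apply: itg_ext => x xab; rewrite /ind ifT ?mulr1//.
  have /andP[h1 _] := cl a; have /andP[_ h2] := cl b.
  by case/andP: xab => h3 h4; rewrite (le_trans h1 h3) (le_trans h4 h2).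
by apply: itg_sub => // x; rewrite mulr_ge0// ind_ge0.
Qed.

Lemma clamp_near (G : R -> R) (n x : R) : - n < x < n ->
  \forall y \near x, G (clamp n y) = G y.
Proof.
move=> /andP[nx xn]; near=> y; congr G; rewrite /clamp.
have ny : - n < y by near: y; exact: lt_nbhsr.
have yn : y < n by near: y; exact: lt_nbhsl.
by rewrite !ltNge (ltW ny) (ltW yn).
Unshelve. all: by end_near. Qed.

Lemma dat_uniq (U : R -> R) x l l' : dat U x l -> dat U x l' -> l = l'.
Proof.
by move=> h1 h2; rewrite -(@derive_val _ _ _ _ _ _ _ h1) -(@derive_val _ _ _ _ _ _ _ h2).
Qed.

(** A dominated function has local densities, and these equal its derivative almost everywhere; any
    measurable a.e. derivative can therefore replace them. Product and chain rules follow from their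
    pointwise versions through this criterion. *)
Lemma ac_intro (G k g : R -> R) : dominated G k -> measurable_fun setT g ->
  {ae mu, forall x, dat G x (g x)} -> ac G g.
Proof.
move=> hG mg hg.
have H (n : nat) : exists2 gn, ac (fun x => G (clamp n%:R x)) gn &
    {ae mu, forall x, - n%:R < x < n%:R -> g x = gn x}.
  have [gn acg] := dominated_local n hG.
  exists gn => //; have := aeI hg (ac_derive acg).
  apply: aeS => x [h1 h2] hx; apply: (dat_uniq h1).
  exact: near_eq_is_derive (clamp_near G hx) h2.
have cl (n x : R) : - n <= x <= n -> clamp n x = x.
  by move=> /andP[h1 h2]; rewrite /clamp !ltNge h1 h2.
have H2 a b : exists2 gn, lig gn & {ae mu, forall x, a <= x <= b -> g x = gn x} /\
   (a <= b -> G b - G a = itg a b gn).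
  have [n nab] := nat_gt (`|a| + `|b|).
  have [gn [lgn gnE] aeg] := H n; exists gn => //; split.
    apply: aeS aeg => x h /andP[ax xb]; apply: h.
    move: nab; rewrite ger0_norm ?addr_ge0// => nab.
    have := ler_norm b; have := ler_norm (- a); rewrite normrN.
    by have := normr_ge0 a; have := normr_ge0 b; lra.
  move=> ab; rewrite -gnE// !cl//.
  - move: nab; rewrite ger0_norm ?addr_ge0//.
    have := ler_norm a; have := ler_norm (- a); rewrite normrN.
    by have := normr_ge0 b; lra.
  - move: nab; rewrite ger0_norm ?addr_ge0//.
    have := ler_norm b; have := ler_norm (- b); rewrite normrN.
    by have := normr_ge0 a; lra.
split.
  split=> // a b; apply/integrable_ind; have [gn lgn [aeg _]] := H2 a b.
  apply: igr_ae (lig_ind a b lgn).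
    by apply: measurable_funM => //; exact: ind_meas.
  apply: aeS aeg => x; rewrite /ind; case: ifP; last by rewrite !mulr0.
  by move=> _ -> .
move=> a b ab; have [gn lgn [aeg ->//]] := H2 a b.
by apply: itg_ae => //; [exact: lgn.1|apply: aeS aeg => x h /h].
Qed.

Lemma dominated_cont G k : dominated G k -> continuous G.
Proof.
move=> [lk k0 Gk] x; have [n xn] := nat_gt x.
apply/cvgrPdist_lt => e e0.
have hk := lig_ind (- n%:R) n%:R lk.
have kk0 y : 0 <= k y * ind (- n%:R) n%:R y by rewrite mulr_ge0// ind_ge0.
have [d d0 H] := itg_small hk kk0 e0.
have hx : - n%:R < x < n%:R by rewrite -ltr_norml.
have E a b : - n%:R < a -> b < n%:R -> itg a b k =
    itg a b (fun x => k x * ind (- n%:R) n%:R x).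
  move=> ha hb; apply: itg_ext => z hz; rewrite /ind ifT ?mulr1//.
  by case/andP: hz => h1 h2; rewrite (le_trans (ltW ha) h1) (le_trans h2 (ltW hb)).
case/andP: (hx) => nx xn'.
near=> y.
have dxy : `|x - y| < d by near: y; exists d.
have ny : - n%:R < y by near: y; exact: lt_nbhsr.
have yn : y < n%:R by near: y; exact: lt_nbhsl.
move: dxy; rewrite ltr_norml => dxy.
have [xy|yx] := leP x y.
  rewrite distrC (le_lt_trans (Gk _ _ xy))// E//.
  by apply: H => //; case/andP: dxy => dxy _; clear -dxy; lra.
rewrite (le_lt_trans (Gk _ _ (ltW yx)))// E//.
by apply: H; [exact: ltW|case/andP: dxy].
Unshelve. all: by end_near. Qed.

Lemma ac_dominated (U u : R -> R) : ac U u -> dominated U (fun x => `|u x|).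
Proof.
move=> [lu hU]; split; [exact: lig_norm| by []|].
by move=> a b ab; rewrite hU// itg_norm.
Qed.

Lemma ac_cont (U u : R -> R) : ac U u -> continuous U.
Proof. by move=> /ac_dominated /dominated_cont. Qed.

Lemma ac_meas (U u : R -> R) : ac U u -> measurable_fun setT U.
Proof. by move=> /ac_cont /continuous_measurable_fun. Qed.

(* A measurable candidate for the derivative is the limsup of difference quotients. *)
Lemma dominated_ac G k : dominated G k ->
  exists2 g, ac G g & forall x, `|g x| <= k x.
Proof.
move=> hG; have [lk k0 Gk] := hG.
have cG := dominated_cont hG.
have mG := continuous_measurable_fun cG.
pose q (n : nat) (x : R) : R := n.+1%:R * (G (x + n.+1%:R^-1) - G x).
pose g0 (x : R) : R := fine (limn_esup (fun n => (q n x)%:E)).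
have mg0 : measurable_fun setT g0.
  apply: measurableT_comp => //; apply: measurable_fun_limn_esup => n.
  apply/measurable_EFinP; apply: measurable_funM => //.
  by apply: measurable_funB => //; exact: measurable_shift.
have q_cvg (F : R -> R) (x l : R) : dat F x l ->
  (fun n => n.+1%:R * (F (x + n.+1%:R^-1) - F x)) @ \oo --> l.
  move=> hl; have [hd hv] := hl.
  have := hd; rewrite /derivable => /cvg_ex[l' hl'].
  have l'l : l' = l by rewrite -hv; apply/esym/cvg_lim.
  rewrite l'l in hl'.
  have hz : (fun n : nat => (n.+1%:R^-1 : R)) @ \oo --> (0 : R)^'.
    move=> P [e /= e0 HP].
    suff : \forall n \near \oo, P (n.+1%:R^-1 : R) by [].
    near=> n; apply: HP => /=.
      rewrite sub0r normrN ger0_norm//; near: n.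
      exact: (near_infty_natSinv_lt (PosNum e0)).
    by rewrite invr_eq0 pnatr_eq0.
  have := cvg_comp _ _ hz hl'; apply: cvg_trans; apply: near_eq_cvg.
  near=> n; rewrite /= invrK; congr (_ * (F _ - _)).
  by rewrite /shift /= [_%:A]mulr1 addrC.
pose Kp := prim k.
have acK : ac Kp k := ac_prim lk.
have aeG : {ae mu, forall x, exists l, dat G x l}.
  have H (n : nat) : {ae mu, forall x, - n%:R < x < n%:R -> exists l, dat G x l}.
    have [gn acg] := dominated_local n hG.
    have := ac_derive acg; apply: aeS => x hd hx; exists (gn x).
    exact: near_eq_is_derive (clamp_near G hx) hd.
  apply: aeS (ae_bigcup H) => x hx; have [n xn] := nat_gt x.
  by apply: (hx n); rewrite -ltr_norml.
(* Truncating between [- k] and [k] makes the bound hold at every point, not only where [G] is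
   differentiable. *)
pose g x := Num.max (- k x) (Num.min (k x) (g0 x)).
have mk : measurable_fun setT k by exact: lk.1.
have mg : measurable_fun setT g.
  apply: measurable_maxr; first exact: measurableT_comp.
  exact: measurable_minr.
exists g; last first.
  by move=> x; rewrite /g ler_norml le_max lexx/= ge_max ge_min lexx/= andbT; have := k0 x; lra.
apply: (ac_intro hG mg).
apply: aeS (aeI aeG (ac_derive acK)) => x [[l hl] hk].
(* At a point where both [G] and the primitive of [k] are differentiable, the quotients of [G] are
   bounded by those of the primitive, whose limit is [k x]. *)
have lk' : `|l| <= k x.
  apply: (ler_cvg_to (cvg_norm (q_cvg _ _ _ hl)) (q_cvg _ _ _ hk)).
  near=> n; rewrite normrM ger0_norm// ler_wpM2l//.
  have xx : x <= x + n.+1%:R^-1 by rewrite lerDl.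
  by rewrite acK.2// Gk.
have gl : g0 x = l.
  have h : (q n x)%:E @[n --> \oo] --> l%:E.
    by apply: cvg_EFin; [by near=> n|exact: q_cvg hl].
  by rewrite /g0 (cvg_limn_einf_sup h).2.
rewrite /g gl; move: lk'; rewrite ler_norml => /andP[h1 h2].
by rewrite min_r// max_r.
Unshelve. all: by end_near. Qed.

End density.

(** * Calculus of absolutely continuous functions and H^1 functions of one variable *)

Section abscont.
Context {R : realType}.
Local Notation mu := (@lebesgue_measure R).
Implicit Types f g h U u V v w : R -> R.

Lemma DCT (f_ : nat -> R -> R) f g :
  (forall n, measurable_fun setT (f_ n)) -> igr f -> igr g ->
  (forall n x, `|f_ n x| <= g x) -> 
  {ae mu, forall x, f_ n x @[n --> \oo] --> f x} ->
  \int[mu]_x f_ n x @[n --> \oo] --> \int[mu]_x f x.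
Proof.
move=> mf_ fi ig fg cf; have mf := igr_meas fi.
have [|||||_ _ H] := @dominated_convergence _ _ _ mu setT measurableT
   (fun n x => (f_ n x)%:E) (EFin \o f) (EFin \o g).
- by move=> n; apply/measurable_EFinP; exact: mf_.
- exact/measurable_EFinP.
- apply: aeS cf => x hx _ /=.
  by apply: cvg_EFin => //; near=> n.
- exact: ig.
- by apply: aeT => x n _ /=; rewrite lee_fin.
apply: (@fine_cvg _ _ _ _ (fun n => (\int[mu]_x (f_ n x)%:E)%E)).
by rewrite fineK//; exact: integrable_fin_num.
Unshelve. all: by end_near. Qed.

Lemma igr_tail f : igr f -> (forall x, 0 <= f x) -> forall e, 0 < e ->
  exists N : nat, forall a b, a <= - N%:R -> N%:R <= b ->
   \int[mu]_x f x - itg a b f < e.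
Proof.
move=> hf f0 e e0.
have lf := igr_lig hf.
have H : itg (- n%:R) n%:R f @[n --> \oo] --> \int[mu]_x f x.
  under eq_fun do rewrite itgE.
  apply: (DCT (g := f)) => //.
  - by move=> n; apply: measurable_funM; [exact: igr_meas hf|exact: ind_meas].
  - by move=> n x; rewrite normrM ger0_norm// ler_piMr// ind_norm.
  apply: aeT => x; apply: cvg_near_cst; near=> n.
  have nx : `|x| < n%:R.
    near: n; have [m xm] := nat_gt x; exists m => // n /= mn.
    by apply: lt_le_trans xm _; rewrite ler_nat.
  by rewrite /ind ifT ?mulr1// -ler_norml ltW.
have /cvgrPdist_lt /(_ _ e0) [N _ HN] := H.
exists N => a b aN Nb; have := HN N (leqnn N) => /=.
rewrite ltr_norml => /andP[_]; apply: le_lt_trans; rewrite lerB//.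
by apply: itg_sub => //; rewrite (@le_trans _ _ 0)// oppr_le0.
Unshelve. all: by end_near. Qed.

(** An integrable function need not tend to 0, but it cannot stay above [e] on a half-line. Points
    where it is small suffice to discard boundary terms. *)
Lemma igr_small_right f : igr f -> forall (N e : R), 0 < e ->
  exists2 x, N <= x & `|f x| < e.
Proof.
move=> hf N e e0; apply: contrapT => H.
have {}H x : N <= x -> e <= `|f x|.
  by move=> Nx; rewrite leNgt; apply/negP => h; apply: H; exists x.
have hn := igr_norm hf.
have K (m : nat) : m%:R * e <= \int[mu]_x `|f x|.
  have := @itg_int_le _ N (N + m%:R) _ hn (fun x => normr_ge0 _).
  apply: le_trans; have NN : N <= N + m%:R by rewrite lerDl.
  have := itg_cst e NN; rewrite addrAC subrr add0r mulrC => <-.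
  apply: itg_le; [exact: lig_cst|exact: igr_lig|].
  by move=> x /andP[Nx _]; exact: H.
have [m hm] := nat_gt ((\int[mu]_x `|f x|) / e).
have := K m; rewrite leNgt => /negP; apply.
by rewrite -ltr_pdivrMr// (le_lt_trans (ler_norm _)).
Qed.

Lemma ig_opp f : igr f -> igr (fun x => f (- x)).
Proof.
move=> hf; have mf := igr_meas hf.
have mof : measurable_fun setT (fun x : R => f (- x)).
  exact: (measurableT_comp mf (@oppr_measurable R setT)).
apply/integrableP; split; first exact/measurable_EFinP.
have ms : measurable_fun (setT : set (measurableTypeR R))
   ((fun x : R => - x) : measurableTypeR R -> measurableTypeR R).
  exact: oppr_measurable.
have mF : measurable_fun setT (fun x : R => `|(EFin \o f) x|%E).
  by apply: measurableT_comp => //; apply/measurable_EFinP.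
have := @ge0_integral_pushforward _ _ _ _ _ _ ms mu setT
  (fun x : R => `|(EFin \o f) x|%E) measurableT mF (fun x _ => abse_ge0 _).
rewrite preimage_setT => <-.
have /integrableP[_] := hf; apply: le_lt_trans; rewrite le_eqVlt; apply/orP; left.
apply/eqP; apply: eq_measure_integral => A mA _.
by rewrite -[RHS](lebesgue_measure_opp mA).
Qed.

Lemma igr_small_left f : igr f -> forall (N e : R), 0 < e ->
  exists2 x, x <= N & `|f x| < e.
Proof.
move=> hf N e e0; have [x Nx fx] := igr_small_right (ig_opp hf) (- N) e0.
by exists (- x) => //; rewrite lerNl.
Qed.

(** The integral of [u] is compared with its integral over [[y, x]], where the endpoints are far out
    and chosen so that [U] is small at both. *)
Lemma int_deriv0 U u : ac U u -> igr U -> igr u -> \int[mu]_x u x = 0.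
Proof.
move=> [lu hU] iU iu; apply/eqP; rewrite -normr_le0 leNgt; apply/negP => e0.
set e := `|_| in e0; have e3 : 0 < e / 3 by rewrite divr_gt0.
have inu := igr_norm iu.
have [N HN] := igr_tail inu (fun x => normr_ge0 _) e3.
have [x Nx Ux] := igr_small_right iU N%:R e3.
have [y yN Uy] := igr_small_left iU (- N%:R) e3.
have yx : y <= x.
  by rewrite (le_trans yN)// (le_trans _ Nx)// (@le_trans _ _ 0)// oppr_le0.
have h1 := HN _ _ yN Nx.
have h2 := hU _ _ yx.
have h3 : `|\int[mu]_x u x - itg y x u| <= \int[mu]_x `|u x| - itg y x (fun x => `|u x|).
  rewrite !itgE -!intB//.
  - apply: int_norm_le => //.
    + by apply: igrB => //; exact: lig_ind.
    + by apply: igrB => //; apply: lig_ind; exact: lig_norm.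
    + by move=> z; rewrite /ind; case: ifP; rewrite ?mulr1 ?mulr0 ?subrr ?subr0 ?normr0.
  - by apply: lig_ind; exact: lig_norm.
  - exact: lig_ind.
rewrite -h2 in h3.
have : e <= `|\int[mu]_x u x - (U x - U y)| + (`|U x| + `|U y|).
  rewrite /e -[X in `|X| <= _](subrK (U x - U y)).
  by apply: le_trans (ler_normD _ _) _; rewrite lerD2l ler_normB.
by lra.
Qed.

Lemma ac_uniq U u v : ac U u -> ac U v -> {ae mu, forall x, u x = v x}.
Proof.
move=> hu hv; apply: aeS (aeI (ac_derive hu) (ac_derive hv)) => x [].
exact: dat_uniq.
Qed.

Lemma ac_ext U u V v : (forall x, U x = V x) -> (forall x, u x = v x) ->
  ac U u -> ac V v.
Proof. by move=> /funext -> /funext ->. Qed.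

Lemma ligZ c u : lig u -> lig (fun x => c * u x).
Proof.
move=> lu; have := ligM lu (measurable_cst c) (fun=> lexx `|c|).
by congr lig; apply/funext => x; rewrite mulrC.
Qed.

Lemma acD U u V v : ac U u -> ac V v ->
  ac (fun x => U x + V x) (fun x => u x + v x).
Proof.
move=> [lu hU] [lv hV]; split; first exact: ligD.
by move=> a b ab; rewrite itgD// -hU// -hV//; ring.
Qed.

Lemma acZ c U u : ac U u -> ac (fun x => c * U x) (fun x => c * u x).
Proof.
move=> [lu hU]; split; first exact: ligZ.
by move=> a b ab; rewrite itgZ// -hU//; ring.
Qed.

Lemma acB U u V v : ac U u -> ac V v ->
  ac (fun x => U x - V x) (fun x => u x - v x).
Proof.
move=> hU hV; apply: ac_ext (acD hU (acZ (-1) hV)) => x; by rewrite mulN1r.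
Qed.

Lemma ac_cst (c : R) : ac (fun=> c) (fun=> 0).
Proof. by split; [exact: lig_cst|move=> a b ab; rewrite itg_cst// mul0r subrr]. Qed.

Lemma itg_shift a b c f : lig f -> itg a b (fun x => f (x + c)) = itg (a + c) (b + c) f.
Proof.
move=> lf; rewrite !itgE -(@int_shift _ (fun x => f x * ind (a + c) (b + c) x) c);
  last exact: lig_ind.
by apply: int_ext => x; rewrite /ind !lerD2r.
Qed.

Lemma lig_shift c f : lig f -> lig (fun x => f (x + c)).
Proof.
move=> lf; split; first exact: measurable_shift lf.1.
move=> a b; apply/integrable_ind.
have := igr_shift c (lig_ind (a + c) (b + c) lf); congr igr.
by apply/funext => x; rewrite /ind !lerD2r.
Qed.

Lemma ac_shift c U u : ac U u -> ac (fun x => U (x + c)) (fun x => u (x + c)).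
Proof.
move=> [lu hU]; split; first exact: lig_shift.
by move=> a b ab; rewrite itg_shift// -hU// lerD2r.
Qed.

Lemma acM C D U u V v : (forall x, `|U x| <= C) -> (forall x, `|V x| <= D) ->
  ac U u -> ac V v -> ac (fun x => U x * V x) (fun x => u x * V x + U x * v x).
Proof.
move=> UC VD hU hV; have [lu hu] := hU; have [lv hv] := hV.
have C0 : 0 <= C by apply: le_trans (UC 0).
have D0 : 0 <= D by apply: le_trans (VD 0).
have lk : lig (fun x => D * `|u x| + C * `|v x|).
  by apply: ligD; apply: ligZ; exact: lig_norm.
apply: (@ac_intro _ _ (fun x => D * `|u x| + C * `|v x|)).
- split=> //; first by move=> x; rewrite addr_ge0// mulr_ge0.
  move=> a b ab; rewrite itgD; [|by apply: ligZ; exact: lig_norm..].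
  rewrite !itgZ; [|exact: lig_norm..].
  have -> : U b * V b - U a * V a = (U b - U a) * V b + U a * (V b - V a) by ring.
  rewrite (le_trans (ler_normD _ _))// !normrM lerD//.
    by rewrite mulrC ler_pM// hu// itg_norm.
  by rewrite ler_pM// hv// itg_norm.
- apply: measurable_funD; apply: measurable_funM;
    [exact: lu.1|exact: ac_meas hV|exact: ac_meas hU|exact: lv.1].
- apply: aeS (aeI (ac_derive hU) (ac_derive hV)) => x [h1 h2].
  apply: is_derive_eq (is_deriveM h1 h2) _.
  by rewrite /GRing.scale/=; ring.
Qed.

(** The predicate [P] contains the range of [U]: the outer function has to be Lipschitz and
    differentiable only there, for example on a half-line or a segment. *)
Lemma ac_comp (P : R -> Prop) L (h dh : R -> R) U u : ac U u -> (forall x, P (U x)) ->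
  (forall a b, P a -> P b -> `|h a - h b| <= L * `|a - b|) ->
  (forall a, P a -> dat h a (dh a)) -> measurable_fun setT (fun x => dh (U x)) ->
  ac (fun x => h (U x)) (fun x => dh (U x) * u x).
Proof.
move=> hU UC hL hd mdh; have [lu hu] := hU.
have lk : lig (fun x => `|L| * `|u x|) by apply: ligZ; exact: lig_norm.
apply: (@ac_intro _ _ (fun x => `|L| * `|u x|)).
- split=> // a b ab; rewrite itgZ; last exact: lig_norm.
  rewrite (le_trans (hL _ _ (UC _) (UC _)))//.
  apply: (@le_trans _ _ (`|L| * `|U b - U a|)); first by rewrite ler_wpM2r// ler_norm.
  by rewrite ler_wpM2l// hu// itg_norm.
- by apply: measurable_funM => //; exact: lu.1.
- apply: aeS (ac_derive hU) => x h1.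
  exact: is_derive1_comp (hd _ (UC x)) h1.
Qed.

(** The value at the origin is 1 rather than 0, so that the square is 1 everywhere. *)
Definition sg (x : R) : R := if 0 <= x then 1 else -1.

Lemma sg_meas : measurable_fun setT sg.
Proof.
apply: measurable_fun_ifT => //.
exact: measurable_fun_ler.
Qed.

Lemma sg_norm x : `|sg x| = 1.
Proof. by rewrite /sg; case: ifP; rewrite ?normrN normr1. Qed.

Lemma sg_le x : `|sg x| <= 1.
Proof. by rewrite sg_norm. Qed.

Lemma sg_sq x : sg x * sg x = 1.
Proof. by rewrite /sg; case: ifP; rewrite ?mulrNN mulr1. Qed.

Lemma itgN a b u : lig u -> itg a b (fun x => - u x) = - itg a b u.
Proof.
move=> lu; rewrite -mulN1r -itgZ//; apply: itg_ext => x _; by rewrite mulN1r.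
Qed.

Lemma lig_sg u : lig u -> lig (fun x => sg x * u x).
Proof.
move=> lu; have := ligM lu sg_meas sg_le.
by congr lig; apply/funext => x; rewrite mulrC.
Qed.

Lemma itg_sg_pos a b u : 0 <= a -> itg a b (fun x => sg x * u x) = itg a b u.
Proof.
move=> a0; apply: itg_ext => x /andP[ax _].
by rewrite /sg (le_trans a0 ax) mul1r.
Qed.

Lemma itg_sg_neg a b u : lig u -> b <= 0 -> itg a b (fun x => sg x * u x) = - itg a b u.
Proof.
move=> lu b0; rewrite -itgN//; apply: itg_ae.
- by apply: measurable_funM; [exact: sg_meas|exact: lu.1].
- by apply: measurableT_comp => //; exact: lu.1.
have : {ae mu, forall x, x != 0}.
  exists [set 0]; split; [exact: measurable_set1|exact: lebesgue_measure_set1|].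
  by move=> x /= /negP; rewrite negbK => /eqP.
apply: aeS => x x0 /andP[_ xb].
by rewrite /sg leNgt lt_neqAle x0 (le_trans xb b0)/= mulN1r.
Qed.

(** Multiplication by the sign produces no jump at the origin because [U 0 = 0]. Through this lemma
    the oddness of the solution enters every weighted estimate. *)
Lemma ac_sg U u : ac U u -> U 0 = 0 -> ac (fun x => sg x * U x) (fun x => sg x * u x).
Proof.
move=> [lu hu] U0; split; first exact: lig_sg.
move=> a b ab; have lsu := lig_sg lu.
have [a0|a0] := leP 0 a.
  rewrite itg_sg_pos// -hu// /sg a0 (le_trans a0 ab); ring.
have [b0|b0] := ltP b 0.
  rewrite itg_sg_neg// ?ltW// -hu// /sg !leNgt a0 b0 /=; ring.
rewrite (itg_cat lsu (ltW a0) b0) itg_sg_neg// itg_sg_pos// -!hu// ?ltW//.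
by rewrite /sg b0 leNgt a0/= U0; ring.
Qed.

(* [U] is the continuous representative of an [H^1] function with weak derivative [u]. *)
Definition sob U u : Prop := [/\ L2R U, L2R u & ac U u].

Lemma sobD U u V v : sob U u -> sob V v ->
  sob (fun x => U x + V x) (fun x => u x + v x).
Proof.
by move=> [? ? ?] [? ? ?]; split; [exact: L2RD|exact: L2RD|exact: acD].
Qed.

Lemma sobB U u V v : sob U u -> sob V v ->
  sob (fun x => U x - V x) (fun x => u x - v x).
Proof.
by move=> [? ? ?] [? ? ?]; split; [exact: L2RB|exact: L2RB|exact: acB].
Qed.

Lemma sobZ c U u : sob U u -> sob (fun x => c * U x) (fun x => c * u x).
Proof.
by move=> [? ? ?]; split; [exact: L2RZ|exact: L2RZ|exact: acZ].
Qed.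

Lemma sob_shift c U u : sob U u -> sob (fun x => U (x + c)) (fun x => u (x + c)).
Proof.
by move=> [? ? ?]; split; [exact: L2R_shift|exact: L2R_shift|exact: ac_shift].
Qed.

Lemma sob0 : sob (fun=> 0) (fun=> 0).
Proof. by split; [exact: L2R0|exact: L2R0|exact: ac_cst]. Qed.

(** Somewhere in [[x, x + 1]] the function is at most [nrm U + 1] in modulus, and by Cauchy-Schwarz
    it varies by at most [nrm u] from there. The constant is crude: the lemma serves where a finite
    bound is enough. *)
Lemma sob_bounded U u x : sob U u -> `|U x| <= nrm U + nrm u + 1.
Proof.
move=> [hU hu acU].
have [z /andP[xz zx] Uz] : exists2 z, x <= z <= x + 1 & `|U z| <= nrm U + 1.
  apply: contrapT => H.
  have {}H z : x <= z <= x + 1 -> (nrm U + 1) ^+ 2 <= U z ^+ 2.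
    move=> hz; rewrite -[leRHS]real_normK ?num_real// lerXn2r ?nnegrE ?addr_ge0 ?nrm_ge0//.
    by rewrite leNgt; apply/negP => h; apply: H; exists z => //; exact: ltW.
  have : (nrm U + 1) ^+ 2 <= nrm U ^+ 2.
    rewrite nrm_sq ip_int; apply: le_trans (@itg_int_le _ x (x + 1) _ hU.2 (fun=> sqr_ge0 _)).
    have x1 : x <= x + 1 by rewrite lerDl.
    have := itg_cst ((nrm U + 1) ^+ 2) x1; rewrite addrAC subrr add0r mulr1 => <-.
    by apply: itg_le; [exact: lig_cst|exact: igr_lig hU.2|].
  have := nrm_ge0 U; nra.
have h : (U z - U x) ^+ 2 <= nrm u ^+ 2.
  rewrite acU.2//; apply: le_trans (itg_sq hu xz) _.
  rewrite nrm_sq ip_int; apply: le_trans (@itg_int_le _ x z _ hu.2 (fun=> sqr_ge0 _)).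
  rewrite ler_piMl//; first by apply: lig_itg_ge0 => y; exact: sqr_ge0.
  by lra.
have {}h : `|U z - U x| <= nrm u.
  by rewrite -(@ler_pXn2r _ 2)// ?nnegrE ?nrm_ge0// real_normK ?num_real.
have : `|U x| <= `|U z| + `|U z - U x|.
  by rewrite -[X in `|X| <= _](subKr (U z)); exact: ler_normB.
by lra.
Qed.

Lemma igr_ip f g : L2R f -> L2R g -> igr (fun x => f x * g x).
Proof. exact: L2R_igrM. Qed.

Lemma sob_acM U u V v : sob U u -> sob V v ->
  ac (fun x => U x * V x) (fun x => u x * V x + U x * v x).
Proof.
move=> hU hV; have [_ _ aU] := hU; have [_ _ aV] := hV.
exact: acM (fun x => sob_bounded x hU) (fun x => sob_bounded x hV) aU aV.
Qed.

Lemma sob_ibp U u V v : sob U u -> sob V v -> ip u V = - ip U v.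
Proof.
move=> hU hV; have [U2 u2 _] := hU; have [V2 v2 _] := hV.
have iuV := igr_ip u2 V2; have iUv := igr_ip U2 v2.
have := int_deriv0 (sob_acM hU hV) (igr_ip U2 V2) (igrD iuV iUv).
rewrite intD// => /eqP; rewrite addr_eq0 => /eqP; exact.
Qed.

(** The derivative [2 U u] of [U^2] is integrated from a point to the left of [x] where [U^2] is
    below [e]. In contrast to [sob_bounded], the bound is small when the norms are. *)
Lemma sob_sup U u x : sob U u -> U x ^+ 2 <= 2 * nrm U * nrm u.
Proof.
move=> hU; have [U2 u2 aU] := hU; apply/ler_addgt0Pr => e e0.
have [z zx Uz] := igr_small_left U2.2 x e0.
have aUU := sob_acM hU hU.
have := aUU.2 _ _ zx; have iUu := igr_ip u2 U2.
have := @itg_int_le _ z x _ (igr_norm (igrZ 2 iUu)) (fun=> normr_ge0 _).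
have -> : \int[mu]_y `|2 * (u y * U y)| = 2 * ip (fun y => `|U y|) (fun y => `|u y|).
  rewrite /ip -intZ; last by apply: igr_ip; exact: L2R_norm.
  by apply: int_ext => y; rewrite !normrM ger0_norm// [_ * `|U y|]mulrC.
have := CS (L2R_norm U2) (L2R_norm u2); rewrite ler_norml => /andP[_].
have e1 f : L2R f -> nrm (fun y => `|f y|) = nrm f.
  by move=> hf; congr Num.sqrt; apply: int_ext => y; rewrite -normrM ger0_norm// -expr2 sqr_ge0.
rewrite !e1// => h1 h2 h3.
have h4 : itg z x (fun y => u y * U y + U y * u y) <=
    itg z x (fun y => `|2 * (u y * U y)|).
  apply: itg_le; [exact: aUU.1|exact: igr_lig (igr_norm (igrZ 2 iUu))|].
  by move=> y _; apply: le_trans (ler_norm _); lra.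
by move: Uz; rewrite ger0_norm ?sqr_ge0// => Uz; rewrite expr2; rewrite expr2 in Uz; lra.
Qed.

Lemma sob_mulw C D w w1 U u : ac w w1 -> (forall x, `|w x| <= C) ->
  (forall x, `|w1 x| <= D) -> sob U u ->
  sob (fun x => w x * U x) (fun x => w1 x * U x + w x * u x).
Proof.
move=> aw wC wD hU; have [U2 u2 aU] := hU; split.
- exact: L2R_mulb U2 (ac_meas aw) wC.
- apply: L2RD; first exact: L2R_mulb U2 aw.1.1 wD.
  exact: L2R_mulb u2 (ac_meas aw) wC.
- exact: acM wC (fun x => sob_bounded x hU) aw aU.
Qed.

End abscont.

(** * Difference quotients in L^2 *)

Section difference_quotients.
Context {R : realType}.
Local Notation mu := (@lebesgue_measure R).
Implicit Types f g h U u V v w : R -> R.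

Lemma ind_sub (a x y : R) : ind x (x + a) y = ind 0 a (y - x).
Proof. by rewrite /ind subr_ge0 lerBlDl. Qed.

Lemma ind_sub' (a x y : R) : ind 0 a (y - x) = ind (y - a) y x.
Proof. by rewrite /ind subr_ge0 lerBlDr andbC lerBlDl addrC. Qed.

(** Tonelli's theorem on the strip [0 <= y - x <= a], whose sections in either direction are
    segments of length [a]. *)
Lemma int_itg (a : R) g : 0 < a -> igr g -> (forall x, 0 <= g x) ->
  igr (fun x => itg x (x + a) g) /\
  \int[mu]_x itg x (x + a) g = a * \int[mu]_x g x.
Proof.
move=> a0 ig g0; have mg := igr_meas ig.
pose F (p : R * R) : \bar R := (g p.2 * ind 0 a (p.2 - p.1))%:E.
have mF : measurable_fun setT F.
  apply/measurable_EFinP; apply: measurable_funM.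
    exact: measurableT_comp mg measurable_snd.
  apply: (measurableT_comp (ind_meas 0 a)).
  by apply: measurable_funB; [exact: measurable_snd|exact: measurable_fst].
have F0 p : (0 <= F p)%E by rewrite lee_fin mulr_ge0// ind_ge0.
have H := @fubini_tonelli _ _ _ _ R mu mu F mF F0.
have E1 x : (\int[mu]_y F (x, y) = (itg x (x + a) g)%:E)%E.
  rewrite itgE fineK.
    by apply: eq_integral => y _; rewrite /F/= -ind_sub.
  by apply: integrable_fin_num => //; exact: lig_ind (igr_lig ig).
have E2 y : (\int[mu]_x F (x, y) = (a * g y)%:E)%E.
  transitivity ((\int[mu]_x (g y * ind (y - a) y x))%:E).
    rewrite fineK.
      by apply: eq_integral => x _; rewrite /F/= ind_sub'.
    by apply: integrable_fin_num => //; exact: igrZ (igr_ind1 _ _).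
  rewrite intZ; last exact: igr_ind1.
  have -> : \int[mu]_x ind (y - a) y x = a.
    rewrite (int_ext (g := fun x => 1 * ind (y - a) y x)); last by move=> x; rewrite mul1r.
    rewrite -itgE itg_cst; last by rewrite gerBl ltW.
    by rewrite mul1r opprB addrC subrK.
  by rewrite mulrC.
have {}H : (\int[mu]_x (itg x (x + a) g)%:E = \int[mu]_y (a * g y)%:E)%E.
  transitivity (\int[mu]_x \int[mu]_y F (x, y))%E.
    by apply: eq_integral => x _; rewrite E1.
  by rewrite H; apply: eq_integral => y _; rewrite E2.
have ig2 : mu.-integrable setT (EFin \o (fun x => a * g x)) by exact: igrZ.
have mI : measurable_fun setT (fun x => itg x (x + a) g).
  apply/measurable_EFinP.
  have := @measurable_fun_fubini_tonelli_F _ _ _ _ R mu F mF F0.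
  by congr measurable_fun; apply/funext => x; rewrite /fubini_F E1.
have ii : igr (fun x => itg x (x + a) g).
  apply/integrableP; split; first exact/measurable_EFinP.
  have : (\int[mu]_x (itg x (x + a) g)%:E < +oo)%E.
    by rewrite H; have := integrable_fin_num measurableT ig2;
      rewrite fin_numE => /andP[_]; rewrite ltey.
  apply: le_lt_trans; rewrite le_eqVlt; apply/orP; left; apply/eqP.
  apply: eq_integral => x _; rewrite /= ger0_norm//.
  exact: lig_itg_ge0.
split=> //; rewrite -intZ//; congr fine; exact: H.
Qed.

Definition dq (a : R) U x : R := a^-1 * (U (x + a) - U x).

Lemma L2R_dq a U : L2R U -> L2R (dq a U).
Proof. by move=> hU; apply: L2RZ; apply: L2RB => //; exact: L2R_shift. Qed.

Lemma sob_dq a U u : sob U u -> sob (dq a U) (dq a u).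
Proof. by move=> hU; apply: sobZ; apply: sobB => //; exact: sob_shift. Qed.

Lemma dq_opp a U x : dq a U x = dq (- a) U (x + a).
Proof. by rewrite /dq addrK invrN mulNr -mulrN opprB. Qed.

(** By Cauchy-Schwarz the square of the quotient at [x] is at most [a^-1] times the integral of
    [u^2] over [[x, x + a]], and [int_itg] integrates this in [x]. A negative step reduces to a
    positive one by translation. *)
Lemma nrm_dq a U u : sob U u -> a != 0 -> nrm (dq a U) <= nrm u.
Proof.
wlog a0 : a / 0 < a.
  move=> H hU an; have [a0|a0] := ltP 0 a; first exact: H.
  have -> : nrm (dq a U) = nrm (dq (- a) U).
    rewrite (nrm_ext (dq_opp a U)) nrm_shift//; apply: L2R_dq; by case: hU.
  by apply: H => //; rewrite ?oppr_eq0// oppr_gt0 lt_neqAle an.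
move=> [U2 u2 aU] _; rewrite /nrm ler_wsqrtr// !ip_int.
have [i1 e1] := int_itg a0 u2.2 (fun=> sqr_ge0 _).
have -> : \int[mu]_x u x ^+ 2 = \int[mu]_x (a^-1 * itg x (x + a) (fun y => u y ^+ 2)).
  by rewrite intZ// e1 mulrA mulVf ?mul1r// gt_eqF.
apply: int_le; [by case: (L2R_dq a U2)|exact: igrZ|].
move=> x; have xa : x <= x + a by rewrite lerDl ltW.
rewrite /dq aU.2// exprMn; have := itg_sq u2 xa; rewrite addrAC subrr add0r.
move=> h; rewrite expr2 -mulrA ler_wpM2l ?invr_ge0 ?(ltW a0)//.
by rewrite mulrC ler_pdivrMr// mulrC.
Qed.

Lemma int0 : \int[mu]_x (0 : R) = 0.
Proof. by rewrite Rintegral_cst//= mul0r. Qed.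

Lemma nrm0 : nrm (fun=> 0 : R) = 0.
Proof. by rewrite /nrm ip_int (int_ext (g := fun=> 0)) ?int0 ?sqrtr0// => x; rewrite expr0n. Qed.

Lemma nrm_shiftB a U u : sob U u -> nrm (fun x => U (x + a) - U x) <= `|a| * nrm u.
Proof.
move=> hU; have [U2 _ _] := hU.
have [->|a0] := eqVneq a 0.
  rewrite normr0 mul0r (nrm_ext (g := fun=> 0)); last by move=> x; rewrite addr0 subrr.
  by rewrite nrm0.
rewrite (nrm_ext (g := fun x => a * dq a U x)).
  by rewrite nrmZ ?ler_wpM2l ?nrm_dq//; exact: L2R_dq.
by move=> x; rewrite /dq mulrA mulfV// mul1r.
Qed.

Lemma limn_einf_ub (s : nat -> \bar R) c : (forall n, s n <= c)%E -> (limn_einf s <= c)%E.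
Proof.
move=> sc; rewrite limn_einf_lim; apply: lime_le; first exact: is_cvg_einfs.
apply: nearW => n; apply: le_trans (sc n).
by apply: ereal_inf_lbound; exists n => //=.
Qed.

(* A.e. convergence together with [nrm (dq a U) <= nrm u] forces strong
   convergence: Fatou's lemma is applied to the squares of [dq a U + u]. *)
Lemma dq_cvg U u : sob U u -> forall e, 0 < e -> 
  exists2 d, 0 < d & forall a, a != 0 -> `|a| < d -> nrm (fun x => dq a U x - u x) < e.
Proof.
move=> hU e e0; have [U2 u2 aU] := hU; apply: contrapT => H.
have {}H (n : nat) : exists a, [/\ a != 0, `|a| < n.+1%:R^-1 &
    e <= nrm (fun x => dq a U x - u x)].
  apply: contrapT => H'; apply: H; exists n.+1%:R^-1 => // a a0 an.
  by rewrite ltNge; apply/negP => h; apply: H'; exists a.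
have [s hs] := choice H.
have s0 : s @ \oo --> (0 : R)^'.
  move=> P [r /= r0 HP].
  suff : \forall n \near \oo, P (s n) by [].
  near=> n; have [h1 h2 _] := hs n; apply: HP => //=.
  rewrite sub0r normrN (lt_trans h2)//; near: n.
  exact: (near_infty_natSinv_lt (PosNum r0)).
have qc : {ae mu, forall x, (fun n => dq (s n) U x) @ \oo --> u x}.
  apply: aeS (ac_derive aU) => x [hd hv].
  have := hd; rewrite /derivable => /cvg_ex[l' hl'].
  have l'l : l' = u x by rewrite -hv; apply/esym/cvg_lim.
  rewrite l'l in hl'.
  have := cvg_comp _ _ s0 hl'; apply: cvg_trans; apply: near_eq_cvg.
  near=> n; rewrite /= /dq; congr (_ * (U _ - _)).
  by rewrite /shift /= [_%:A]mulr1 addrC.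
pose F n x := (dq (s n) U x + u x) ^+ 2.
have LF n : L2R (fun x => dq (s n) U x + u x) by apply: L2RD => //; exact: L2R_dq.
(* By the parallelogram identity, a distance of at least [e] between [dq (s n) U] and [u] costs
   [e^2] in the squared norm of their sum, since neither norm exceeds [nrm u]. *)
have IF n : \int[mu]_x F n x <= 4 * nrm u ^+ 2 - e ^+ 2.
  have [h1 _ h3] := hs n.
  have q2 := L2R_dq (s n) U2.
  have := nrm_dq hU h1.
  have E1 : nrm (fun x => dq (s n) U x - u x) ^+ 2 =
     nrm (dq (s n) U) ^+ 2 + nrm u ^+ 2 - 2 * ip (dq (s n) U) u.
    rewrite !nrm_sq ipBl//; last by apply: L2RB.
    rewrite !ipBr// (ipC u); ring.
  have E2 : \int[mu]_x F n x =
     nrm (dq (s n) U) ^+ 2 + nrm u ^+ 2 + 2 * ip (dq (s n) U) u.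
    have -> : \int[mu]_x F n x =
      ip (fun x => dq (s n) U x + u x) (fun x => dq (s n) U x + u x) by rewrite ip_int.
    rewrite !nrm_sq ipDl//.
    rewrite !ipDr// (ipC u); ring.
  move=> h4; rewrite E2.
  have h5 : e ^+ 2 <= nrm (fun x => dq (s n) U x - u x) ^+ 2.
    by rewrite lerXn2r// nnegrE ?nrm_ge0 ?ltW.
  have h6 : nrm (dq (s n) U) ^+ 2 <= nrm u ^+ 2 by rewrite lerXn2r// nnegrE nrm_ge0.
  rewrite E1 in h5; lra.
have mF n : measurable_fun setT (fun x => (F n x)%:E).
  by apply/measurable_EFinP; apply: measurable_funX; exact: (LF n).1.
have F0 n x : setT x -> (0 <= (F n x)%:E)%E by move=> _; rewrite lee_fin sqr_ge0.
have := @fatou _ _ R mu setT measurableT (fun n x => (F n x)%:E) mF F0.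
have -> : (\int[mu]_x limn_einf (fun n => (F n x)%:E) = (4 * nrm u ^+ 2)%:E)%E.
  have i4 : igr (fun x => 4 * u x ^+ 2) by apply: igrZ; exact: u2.2.
  transitivity ((\int[mu]_x (4 * u x ^+ 2))%:E); last first.
    by rewrite intZ ?nrm_sq ?ip_int//; exact: u2.2.
  rewrite fineK; last exact: integrable_fin_num i4.
  apply: ae_eq_integral => //.
  - rewrite /limn_einf; apply: measurableT_comp => //.
    apply: measurable_fun_limn_esup => n.
    by apply: measurableT_comp => //; exact: mF.
  - by apply/measurable_EFinP; exact: igr_meas i4.
  apply: aeS qc => x hx _.
  have hF : (fun n => (F n x)%:E) @ \oo --> (4 * u x ^+ 2)%:E.
    apply: cvg_EFin; first by near=> n.
    have -> : 4 * u x ^+ 2 = (u x + u x) * (u x + u x) by ring.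
    rewrite (_ : _ \o _ = (fun n => (dq (s n) U x + u x) * (dq (s n) U x + u x))); last first.
      by apply/funext => n /=; rewrite /F expr2.
    by apply: cvgM; apply: cvgD => //; exact: cvg_cst.
  by rewrite (cvg_limn_einf_sup hF).1.
have le2 : (limn_einf (fun n => \int[mu]_x (F n x)%:E) <= (4 * nrm u ^+ 2 - e ^+ 2)%:E)%E.
  apply: limn_einf_ub => n; have := IF n; rewrite -lee_fin fineK//.
  by apply: integrable_fin_num => //; exact: (LF n).2.
move=> /le_trans /(_ le2); rewrite lee_fin.
have : 0 < e ^+ 2 by rewrite exprn_gt0.
lra.
Unshelve. all: by end_near. Qed.

End difference_quotients.

(** * Time-dependent functions and conservation laws *)

Section curves.
Context {R : realType}.
Local Notation mu := (@lebesgue_measure R).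
Implicit Types (f g h U u V v w : R -> R) (X Y K L : R -> R -> R).

Lemma dat_intro (F : R -> R) (x l : R) :
  (forall e, 0 < e -> \forall h \near 0^', `|h^-1 * (F (x + h) - F x) - l| <= e) ->
  dat F x l.
Proof.
move=> H.
have c : h^-1 *: ((F \o shift x) h%:A - F x) @[h --> 0^'] --> l.
  apply/cvgrPdist_le => e e0; have := H _ e0; apply: filterS => h.
  by rewrite distrC /= [_%:A]mulr1 /shift/= (addrC h).
have d : derivable F x 1 by apply/cvg_ex; exists l.
by apply: DeriveDef => //; exact/cvg_lim.
Qed.

Lemma dat_cont (F : R -> R) x l : dat F x l -> {for x, continuous F}.
Proof.
move=> [d _]; apply: differentiable_continuous; exact/derivable1_diffP.
Qed.

Lemma dat_mvt (F l : R -> R) (a b c : R) : a <= b ->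
  (forall x, a <= x <= b -> dat F x (l x)) ->
  (forall x, a <= x <= b -> c <= l x) -> c * (b - a) <= F b - F a.
Proof.
rewrite le_eqVlt => /predU1P[->|ab] hd hl; first by rewrite !subrr mulr0.
have [||x] := @MVT _ F l a b ab.
- by move=> x; rewrite in_itv/= => /andP[ax xb]; apply: hd; rewrite !ltW.
- apply: derivable_within_continuous => x; rewrite in_itv/= => /hd [].
  by [].
rewrite in_itv/= => /andP[ax xb] ->.
by rewrite ler_wpM2r// ?subr_ge0 ?(ltW ab)// hl// !ltW.
Qed.

Lemma dat_mvt_abs (F l : R -> R) (a b c : R) : a <= b ->
  (forall x, a <= x <= b -> dat F x (l x)) ->
  (forall x, a <= x <= b -> `|l x| <= c) -> `|F b - F a| <= c * (b - a).
Proof.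
move=> ab hd hl; rewrite ler_norml; apply/andP; split.
  rewrite -mulNr; apply: (dat_mvt ab hd) => x /hl; rewrite ler_norml => /andP[] //.
have hd' x : a <= x <= b -> dat (fun x => - F x) x (- l x).
  by move=> /hd h; exact: is_deriveN h.
have := dat_mvt (c := - c) ab hd'; rewrite mulNr.
move=> H; have : - (c * (b - a)) <= - F b - - F a.
  by apply: H => x /hl; rewrite ler_norml lerN2 => /andP[].
by lra.
Qed.

Lemma datD (F G : R -> R) x l k : dat F x l -> dat G x k ->
  dat (fun x => F x + G x) x (l + k).
Proof. by move=> h1 h2; exact: is_deriveD h1 h2. Qed.

Lemma datB (F G : R -> R) x l k : dat F x l -> dat G x k ->
  dat (fun x => F x - G x) x (l - k).
Proof. by move=> h1 h2; exact: is_deriveB h1 h2. Qed.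

Lemma datZ c (F : R -> R) x l : dat F x l -> dat (fun x => c * F x) x (c * l).
Proof. by move=> h1; exact: is_deriveZ h1. Qed.

Lemma dat_eq (F : R -> R) x l k : dat F x l -> l = k -> dat F x k.
Proof. by move=> h <-. Qed.

Lemma dat_ext (F G : R -> R) x l : (forall x, F x = G x) -> dat F x l -> dat G x l.
Proof. by move=> /funext ->. Qed.

(** Continuity in time with values in H^1, where [X1 t] is the derivative of [X t] in space; the sum
    of the two L^2 norms stands for the Hilbert norm. *)
Definition curve X X1 : Prop :=
  (forall t, sob (X t) (X1 t)) /\
  forall t0 e, 0 < e -> \forall t \near t0,
    nrm (fun x => X t x - X t0 x) + nrm (fun x => X1 t x - X1 t0 x) < e.

(* [d/dt X = K0 - d/dx K1] in [H^-1]; the error is uniform over the [H^1] unit ball. *)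
Definition wder X K0 K1 : Prop :=
  [/\ forall t, L2R (K0 t), forall t, L2R (K1 t) &
  forall t e, 0 < e -> \forall h \near 0^', forall phi phi1, sob phi phi1 ->
    `|h^-1 * ip (fun x => X (t + h) x - X t x) phi - (ip (K0 t) phi + ip (K1 t) phi1)|
    <= e * (nrm phi + nrm phi1)].

Lemma near0_shift (P : R -> Prop) t : (\forall s \near t, P s) ->
  \forall h \near 0^', P (t + h).
Proof.
move=> [e /= e0 H]; exists e => //= h h1 _; apply: H => /=.
by move: h1; rewrite /ball_/= sub0r opprD addrA subrr sub0r.
Qed.

Lemma wder_shift c X K0 K1 : (forall t, L2R (X t)) -> wder X K0 K1 ->
  wder (fun t x => X t (x + c)) (fun t x => K0 t (x + c)) (fun t x => K1 t (x + c)).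
Proof.
move=> X2 [h0 h1 H]; split; [by move=> t; exact: L2R_shift..|move=> t e e0].
have := H t e e0; apply: filterS => h Hh phi phi1 hphi.
have [p2 p12 _] := hphi.
have := Hh _ _ (sob_shift (- c) hphi).
rewrite !nrm_shift//.
have sh F G : L2R F -> L2R G -> ip F (fun x => G (x - c)) = ip (fun x => F (x + c)) G.
  move=> F2 G2; rewrite -(@ip_shift _ F _ c)//; last exact: L2R_shift.
  by congr ip; apply/funext => x; rewrite addrK.
by rewrite !sh//; apply: L2RB; exact: X2.
Qed.

(** The weight is moved onto the test function; the term [w1 * phi] in the derivative of [w * phi]
    is what adds [w1 * K1] to the part of order zero. *)
Lemma wder_mulw C D w w1 X K0 K1 : ac w w1 -> (forall x, `|w x| <= C) ->
  (forall x, `|w1 x| <= D) -> (forall t, L2R (X t)) -> wder X K0 K1 ->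
  wder (fun t x => w x * X t x) (fun t x => w x * K0 t x + w1 x * K1 t x)
       (fun t x => w x * K1 t x).
Proof.
move=> aw wC wD X2 [h0 h1 H].
have mw := ac_meas aw; have mw1 := aw.1.1.
have L1 t : L2R (fun x => w x * K0 t x) by exact: L2R_mulb (h0 t) mw wC.
have L2 t : L2R (fun x => w1 x * K1 t x) by exact: L2R_mulb (h1 t) mw1 wD.
have L3 t : L2R (fun x => w x * K1 t x) by exact: L2R_mulb (h1 t) mw wC.
split; [by move=> t; exact: L2RD|by []|move=> t e e0].
have C0 : 0 <= C by apply: le_trans (wC 0).
have D0 : 0 <= D by apply: le_trans (wD 0).
have e1 : 0 < e / (C + D + 1) by rewrite divr_gt0// ltr_wpDl// addr_ge0.
have := H t _ e1; apply: filterS => h Hh phi phi1 hphi.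
have [p2 p12 _] := hphi.
have hw := sob_mulw aw wC wD hphi.
have := Hh _ _ hw.
have mv F : ip (fun x => w x * F x) phi = ip F (fun x => w x * phi x).
  by apply: int_ext => x; ring.
have W1 : L2R (fun x => w x * phi1 x) by exact: L2R_mulb p12 mw wC.
have W2 : L2R (fun x => w1 x * phi x) by exact: L2R_mulb p2 mw1 wD.
have -> : ip (fun x => w x * X (t + h) x - w x * X t x) phi =
   ip (fun x => X (t + h) x - X t x) (fun x => w x * phi x).
  by rewrite -mv; apply: int_ext => x; ring.
have -> : ip (K0 t) (fun x => w x * phi x) +
   ip (K1 t) (fun x => w1 x * phi x + w x * phi1 x) =
   ip (fun x => w x * K0 t x + w1 x * K1 t x) phi + ip (fun x => w x * K1 t x) phi1.
  rewrite ipDr// ipDl// mv addrA; congr (_ + _ + _); apply: int_ext => x; ring.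
move=> /le_trans; apply.
have n1 := nrm_mulb p2 mw wC.
have n2 := nrm_mulb p2 mw1 wD.
have n3 := nrm_mulb p12 mw wC.
have n4 := nrmD W2 W1.
have -> : e * (nrm phi + nrm phi1) = e / (C + D + 1) * ((C + D + 1) * (nrm phi + nrm phi1)).
  rewrite mulrA divfK// gt_eqF// ltr_wpDl// addr_ge0//.
rewrite ler_wpM2l ?(ltW e1)//.
have := mulr_ge0 D0 (nrm_ge0 phi1).
by have := nrm_ge0 phi; have := nrm_ge0 phi1; lra.
Qed.

Lemma curve_shift c X X1 : curve X X1 ->
  curve (fun t x => X t (x + c)) (fun t x => X1 t (x + c)).
Proof.
move=> [hX cX]; split; first by move=> t; exact: sob_shift.
move=> t0 e e0; have := cX t0 e e0; apply: filterS => t.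
have [a1 a2 _] := hX t; have [b1 b2 _] := hX t0.
rewrite (@nrm_shift _ (fun x => X t x - X t0 x)); last exact: L2RB.
by rewrite (@nrm_shift _ (fun x => X1 t x - X1 t0 x)); last exact: L2RB.
Qed.

Lemma curve_mulw C D w w1 X X1 : ac w w1 -> (forall x, `|w x| <= C) ->
  (forall x, `|w1 x| <= D) -> curve X X1 ->
  curve (fun t x => w x * X t x) (fun t x => w1 x * X t x + w x * X1 t x).
Proof.
move=> aw wC wD [hX cX]; split; first by move=> t; exact: sob_mulw aw wC wD (hX t).
move=> t0 e e0.
have mw := ac_meas aw; have mw1 := aw.1.1.
have C0 : 0 <= C by apply: le_trans (wC 0).
have D0 : 0 <= D by apply: le_trans (wD 0).
have P : 0 < C + D + 1 by rewrite ltr_wpDl// addr_ge0.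
have e1 : 0 < e / (C + D + 1) by rewrite divr_gt0.
have := cX t0 _ e1; apply: filterS => t.
have [a1 a2 _] := hX t; have [b1 b2 _] := hX t0.
have d0 := L2RB a1 b1; have d1 := L2RB a2 b2.
rewrite ltr_pdivlMr//; apply: le_lt_trans.
have n1 := nrm_mulb d0 mw wC.
have n2 := nrm_mulb d0 mw1 wD.
have n3 := nrm_mulb d1 mw wC.
have n4 := nrmD (L2R_mulb d0 mw1 wD) (L2R_mulb d1 mw wC).
have e2 : nrm (fun x => w x * X t x - w x * X t0 x) = nrm (fun x => w x * (X t x - X t0 x)).
  by apply: nrm_ext => x; ring.
have e3 : nrm (fun x => w1 x * X t x + w x * X1 t x - (w1 x * X t0 x + w x * X1 t0 x)) =
    nrm (fun x => w1 x * (X t x - X t0 x) + w x * (X1 t x - X1 t0 x)).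
  by apply: nrm_ext => x; ring.
rewrite e2 e3.
move: n1 n2 n3 n4.
set q0 := nrm (fun x => X t x - X t0 x); set q1 := nrm (fun x => X1 t x - X1 t0 x).
have q00 : 0 <= q0 by exact: nrm_ge0.
have q10 : 0 <= q1 by exact: nrm_ge0.
by have := mulr_ge0 D0 q10; lra.
Qed.

(** The increment of the pairing is the increment of [X] tested against [Y t], plus that of [Y]
    tested against [X (t + h)]. The second test function moves with [h], which is why [wder] asks
    for an error uniform over H^1; continuity in H^1 then replaces it by [X t]. *)
Lemma leibniz X X1 Y Y1 K0 K1 L0 L1 t : curve X X1 -> curve Y Y1 ->
  wder X K0 K1 -> wder Y L0 L1 ->
  dat (fun t => ip (X t) (Y t)) t
    (ip (K0 t) (Y t) + ip (K1 t) (Y1 t) + (ip (L0 t) (X t) + ip (L1 t) (X1 t))).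
Proof.
move=> [hX cX] [hY cY] [k0 k1 HX] [l0 l1 HY]; apply: dat_intro => e e0.
have [x2 x12 ax] := hX t; have [y2 y12 ay] := hY t.
pose M := nrm (Y t) + nrm (Y1 t) + (nrm (X t) + nrm (X1 t) + 1) +
  (nrm (L0 t) + nrm (L1 t)).
have M1 : 1 <= M.
  rewrite /M; have := nrm_ge0 (Y t); have := nrm_ge0 (Y1 t); have := nrm_ge0 (X t).
  have := nrm_ge0 (X1 t); have := nrm_ge0 (L0 t); have := nrm_ge0 (L1 t); clear; lra.
have M0 : 0 < M by exact: lt_le_trans M1.
pose eps := e / (3 * M).
have d1 : 0 < eps by rewrite divr_gt0// mulr_gt0.
have d0 : 0 < Num.min 1 eps by rewrite lt_min ltr01.
have e3 : e = 3 * (eps * M).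
  by rewrite /eps mulrA [3 * _]mulrC -mulrA divfK// gt_eqF// mulr_gt0.
near=> h.
have HXh : forall phi phi1, sob phi phi1 ->
    `|h^-1 * ip (fun x => X (t + h) x - X t x) phi - (ip (K0 t) phi + ip (K1 t) phi1)|
    <= eps * (nrm phi + nrm phi1) by near: h; exact: HX.
have HYh : forall phi phi1, sob phi phi1 ->
    `|h^-1 * ip (fun x => Y (t + h) x - Y t x) phi - (ip (L0 t) phi + ip (L1 t) phi1)|
    <= eps * (nrm phi + nrm phi1) by near: h; exact: HY.
have Hc : nrm (fun x => X (t + h) x - X t x) + nrm (fun x => X1 (t + h) x - X1 t x)
   < Num.min 1 (eps).
  by near: h; apply: (@near0_shift (fun s => nrm (fun x => X s x - X t x) +
    nrm (fun x => X1 s x - X1 t x) < Num.min 1 (eps))); exact: cX.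
have [x2' x12' ax'] := hX (t + h); have [y2' y12' ay'] := hY (t + h).
have E : ip (X (t + h)) (Y (t + h)) - ip (X t) (Y t) =
   ip (fun x => X (t + h) x - X t x) (Y t) +
   ip (fun x => Y (t + h) x - Y t x) (X (t + h)).
  by rewrite !ipBl// (ipC (Y _)) (ipC (Y t)); ring.
rewrite E mulrDr.
have h1 := HXh _ _ (hY t); have h2 := HYh _ _ (hX (t + h)).
have dx2 := L2RB x2' x2; have dx12 := L2RB x12' x12.
have h3 := CS (l0 t) dx2; have h4 := CS (l1 t) dx12.
rewrite ipBr// in h3; rewrite ipBr// in h4.
have n1 : nrm (X (t + h)) <= nrm (X t) + nrm (fun x => X (t + h) x - X t x).
  have := nrmD x2 dx2; congr (_ <= _).
  by apply: nrm_ext => x; ring.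
have n2 : nrm (X1 (t + h)) <= nrm (X1 t) + nrm (fun x => X1 (t + h) x - X1 t x).
  have := nrmD x12 dx12; congr (_ <= _).
  by apply: nrm_ext => x; ring.
move: Hc; rewrite lt_min => /andP[c1 c2].
set q0 := nrm (fun x => X (t + h) x - X t x) in h3 n1 c1 c2.
set q1 := nrm (fun x => X1 (t + h) x - X1 t x) in h4 n2 c1 c2.
have q00 : 0 <= q0 by exact: nrm_ge0.
have q10 : 0 <= q1 by exact: nrm_ge0.
have z1 : `|h^-1 * ip (fun x => X (t + h) x - X t x) (Y t) -
   (ip (K0 t) (Y t) + ip (K1 t) (Y1 t))| <= eps * M.
  apply: le_trans h1 _; rewrite ler_wpM2l ?(ltW d1)// /M.
  have := nrm_ge0 (X t); have := nrm_ge0 (X1 t).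
  by have := nrm_ge0 (L0 t); have := nrm_ge0 (L1 t); clear; lra.
have z2 : `|h^-1 * ip (fun x => Y (t + h) x - Y t x) (X (t + h)) -
   (ip (L0 t) (X (t + h)) + ip (L1 t) (X1 (t + h)))| <= eps * M.
  apply: le_trans h2 _; rewrite ler_wpM2l ?(ltW d1)// /M.
  have := nrm_ge0 (Y t); have := nrm_ge0 (Y1 t).
  by have := nrm_ge0 (L0 t); have := nrm_ge0 (L1 t); move: n1 n2 c1; clear; lra.
have z3 : `|(ip (L0 t) (X (t + h)) - ip (L0 t) (X t)) +
   (ip (L1 t) (X1 (t + h)) - ip (L1 t) (X1 t))| <= eps * M.
  apply: le_trans (ler_normD _ _) _; apply: le_trans (lerD h3 h4) _.
  have b0 := nrm_ge0 (L0 t); have b1 := nrm_ge0 (L1 t).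
  apply: (@le_trans _ _ ((nrm (L0 t) + nrm (L1 t)) * eps)).
    by rewrite mulrDl lerD// ler_wpM2l//; apply: ltW; apply: le_lt_trans c2; rewrite ?lerDl ?lerDr.
  rewrite mulrC ler_wpM2l ?(ltW d1)// /M.
  have := nrm_ge0 (X t); have := nrm_ge0 (X1 t).
  by have := nrm_ge0 (Y t); have := nrm_ge0 (Y1 t); clear; lra.
rewrite e3; move: z1 z2 z3; rewrite !ler_norml.
clear; lra.
Unshelve. all: by end_near. Qed.

(** Compactness in near-covering form: neighbourhoods depending on [t] are merged into a single
    member of the filter. *)
Lemma segment_cover (T1 T2 : R) (I : Type) (F : set_system I) (P : I -> R -> Prop) :
  Filter F -> (forall t, T1 <= t <= T2 -> \forall s \near t & i \near F, P i s) ->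
  \forall i \near F, forall t, T1 <= t <= T2 -> P i t.
Proof.
move=> FF H.
have cK := @segment_compact R T1 T2.
have [+ _] := compact_near_coveringP (`[T1, T2]%classic : set R).
move=> /(_ cK I F P FF) K.
have {}K : \forall i \near F, `[T1, T2]%classic `<=` P i.
  by apply: K => t; rewrite /= in_itv/= => /H.
by apply: filterS K => i h t ht; apply: h; rewrite /= in_itv.
Qed.

Lemma curve_bounded X X1 T1 T2 : curve X X1 ->
  exists M, forall t, T1 <= t <= T2 -> nrm (X t) + nrm (X1 t) <= M.
Proof.
move=> [hX cX].
have H : \forall M \near +oo, forall t, T1 <= t <= T2 -> nrm (X t) + nrm (X1 t) <= M.
  apply: segment_cover => t _.
  have h1 := cX t 1 ltr01.
  exists ([set s | nrm (fun x => X s x - X t x) + nrm (fun x => X1 s x - X1 t x) < 1],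
    [set M | nrm (X t) + nrm (X1 t) + 1 <= M]).
    by split; [exact: h1|apply: nbhs_pinfty_ge; rewrite num_real].
  move=> [s M] /= [hs hM].
  have [a1 a2 _] := hX s; have [b1 b2 _] := hX t.
  have n1 : nrm (X s) <= nrm (X t) + nrm (fun x => X s x - X t x).
    have := nrmD b1 (L2RB a1 b1); congr (_ <= _).
    by apply: nrm_ext => x; ring.
  have n2 : nrm (X1 s) <= nrm (X1 t) + nrm (fun x => X1 s x - X1 t x).
    have := nrmD b2 (L2RB a2 b2); congr (_ <= _).
    by apply: nrm_ext => x; ring.
  by lra.
have [M [_ HM]] := H; exists (M + 1); apply: HM; by rewrite ltrDl.
Qed.

(** By the contraction [nrm_dq], the error at time [s] differs from the error at a nearby [t] by
    little, whatever the step. The convergence [dq_cvg] at each fixed time is therefore uniform on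
    compact time intervals. *)
Lemma dq_unif X X1 T1 T2 e : curve X X1 -> 0 < e ->
  \forall a \near 0^', forall t, T1 <= t <= T2 ->
     nrm (fun x => dq a (X t) x - X1 t x) < e.
Proof.
move=> [hX cX] e0; apply: segment_cover => t _.
have e3 : 0 < e / 3 by rewrite divr_gt0.
have h1 := cX t _ e3.
have [d d0 hd] := dq_cvg (hX t) e3.
exists ([set s | nrm (fun x => X s x - X t x) + nrm (fun x => X1 s x - X1 t x) < e / 3],
  [set a | nrm (fun x => dq a (X t) x - X1 t x) < e / 3 /\ a != 0]).
  split; [exact: h1|exists d => //= a; rewrite /ball_/= sub0r normrN => ad an].
  by split => //; exact: hd.
move=> [s a] /= [hs [ha an]].
have [a1 a2 _] := hX s; have [b1 b2 _] := hX t.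
have q := sobB (hX s) (hX t).
have n1 := nrm_dq q an.
have l1 : L2R (dq a (fun x => X s x - X t x)) by apply: L2R_dq; exact: L2RB.
have l2 : L2R (fun x => dq a (X t) x - X1 t x) by apply: L2RB => //; exact: L2R_dq.
have l3 : L2R (fun x => X1 s x - X1 t x) by exact: L2RB.
have n2 := nrmB (L2RD l1 l2) l3.
have n3 := nrmD l1 l2.
have <- : nrm (fun x => dq a (fun x => X s x - X t x) x +
   (dq a (X t) x - X1 t x) - (X1 s x - X1 t x)) = nrm (fun x => dq a (X s) x - X1 s x).
  by apply: nrm_ext => x; rewrite /dq; ring.
have := nrm_ge0 (fun x => X s x - X t x).
by lra.
Qed.

End curves.

(** * The nonlinearity acting on H^1 functions *)

Section nonlinearity.
Context {R : realType}.
Local Notation mu := (@lebesgue_measure R).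
Implicit Types (g h U u v w : R -> R) (K L : R -> R -> R).

(* [F] is the primitive of [f] vanishing at [0]; both only matter on [0, +oo[. *)
Record nonlin (f F : R -> R) : Prop := Nonlin {
  nl_F0 : F 0 = 0;
  nl_lip : forall S, exists2 L, 0 <= L & forall a b c d,
    `|a| <= S -> `|b| <= S -> `|c| <= S -> `|d| <= S ->
    `|f (c ^+ 2 + d ^+ 2) - f (a ^+ 2 + b ^+ 2)| <= L * (`|c - a| + `|d - b|);
  nl_taylor : forall S, exists2 L, 0 <= L & forall a b c d,
    `|a| <= S -> `|b| <= S -> `|c| <= S -> `|d| <= S ->
    `|F (c ^+ 2 + d ^+ 2) - F (a ^+ 2 + b ^+ 2)
      - f (a ^+ 2 + b ^+ 2) * (c ^+ 2 + d ^+ 2 - (a ^+ 2 + b ^+ 2))|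
    <= L * ((c - a) ^+ 2 + (d - b) ^+ 2);
  nl_measf : forall U u, measurable_fun setT U -> measurable_fun setT u ->
    measurable_fun setT (fun x => f (U x ^+ 2 + u x ^+ 2));
  nl_measF : forall U u, measurable_fun setT U -> measurable_fun setT u ->
    measurable_fun setT (fun x => F (U x ^+ 2 + u x ^+ 2)) }.

Variables (f F : R -> R).
Hypothesis nlf : nonlin f F.

Lemma nl_bound (S : R) : exists2 C, 0 <= C & forall a b, `|a| <= S -> `|b| <= S ->
  `|f (a ^+ 2 + b ^+ 2)| <= C.
Proof.
have [L L0 HL] := nl_lip nlf S.
exists (`|f 0| + L * (`|S| + `|S|)).
  by rewrite addr_ge0// mulr_ge0// addr_ge0.
move=> a b ha hb; have S0 : 0 <= S by apply: le_trans ha.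
have := HL 0 0 a b; rewrite normr0 expr0n/= addr0 !subr0 => /(_ S0 S0 ha hb) h.
have : `|f (a ^+ 2 + b ^+ 2)| <= `|f 0| + `|f (a ^+ 2 + b ^+ 2) - f 0|.
  by rewrite -[X in `|X| <= _](subrKC (f 0)); exact: ler_normD.
move=> /le_trans; apply; rewrite lerD2l; apply: le_trans h _.
by rewrite ler_wpM2l// (ger0_norm S0) lerD.
Qed.

Definition rho (U u : R -> R) x : R := U x ^+ 2 + u x ^+ 2.

Lemma L2R_nl S U u v : (forall x, `|U x| <= S) -> (forall x, `|u x| <= S) ->
  measurable_fun setT U -> measurable_fun setT u -> L2R v ->
  L2R (fun x => f (rho U u x) * v x).
Proof.
move=> US uS mU mu' hv; have [C C0 HC] := nl_bound S.
apply: (L2R_mulb (C := C)) => //; first exact: (nl_measf nlf).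
by move=> x; exact: HC.
Qed.

(** No derivative of [f] is available for a chain rule. The Lipschitz bound shows instead that the
    increments are dominated by the integral of a multiple of [|A1| + |B1|], and [dominated_ac]
    supplies a derivative with the same pointwise bound. *)
Lemma sob_nl (S : R) : exists2 K, 0 <= K & forall A A1 B B1, sob A A1 -> sob B B1 ->
  (forall x, `|A x| <= S) -> (forall x, `|B x| <= S) ->
  exists2 N1, sob (fun x => f (rho A B x) * A x) N1 &
     nrm N1 <= K * (nrm A1 + nrm B1).
Proof.
have [L L0 HL] := nl_lip nlf S; have [C C0 HC] := nl_bound S.
exists (L * `|S| + C); first by rewrite addr_ge0// mulr_ge0.
move=> A A1 B B1 hA hB AS BS.
have [A2 A12 aA] := hA; have [B2 B12 aB] := hB.
have S0 : 0 <= S by apply: le_trans (AS 0).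
pose k x := (L * `|S| + C) * (`|A1 x| + `|B1 x|).
have k2 : L2R k by apply: L2RZ; apply: L2RD; exact: L2R_norm.
have dom : dominated (fun x => f (rho A B x) * A x) k.
  split; first exact: L2R_lig.
    by move=> x; rewrite mulr_ge0 ?addr_ge0 ?mulr_ge0.
  move=> a b ab.
  have l1 := L2R_lig (L2R_norm A12); have l2 := L2R_lig (L2R_norm B12).
  rewrite /k itgZ; last by apply: ligD.
  rewrite itgD//.
  have dA : `|A b - A a| <= itg a b (fun x => `|A1 x|).
    by rewrite aA.2// itg_norm//; exact: L2R_lig.
  have dB : `|B b - B a| <= itg a b (fun x => `|B1 x|).
    by rewrite aB.2// itg_norm//; exact: L2R_lig.
  have h1 := HL _ _ _ _ (AS a) (BS a) (AS b) (BS b).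
  have h2 := HC _ _ (AS b) (BS b).
  have -> : f (rho A B b) * A b - f (rho A B a) * A a =
    (f (rho A B b) - f (rho A B a)) * A a + f (rho A B b) * (A b - A a) by ring.
  apply: le_trans (ler_normD _ _) _; rewrite !normrM.
  have h3 : `|f (rho A B b) - f (rho A B a)| * `|A a| <=
     L * (`|A b - A a| + `|B b - B a|) * `|S|.
    by rewrite ler_pM// (le_trans (AS a))// ler_norm.
  have h4 : `|f (rho A B b)| * `|A b - A a| <= C * (`|A b - A a| + `|B b - B a|).
    by rewrite ler_pM// lerDl.
  apply: le_trans (lerD h3 h4) _.
  rewrite mulrAC -mulrDl ler_wpM2l ?lerD//.
  by rewrite addr_ge0// mulr_ge0.
have [N1 aN N1k] := dominated_ac dom.
exists N1.
  split=> //.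
  - exact: (L2R_nl AS BS A2.1 B2.1 A2).
  - exact: (L2R_le aN.1.1 N1k k2).
have N2 := L2R_le aN.1.1 N1k k2.
apply: (@le_trans _ _ (nrm k)).
  by apply: nrm_le => // x; rewrite (le_trans (N1k x))// ler_norm.
have l1 := L2R_norm A12; have l2 := L2R_norm B12.
rewrite /k nrmZ; last exact: L2RD.
have e1 g : L2R g -> nrm (fun y => `|g y|) = nrm g.
  move=> hg; congr Num.sqrt; apply: int_ext => y.
  by rewrite -normrM ger0_norm// -expr2 sqr_ge0.
rewrite ger0_norm ?addr_ge0 ?mulr_ge0// ler_wpM2l ?addr_ge0 ?mulr_ge0//.
by have := nrmD l1 l2; rewrite !e1.
Qed.

Lemma F_bound (S : R) : exists2 C, 0 <= C & forall a b, `|a| <= S -> `|b| <= S ->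
  `|F (a ^+ 2 + b ^+ 2)| <= C * (a ^+ 2 + b ^+ 2).
Proof.
have [L L0 HL] := nl_taylor nlf S.
exists (L + `|f 0|); first by rewrite addr_ge0.
move=> a b ha hb; have S0 : 0 <= S by apply: le_trans ha.
have := HL 0 0 a b; rewrite normr0 expr0n/= addr0 !subr0 (nl_F0 nlf) subr0.
move=> /(_ S0 S0 ha hb) h.
rewrite -[X in `|X| <= _](subrK (f 0 * (a ^+ 2 + b ^+ 2))).
apply: le_trans (ler_normD _ _) _; rewrite mulrDl lerD// normrM.
by rewrite [X in _ * X]ger0_norm// addr_ge0// sqr_ge0.
Qed.

Lemma igr_F S U u : (forall x, `|U x| <= S) -> (forall x, `|u x| <= S) ->
  L2R U -> L2R u -> igr (fun x => F (rho U u x)).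
Proof.
move=> US uS U2 u2; have [C C0 HC] := F_bound S.
apply: (igr_le (g := fun x => C * rho U u x)).
- by apply: (nl_measF nlf); [exact: U2.1|exact: u2.1].
- by move=> x; exact: HC.
- by apply: igrZ; apply: igrD; [exact: U2.2|exact: u2.2].
Qed.

(** Applied to [z = h^-1 * ip dA dA] for an increment [dA]: the time derivative is tested against
    the increment itself, whose H^1 size [d0 + d1] is small. Hence the squared L^2 norm of the
    increment is o(h). *)
Lemma triangle_aux (z k0 k1 n0 n1 d0 d1 e : R) :
  `|z - (k0 + k1)| <= e * (d0 + d1) -> `|k0| <= n0 * d0 -> `|k1| <= n1 * d1 ->
  0 <= n0 -> 0 <= n1 -> 0 <= d0 -> 0 <= d1 -> d0 + d1 < 1 -> d0 + d1 < e ->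
  `|z| <= (n0 + n1 + 1) * e.
Proof.
move=> h h0 h1 n00 n10 d00 d10 s1 se.
have e0 : 0 <= e by apply: le_trans (ltW se); exact: addr_ge0.
have a0 : n0 * d0 <= n0 * e by rewrite ler_wpM2l//; clear -se d10; lra.
have a1 : n1 * d1 <= n1 * e by rewrite ler_wpM2l//; clear -se d00; lra.
have a2 : e * (d0 + d1) <= e by rewrite ler_piMr// ltW.
rewrite -[z](subrK (k0 + k1)); apply: le_trans (ler_normD _ _) _.
have := ler_normD k0 k1; clear -h h0 h1 a0 a1 a2; lra.
Qed.

(** The Taylor remainder is controlled by the squared L^2 norms of the increments, which
    [triangle_aux] shows to be o(h). The linear part is the weak time derivative tested against
    [2 f(rho) A] and [2 f(rho) B], which belong to H^1 by assumption. *)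
Lemma pot_derive A A1 B B1 K0 K1 L0 L1 (t : R) NA NB : curve A A1 -> curve B B1 ->
  wder A K0 K1 -> wder B L0 L1 ->
  sob (fun x => f (rho (A t) (B t) x) * A t x) NA ->
  sob (fun x => f (rho (A t) (B t) x) * B t x) NB ->
  dat (fun t => \int[mu]_x F (rho (A t) (B t) x)) t
   (2 * (ip (K0 t) (fun x => f (rho (A t) (B t) x) * A t x) + ip (K1 t) NA +
     (ip (L0 t) (fun x => f (rho (A t) (B t) x) * B t x) + ip (L1 t) NB))).
Proof.
move=> [hA cA] [hB cB] [k0 k1 HA] [l0 l1 HB] hNA hNB.
set fA := (fun x => f (rho (A t) (B t) x) * A t x) in hNA *.
set fB := (fun x => f (rho (A t) (B t) x) * B t x) in hNB *.
have [a2 a12 aA] := hA t; have [b2 b12 aB] := hB t.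
have [fA2 NA2 _] := hNA; have [fB2 NB2 _] := hNB.
(* The 3 covers two uses of [sob_bounded]: 1 for the function at time [t], and at most 2 for an
   increment whose H^1 size is below 1. *)
pose S := nrm (A t) + nrm (A1 t) + (nrm (B t) + nrm (B1 t)) + 3.
have [L LL0 HL] := nl_taylor nlf S; have [C C0 HC] := nl_bound S.
pose K := L + C.
have K00 : 0 <= K by rewrite addr_ge0.
have bdA s : nrm (fun x => A s x - A t x) + nrm (fun x => A1 s x - A1 t x) < 1 ->
   forall x, `|A s x| <= S.
  move=> hs x; have := sob_bounded x (sobB (hA s) (hA t)).
  have := sob_bounded x (hA t).
  have : `|A s x| <= `|A s x - A t x| + `|A t x|.
    by rewrite -[X in `|X| <= _](subrK (A t x)); exact: ler_normD.
  rewrite /S; have := nrm_ge0 (B t); have := nrm_ge0 (B1 t).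
  by move: hs; clear; lra.
have bdB s : nrm (fun x => B s x - B t x) + nrm (fun x => B1 s x - B1 t x) < 1 ->
   forall x, `|B s x| <= S.
  move=> hs x; have := sob_bounded x (sobB (hB s) (hB t)).
  have := sob_bounded x (hB t).
  have : `|B s x| <= `|B s x - B t x| + `|B t x|.
    by rewrite -[X in `|X| <= _](subrK (B t x)); exact: ler_normD.
  rewrite /S; have := nrm_ge0 (A t); have := nrm_ge0 (A1 t).
  by move: hs; clear; lra.
have AtS x : `|A t x| <= S.
  apply: bdA; rewrite (nrm_ext (g := fun=> 0)); last by move=> y; rewrite subrr.
  by rewrite nrm0 add0r (nrm_ext (g := fun=> 0)) ?nrm0// => y; rewrite subrr.
have BtS x : `|B t x| <= S.
  apply: bdB; rewrite (nrm_ext (g := fun=> 0)); last by move=> y; rewrite subrr.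
  by rewrite nrm0 add0r (nrm_ext (g := fun=> 0)) ?nrm0// => y; rewrite subrr.
apply: dat_intro => e e0.
pose M := 2 * (nrm fA + nrm NA + (nrm fB + nrm NB)) +
  K * (nrm (K0 t) + nrm (K1 t) + (nrm (L0 t) + nrm (L1 t)) + 2) + 1.
have nf := (nrm_ge0 fA, nrm_ge0 NA, nrm_ge0 fB, nrm_ge0 NB).
have nK := (nrm_ge0 (K0 t), nrm_ge0 (K1 t), nrm_ge0 (L0 t), nrm_ge0 (L1 t)).
have M0 : 0 < M.
  rewrite /M ltr_wpDl// addr_ge0// mulr_ge0// ?addr_ge0//; by rewrite ?nf ?nK.
pose eps := e / M; have eps0 : 0 < eps by rewrite divr_gt0.
have d0 : 0 < Num.min 1 eps by rewrite lt_min ltr01.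
near=> h.
have HAh : forall phi phi1, sob phi phi1 ->
    `|h^-1 * ip (fun x => A (t + h) x - A t x) phi - (ip (K0 t) phi + ip (K1 t) phi1)|
    <= eps * (nrm phi + nrm phi1) by near: h; exact: HA.
have HBh : forall phi phi1, sob phi phi1 ->
    `|h^-1 * ip (fun x => B (t + h) x - B t x) phi - (ip (L0 t) phi + ip (L1 t) phi1)|
    <= eps * (nrm phi + nrm phi1) by near: h; exact: HB.
have cAh : nrm (fun x => A (t + h) x - A t x) + nrm (fun x => A1 (t + h) x - A1 t x)
   < Num.min 1 eps.
  by near: h; apply: (@near0_shift _ (fun s => nrm (fun x => A s x - A t x) +
    nrm (fun x => A1 s x - A1 t x) < Num.min 1 eps)); exact: cA.
have cBh : nrm (fun x => B (t + h) x - B t x) + nrm (fun x => B1 (t + h) x - B1 t x)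
   < Num.min 1 eps.
  by near: h; apply: (@near0_shift _ (fun s => nrm (fun x => B s x - B t x) +
    nrm (fun x => B1 s x - B1 t x) < Num.min 1 eps)); exact: cB.
have [a2' a12' aA'] := hA (t + h); have [b2' b12' aB'] := hB (t + h).
pose dA x := A (t + h) x - A t x; pose dB x := B (t + h) x - B t x.
have sdA : sob dA (fun x => A1 (t + h) x - A1 t x) by exact: sobB.
have sdB : sob dB (fun x => B1 (t + h) x - B1 t x) by exact: sobB.
have [dA2 dA12 _] := sdA; have [dB2 dB12 _] := sdB.
move: cAh cBh; rewrite !lt_min => /andP[cA1 cA2] /andP[cB1 cB2].
have A'S := bdA _ cA1; have B'S := bdB _ cB1.
have i1 := igr_F A'S B'S a2' b2'; have i2 := igr_F AtS BtS a2 b2.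
have r1 := igr_ip dA2 fA2; have r2 := igr_ip dB2 fB2.
have r3 : igr (fun x => 2 * (dA x * fA x + dB x * fB x)) by apply: igrZ; exact: igrD.
(* The pointwise error is the Taylor remainder of [F] plus [f(rho)] times the squares of the
   increments, because the increment of [rho] is linear only up to these squares. This gives the
   constant [K = L + C]. *)
have q : `|\int[mu]_x F (rho (A (t + h)) (B (t + h)) x) - \int[mu]_x F (rho (A t) (B t) x)
    - 2 * (ip dA fA + ip dB fB)| <= K * (ip dA dA + ip dB dB).
  rewrite /ip -!intD//; [|exact: igr_ip..].
  rewrite -!intZ//; [|by apply: igrD => //; exact: igr_ip..].
  rewrite -!intB//; last exact: igrB.
  apply: int_norm_le.
  - by apply: igrB => //; exact: igrB.
  - by apply: igrZ; apply: igrD; exact: igr_ip.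
  move=> x; have h1 := HL _ _ _ _ (AtS x) (BtS x) (A'S x) (B'S x).
  have h2 := HC _ _ (AtS x) (BtS x).
  rewrite -/(rho (A t) (B t) x) -/(rho (A (t + h)) (B (t + h)) x) in h1 h2.
  set z := (X in `|X| <= _).
  have -> : z = F (rho (A (t + h)) (B (t + h)) x) - F (rho (A t) (B t) x) -
     f (rho (A t) (B t) x) * (rho (A (t + h)) (B (t + h)) x - rho (A t) (B t) x) +
     f (rho (A t) (B t) x) * (dA x ^+ 2 + dB x ^+ 2).
    by rewrite /z /fA /fB /dA /dB /rho; ring.
  apply: le_trans (ler_normD _ _) _; rewrite /K mulrDl lerD//.
  rewrite normrM -!expr2 [X in _ * X]ger0_norm ?addr_ge0 ?sqr_ge0//.
  by rewrite ler_wpM2r// addr_ge0 ?sqr_ge0.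
have w1 := HAh _ _ hNA; have w2 := HBh _ _ hNB.
have w3 := HAh _ _ sdA; have w4 := HBh _ _ sdB.
have u1 := CS (k0 t) dA2; have u2 := CS (k1 t) dA12.
have u3 := CS (l0 t) dB2; have u4 := CS (l1 t) dB12.
rewrite -/dA -/dB -/fA -/fB in w1 w2 w3 w4 cA1 cA2 cB1 cB2 *.
set IF := (X in h^-1 * X).
have q0 : `|h^-1 * (ip dA dA)| <= (nrm (K0 t) + nrm (K1 t) + 1) * eps.
  exact: (triangle_aux w3 u1 u2 (nrm_ge0 _) (nrm_ge0 _) (nrm_ge0 _) (nrm_ge0 _) cA1 cA2).
have q1 : `|h^-1 * (ip dB dB)| <= (nrm (L0 t) + nrm (L1 t) + 1) * eps.
  exact: (triangle_aux w4 u3 u4 (nrm_ge0 _) (nrm_ge0 _) (nrm_ge0 _) (nrm_ge0 _) cB1 cB2).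
have q2 : `|h^-1 * (IF - 2 * (ip dA fA + ip dB fB))| <=
    K * (`|h^-1 * (ip dA dA)| + `|h^-1 * (ip dB dB)|).
  rewrite normrM; apply: le_trans (ler_wpM2l (normr_ge0 _) q) _.
  rewrite !normrM (ger0_norm (ip_ge0 dA)) (ger0_norm (ip_ge0 dB)).
  by rewrite -mulrDr mulrCA.
have q3 := le_trans q2 (ler_wpM2l K00 (lerD q0 q1)).
have {}w1 := w1; have {}w2 := w2.
set kA := ip (K0 t) fA + ip (K1 t) NA in w1 *.
set kB := ip (L0 t) fB + ip (L1 t) NB in w2 *.
set zA := ip dA fA in q3 w1; set zB := ip dB fB in q3 w2.
have -> : h^-1 * IF - 2 * (kA + kB) = h^-1 * (IF - 2 * (zA + zB)) +
  2 * ((h^-1 * zA - kA) + (h^-1 * zB - kB)) by ring.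
have eE : e = eps * M by rewrite /eps divfK// gt_eqF.
apply: le_trans (ler_normD _ _) _.
rewrite [X in _ + X]normrM [X in _ + X * _]ger0_norm//.
have w5 := le_trans (ler_normD (h^-1 * zA - kA) (h^-1 * zB - kB)) (lerD w1 w2).
have w6 := lerD q3 (ler_wpM2l (ler0n R 2) w5).
apply: (le_trans w6); rewrite eE /M.
set K_ := K; set a0 := nrm (K0 t); set a1 := nrm (K1 t); set b0 := nrm (L0 t).
set b1 := nrm (L1 t); set c0 := nrm fA; set c1 := nrm NA; set c2 := nrm fB.
set c3 := nrm NB; clear -eps0; move: (ltW eps0) => h; rewrite -subr_ge0.
by apply: le_trans h _; rewrite le_eqVlt; apply/orP; left; apply/eqP; ring.
Unshelve. all: by end_near. Qed.

End nonlinearity.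

(** * Conservation of mass and energy *)

Section conservation.
Context {R : realType}.
Local Notation mu := (@lebesgue_measure R).
Implicit Types (g h U u v w : R -> R) (X Y K L : R -> R -> R).

Lemma wderB X Y K0 K1 L0 L1 : (forall t, L2R (X t)) -> (forall t, L2R (Y t)) ->
  wder X K0 K1 -> wder Y L0 L1 ->
  wder (fun t x => X t x - Y t x) (fun t x => K0 t x - L0 t x)
    (fun t x => K1 t x - L1 t x).
Proof.
move=> X2 Y2 [k0 k1 HX] [l0 l1 HY].
split; [by move=> t; exact: L2RB..|move=> t e e0].
have e2 : 0 < e / 2 by rewrite divr_gt0.
have := HX t _ e2; apply: filterS2 (HY t _ e2) => h H2 H1 phi phi1 hphi.
have [p2 p12 _] := hphi; have h1 := H1 _ _ hphi; have h2 := H2 _ _ hphi.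
have -> : ip (fun x => X (t + h) x - Y (t + h) x - (X t x - Y t x)) phi =
   ip (fun x => X (t + h) x - X t x) phi - ip (fun x => Y (t + h) x - Y t x) phi.
  rewrite -ipBl//; [|exact: L2RB..].
  by apply: int_ext => x; ring.
rewrite (ipBl (k0 t) (l0 t) p2) (ipBl (k1 t) (l1 t) p12); move: h1 h2.
set a1 := h^-1 * ip _ _; set a2 := h^-1 * ip _ _ => h1 h2.
rewrite [e]splitr mulrDl; apply: le_trans (lerD h1 h2); apply: le_trans (ler_normB _ _).
by rewrite le_eqVlt /a1 /a2; apply/orP; left; apply/eqP; congr `|_|; ring.
Qed.

Lemma wderZ c X K0 K1 : (forall t, L2R (X t)) -> wder X K0 K1 ->
  wder (fun t x => c * X t x) (fun t x => c * K0 t x) (fun t x => c * K1 t x).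
Proof.
move=> X2 [k0 k1 HX]; split; [by move=> t; exact: L2RZ..|move=> t e e0].
have c0 : 0 < `|c| + 1 by rewrite ltr_wpDl.
have e2 : 0 < e / (`|c| + 1) by rewrite divr_gt0.
have := HX t _ e2; apply: filterS => h H1 phi phi1 hphi.
have [p2 p12 _] := hphi; have h1 := H1 _ _ hphi.
have -> : ip (fun x => c * X (t + h) x - c * X t x) phi =
   c * ip (fun x => X (t + h) x - X t x) phi.
  rewrite -ipZl//; last exact: L2RB.
  by apply: int_ext => x; ring.
rewrite !ipZl// mulrCA -mulrDr -mulrBr normrM.
apply: le_trans (ler_wpM2l (normr_ge0 c) h1) _.
have -> : e * (nrm phi + nrm phi1) = (`|c| + 1) * (e / (`|c| + 1) * (nrm phi + nrm phi1)).
  by rewrite mulrA [(_ + 1) * _]mulrC divfK// gt_eqF.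
rewrite ler_wpM2r ?lerDl// mulr_ge0 ?(ltW e2)//.
by rewrite addr_ge0 ?nrm_ge0.
Qed.

Lemma curveB X X1 Y Y1 : curve X X1 -> curve Y Y1 ->
  curve (fun t x => X t x - Y t x) (fun t x => X1 t x - Y1 t x).
Proof.
move=> [hX cX] [hY cY]; split; first by move=> t; exact: sobB.
move=> t0 e e0; have e2 : 0 < e / 2 by rewrite divr_gt0.
have := cX t0 _ e2; apply: filterS2 (cY t0 _ e2) => t h2 h1.
have [a1 a2 _] := hX t; have [b1 b2 _] := hX t0.
have [c1 c2 _] := hY t; have [d1 d2 _] := hY t0.
have n1 := nrmB (L2RB a1 b1) (L2RB c1 d1).
have n2 := nrmB (L2RB a2 b2) (L2RB c2 d2).
have e3 : nrm (fun x => X t x - Y t x - (X t0 x - Y t0 x)) =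
  nrm (fun x => X t x - X t0 x - (Y t x - Y t0 x)) by apply: nrm_ext => x; ring.
have e4 : nrm (fun x => X1 t x - Y1 t x - (X1 t0 x - Y1 t0 x)) =
  nrm (fun x => X1 t x - X1 t0 x - (Y1 t x - Y1 t0 x)) by apply: nrm_ext => x; ring.
by rewrite e3 e4; move: h1 h2 n1 n2; clear; lra.
Qed.

Lemma curveZ c X X1 : curve X X1 ->
  curve (fun t x => c * X t x) (fun t x => c * X1 t x).
Proof.
move=> hX; have := curve_mulw (C := `|c|) (D := 0) (ac_cst c) (fun=> lexx _) _ hX.
rewrite normr0 => /(_ (fun=> lexx _)); congr curve.
by apply/funext => t; apply/funext => x; rewrite mul0r add0r.
Qed.

Lemma curve_dq a X X1 : curve X X1 ->
  curve (fun t => dq a (X t)) (fun t => dq a (X1 t)).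
Proof. by move=> hX; apply: curveZ; apply: curveB => //; exact: curve_shift. Qed.

Lemma wder_dq a X K0 K1 : (forall t, L2R (X t)) -> wder X K0 K1 ->
  wder (fun t => dq a (X t)) (fun t => dq a (K0 t)) (fun t => dq a (K1 t)).
Proof.
move=> X2 hX; apply: wderZ; last apply: wderB => //.
- by move=> t; apply: L2RB => //; exact: L2R_shift.
- by move=> t; exact: L2R_shift.
- exact: wder_shift.
Qed.

Lemma ip_dqN a g h : L2R g -> L2R h -> ip (dq a g) h = - ip g (dq (- a) h).
Proof.
move=> hg hh.
rewrite /dq ipZl ?ipBl ?ipZr ?ipBr//; try by [exact: L2R_shift|apply: L2RB => //; exact: L2R_shift].
have -> : ip (fun x => g (x + a)) h = ip g (fun x => h (x - a)).
  rewrite -(@ip_shift _ g _ a)//; last exact: L2R_shift.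
  by congr ip; apply/funext => x; rewrite addrK.
by rewrite invrN; ring.
Qed.

Lemma ip_dq a U u V v : sob U u -> sob V v ->
  ip (dq a U) v = ip u (dq (- a) V).
Proof.
move=> hU hV; have [U2 _ _] := hU; have [_ v2 _] := hV.
by rewrite ip_dqN// (sob_ibp hU (sob_dq (- a) hV)).
Qed.

(** The term [ip (dq a N) G1] equals [ip N1 (dq (- a) G)] exactly, so only the quotients of [G] have
    to converge. For [N] a bound on [N1] suffices, and this is what is known of the nonlinear terms
    uniformly in time. *)
Lemma dq_pair a (N N1 G G1 : R -> R) : a != 0 -> sob N N1 -> sob G G1 ->
  `|ip (dq a N) (dq a G) - ip N1 G1| <=
  nrm N1 * (nrm (fun x => dq a G x - G1 x) + nrm (fun x => dq (- a) G x - G1 x)).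
Proof.
move=> a0 hN hG; have [N2 N12 _] := hN; have [G2 G12 _] := hG.
have dN2 := L2R_dq a N2; have dG2 := L2R_dq a G2; have dG2' := L2R_dq (- a) G2.
have -> : ip (dq a N) (dq a G) - ip N1 G1 =
  ip (dq a N) (fun x => dq a G x - G1 x) + ip N1 (fun x => dq (- a) G x - G1 x).
  by rewrite !ipBr// (ip_dq a hN hG); ring.
have h1 := CS dN2 (L2RB dG2 G12); have h2 := CS N12 (L2RB dG2' G12).
apply: le_trans (ler_normD _ _) _; rewrite mulrDr; apply: le_trans (lerD h1 h2) _.
by rewrite lerD2r ler_wpM2r ?nrm_ge0// (nrm_dq hN).
Qed.

Lemma near0_opp (P : R -> Prop) : (\forall a \near 0^', P a) ->
  \forall a \near 0^', P (- a).
Proof.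
move=> [e /= e0 H]; exists e => //= a; rewrite /ball_/= sub0r normrN => ae an.
by apply: H; rewrite /= ?sub0r ?opprK// ?oppr_eq0.
Qed.

(* [A + i B] solves the equation: [A_t = W B - B_xx] and [B_t = - W A + A_xx],
   where [W = m V + f (A^2 + B^2)] and [A1 = A_x], [B1 = B_x]. *)
Record rsol (m : R) (V V1 f F : R -> R) (A A1 B B1 : R -> R -> R) : Prop := Rsol {
  rs_nl : nonlin f F;
  rs_V : ac V V1;
  rs_V0 : exists v0 : R, forall x, `|V x| <= v0;
  rs_V1 : exists v1 : R, forall x, `|V1 x| <= v1;
  rs_A : curve A A1;
  rs_B : curve B B1;
  rs_dA : wder A (fun t x => (m * V x + f (rho (A t) (B t) x)) * B t x) B1;
  rs_dB : wder B (fun t x => - ((m * V x + f (rho (A t) (B t) x)) * A t x))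
                 (fun t x => - A1 t x) }.

Variables (m : R) (V V1 f F : R -> R) (A A1 B B1 : R -> R -> R).
Hypothesis sol : rsol m V V1 f F A A1 B B1.

Let W t x := m * V x + f (rho (A t) (B t) x).

Lemma sol_L2 t : [/\ L2R (A t), L2R (A1 t), L2R (B t) & L2R (B1 t)].
Proof.
by have [[hA _] [hB _]] := (rs_A sol, rs_B sol);
  have [? ? _] := hA t; have [? ? _] := hB t.
Qed.

Lemma sol_WL2 t : L2R (fun x => W t x * B t x) /\ L2R (fun x => W t x * A t x).
Proof.
have [h _ _] := rs_dA sol; have [h' _ _] := rs_dB sol; split; first exact: h.
have := L2RN (h' t); congr L2R; by apply/funext => x; rewrite opprK.
Qed.

(** The real potential [W] drops out and only the flux through [w1] is left. The weight is 1 for the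
    mass, [V] for the potential energy and [ew 2] for the local mass. *)
Lemma weight_derive C D w w1 t : ac w w1 -> (forall x, `|w x| <= C) ->
  (forall x, `|w1 x| <= D) ->
  dat (fun t => ip (A t) (fun x => w x * A t x) + ip (B t) (fun x => w x * B t x)) t
   (2 * (ip (B1 t) (fun x => w1 x * A t x) - ip (A1 t) (fun x => w1 x * B t x))).
Proof.
move=> aw wC wD; have mw := ac_meas aw; have mw1 := aw.1.1.
have [cA cB] := (rs_A sol, rs_B sol).
have A2 s := let: And4 h _ _ _ := sol_L2 s in h.
have B2 s := let: And4 _ _ h _ := sol_L2 s in h.
have dA := rs_dA sol; have dB := rs_dB sol.
have hA := leibniz t cA (curve_mulw aw wC wD cA) dA (wder_mulw aw wC wD A2 dA).
have hB := leibniz t cB (curve_mulw aw wC wD cB) dB (wder_mulw aw wC wD B2 dB).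
apply: dat_eq (datD hA hB) _.
have [a2 a12 b2 b12] := sol_L2 t; have [WB2 WA2] := sol_WL2 t.
have mul g : L2R g -> L2R (fun x => w x * g x) by move=> hg; exact: L2R_mulb hg mw wC.
have mul1 g : L2R g -> L2R (fun x => w1 x * g x) by move=> hg; exact: L2R_mulb hg mw1 wD.
rewrite -/(W t) in hA hB *.
have n1 := L2RN WA2; have n2 := L2RN a12.
rewrite !(ipDr, ipDl)//; try by [exact: mul|exact: mul1|apply: L2RD; [exact: mul|exact: mul1]].
rewrite !(ipNl WA2) ?(ipNl a12)//; try by [exact: mul|exact: mul1].
have sw g h : ip (fun x => w x * g x) h = ip g (fun x => w x * h x).
  by apply: int_ext => x; ring.
have sw1 g h : ip (fun x => w1 x * g x) h = ip g (fun x => w1 x * h x).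
  by apply: int_ext => x; ring.
rewrite !sw !sw1 !(ipNl WA2) ?(ipNl a12)//; try by [exact: mul|exact: mul1].
have -> : ip (fun x => W t x * A t x) (fun x => w x * B t x) =
  ip (fun x => W t x * B t x) (fun x => w x * A t x).
  by apply: int_ext => x; ring.
have -> : ip (A1 t) (fun x => w x * B1 t x) = ip (B1 t) (fun x => w x * A1 t x).
  by apply: int_ext => x; ring.
ring.
Qed.

Lemma mass_const T : 0 <= T ->
  ip (A T) (A T) + ip (B T) (B T) = ip (A 0) (A 0) + ip (B 0) (B 0).
Proof.
move=> T0.
have H t : dat (fun t => ip (A t) (fun x => 1 * A t x) + ip (B t) (fun x => 1 * B t x)) t 0.
  apply: dat_eq (weight_derive (C := 1) (D := 0) t (ac_cst 1) _ _) _.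
  - by move=> _; rewrite normr1.
  - by move=> _; rewrite normr0.
  have z g h : ip g (fun x => 0 * h x) = 0.
    by rewrite -[RHS](@int0 R); apply: int_ext => x; ring.
  by rewrite !z subrr mulr0.
have := dat_mvt_abs (c := 0) T0 (fun t _ => H t).
rewrite normr0 mul0r => /(_ (fun _ _ => lexx _)).
rewrite normr_le0 subr_eq0 => /eqP.
have o g : ip g (fun x => 1 * g x) = ip g g by apply: int_ext => x; rewrite mul1r.
by rewrite !o.
Qed.

Lemma sol_unif_bound T : exists S, forall t, 0 <= t <= T ->
  [/\ forall x, `|A t x| <= S, forall x, `|B t x| <= S,
    nrm (A t) + nrm (A1 t) <= S & nrm (B t) + nrm (B1 t) <= S].
Proof.
have [M HM] := curve_bounded 0 T (rs_A sol).
have [M' HM'] := curve_bounded 0 T (rs_B sol).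
exists (`|M| + `|M'| + 1) => t ht.
have h1 := HM t ht; have h2 := HM' t ht.
have [cA _] := rs_A sol; have [cB _] := rs_B sol.
have n1 := ler_norm M; have n2 := ler_norm M'.
have p1 := normr_ge0 M; have p2 := normr_ge0 M'.
split.
- by move=> x; have := sob_bounded x (cA t); move: h1 n1 p2; lra.
- by move=> x; have := sob_bounded x (cB t); move: h2 n2 p1; lra.
- by move: h1 n1 p2; lra.
- by move: h2 n2 p1; lra.
Qed.

Definition energy t : R :=
  (ip (A1 t) (A1 t) + ip (B1 t) (B1 t)
   + (m * (ip (A t) (fun x => V x * A t x) + ip (B t) (fun x => V x * B t x))
   + \int[mu]_x F (rho (A t) (B t) x))) / 2.

(** The constant depends on the time only through the bound [S]; it controls the derivatives of
    [W A] and [W B] uniformly on a compact time interval. *)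
Lemma sob_W (S : R) : exists2 K, 0 <= K & forall t,
  (forall x, `|A t x| <= S) -> (forall x, `|B t x| <= S) ->
  nrm (A t) + nrm (A1 t) <= S -> nrm (B t) + nrm (B1 t) <= S ->
  exists NfA NfB, [/\
    sob (fun x => f (rho (A t) (B t) x) * A t x) NfA,
    sob (fun x => f (rho (A t) (B t) x) * B t x) NfB,
    nrm (fun x => m * (V1 x * A t x + V x * A1 t x) + NfA x) <= K &
    nrm (fun x => m * (V1 x * B t x + V x * B1 t x) + NfB x) <= K].
Proof.
have [K K0 HK] := sob_nl (rs_nl sol) S.
have [v0 hv0] := rs_V0 sol; have [v1 hv1] := rs_V1 sol.
exists (`|m| * ((`|v0| + `|v1|) * `|S|) + K * (`|S| + `|S|)).
  by rewrite addr_ge0 ?mulr_ge0 ?addr_ge0.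
move=> t AS BS nA nB.
have [cA _] := rs_A sol; have [cB _] := rs_B sol.
have [NA sA hA] := HK _ _ _ _ (cA t) (cB t) AS BS.
have [NB sB hB] := HK _ _ _ _ (cB t) (cA t) BS AS.
have E g : (fun x => f (rho (B t) (A t) x) * g x) = (fun x => f (rho (A t) (B t) x) * g x).
  by apply/funext => x; rewrite /rho addrC.
rewrite E in sB.
exists NA, NB.
have V_m := ac_meas (rs_V sol); have V1_m := (rs_V sol).1.1.
have bd (X X1 N : R -> R) : sob X X1 -> L2R N -> nrm X + nrm X1 <= S ->
    nrm N <= K * (nrm (A1 t) + nrm (B1 t)) ->
    nrm (fun x => m * (V1 x * X x + V x * X1 x) + N x) <=
     `|m| * ((`|v0| + `|v1|) * `|S|) + K * (`|S| + `|S|).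
  move=> hX N2 XS NK; have [X2 X12 _] := hX.
  have l1 := L2R_mulb X2 V1_m hv1; have l2 := L2R_mulb X12 V_m hv0.
  have n1 := nrm_mulb X2 V1_m hv1; have n2 := nrm_mulb X12 V_m hv0.
  apply: le_trans (nrmD (L2RZ m (L2RD l1 l2)) N2) _; apply: lerD.
    rewrite nrmZ ?ler_wpM2l//; last exact: L2RD.
    apply: le_trans (nrmD l1 l2) _; apply: le_trans (lerD n1 n2) _.
    have S0 : 0 <= `|S| - (nrm X + nrm X1) by rewrite subr_ge0 (le_trans XS)// ler_norm.
    have m1 : v1 * nrm X <= `|v1| * nrm X by rewrite ler_wpM2r ?nrm_ge0 ?ler_norm.
    have m2 : v0 * nrm X1 <= `|v0| * nrm X1 by rewrite ler_wpM2r ?nrm_ge0 ?ler_norm.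
    have m3 := mulr_ge0 (normr_ge0 v1) S0; have m4 := mulr_ge0 (normr_ge0 v0) S0.
    have m5 := mulr_ge0 (normr_ge0 v1) (nrm_ge0 X1).
    have m6 := mulr_ge0 (normr_ge0 v0) (nrm_ge0 X).
    by lra.
  apply: le_trans NK _; rewrite ler_wpM2l// lerD//.
    by apply: le_trans (le_trans _ nA) (ler_norm S); rewrite lerDr nrm_ge0.
  by apply: le_trans (le_trans _ nB) (ler_norm S); rewrite lerDr nrm_ge0.
split=> //.
- apply: (bd _ _ _ (cA t)) => //; by case: sA.
- apply: (bd _ _ _ (cB t)) => //; [by case: sB|by rewrite addrC].
Qed.

(* Energy in which [A1], [B1] are replaced by difference quotients, so that it
   is differentiable in time for [H^1] solutions. *)
Let Ea a t : R :=
  (ip (dq a (A t)) (dq a (A t)) + ip (dq a (B t)) (dq a (B t))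
   + (m * (ip (A t) (fun x => V x * A t x) + ip (B t) (fun x => V x * B t x))
   + \int[mu]_x F (rho (A t) (B t) x))) / 2.

(** The pairings of [dq a (A1 t)] with [dq a (B1 t)] cancel. What remains is arranged in two
    differences of the form treated by [dq_pair], with [N = W B], [G = A] and with [N = W A],
    [G = B]; the terms with [V A1 B1] added to complete them cancel each other. *)
Lemma Ea_derive a t NfA NfB :
  sob (fun x => f (rho (A t) (B t) x) * A t x) NfA ->
  sob (fun x => f (rho (A t) (B t) x) * B t x) NfB ->
  dat (Ea a) t
   ((ip (dq a (fun x => W t x * B t x)) (dq a (A t)) -
       ip (fun x => m * (V1 x * B t x + V x * B1 t x) + NfB x) (A1 t)) -
    (ip (dq a (fun x => W t x * A t x)) (dq a (B t)) -
       ip (fun x => m * (V1 x * A t x + V x * A1 t x) + NfA x) (B1 t))).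
Proof.
move=> hNA hNB.
have [v0 hv0] := rs_V0 sol; have [v1 hv1] := rs_V1 sol.
have V_m := ac_meas (rs_V sol); have V1_m := (rs_V sol).1.1.
have [cA cB] := (rs_A sol, rs_B sol).
have A2 s := let: And4 h _ _ _ := sol_L2 s in h.
have B2 s := let: And4 _ _ h _ := sol_L2 s in h.
have dA := rs_dA sol; have dB := rs_dB sol.
have kA := leibniz t (curve_dq a cA) (curve_dq a cA) (wder_dq a A2 dA) (wder_dq a A2 dA).
have kB := leibniz t (curve_dq a cB) (curve_dq a cB) (wder_dq a B2 dB) (wder_dq a B2 dB).
have kV := weight_derive t (rs_V sol) hv0 hv1.
have kF := pot_derive (rs_nl sol) cA cB dA dB hNA hNB.
have := datZ 2^-1 (datD (datD kA kB) (datD (datZ m kV) kF)).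
have -> : (fun x => 2^-1 * (ip (dq a (A x)) (dq a (A x)) + ip (dq a (B x)) (dq a (B x)) +
   (m * (ip (A x) (fun x0 => V x0 * A x x0) + ip (B x) (fun x0 => V x0 * B x x0)) +
      \int[mu]_x0 F (rho (A x) (B x) x0)))) = Ea a.
  by apply/funext => s; rewrite /Ea mulrC.
move=> H; apply: dat_eq H _.
have [a2 a12 b2 b12] := sol_L2 t; have [WB2 WA2] := sol_WL2 t.
have [NfA0 NfA2 _] := hNA; have [NfB0 NfB2 _] := hNB.
have mv g : L2R g -> L2R (fun x => V x * g x) by move=> hg; exact: L2R_mulb hg V_m hv0.
have mv1 g : L2R g -> L2R (fun x => V1 x * g x) by move=> hg; exact: L2R_mulb hg V1_m hv1.
rewrite -/(W t).
have dqN g : dq a (fun x => - g x) = (fun x => - dq a g x).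
  by apply/funext => x; rewrite /dq; ring.
rewrite !dqN.
have q := L2R_dq a.
rewrite (ipNl (q _ WA2) (q _ b2)) (ipNl (q _ a12) (q _ b12)).
rewrite (ipNl WA2 NfB0) (ipNl a12 NfB2).
rewrite (ipDl (L2RZ m (L2RD (mv1 _ b2) (mv _ b12))) NfB2 a12).
rewrite (ipDl (L2RZ m (L2RD (mv1 _ a2) (mv _ a12))) NfA2 b12).
rewrite (ipZl m (L2RD (mv1 _ b2) (mv _ b12)) a12).
rewrite (ipZl m (L2RD (mv1 _ a2) (mv _ a12)) b12).
rewrite (ipDl (mv1 _ b2) (mv _ b12) a12) (ipDl (mv1 _ a2) (mv _ a12) b12).
have -> : ip (fun x => W t x * A t x) (fun x => f (rho (A t) (B t) x) * B t x) =
  ip (fun x => W t x * B t x) (fun x => f (rho (A t) (B t) x) * A t x).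
  by apply: int_ext => x; ring.
have -> : ip (fun x => V x * B1 t x) (A1 t) = ip (fun x => V x * A1 t x) (B1 t).
  by apply: int_ext => x; ring.
rewrite (ipC (dq a (B1 t))) (ipC (B1 t)) (ipC (A1 t) (fun x => V1 x * _)).
rewrite (ipC (B1 t) NfA) (ipC (A1 t) NfB).
by set z1 := ip (dq a (A1 t)) _; field.
Qed.

(** The energy with difference quotients has, by [dq_pair], a derivative tending to 0 with the step,
    uniformly on [[0, T]], and it converges to the true energy at both ends. *)
Lemma energy_const T : 0 <= T -> energy T = energy 0.
Proof.
move=> T0; have [S HS] := sol_unif_bound T.
have [K K0 HK] := sob_W S.
have [cA cB] := (rs_A sol, rs_B sol).
have S0 : 0 <= S.
  have [//|_ _ h _] := HS 0; first by rewrite lexx.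
  by apply: le_trans h; rewrite addr_ge0 ?nrm_ge0.
apply/eqP; rewrite -subr_eq0 -normr_le0; apply/ler_addgt0Pr => e e0.
rewrite add0r.
(* The drift over [[0, T]] costs [4 K d T], and the two passages between the energies cost [2 S d]
   each. *)
pose d := e / (4 * K * T + 4 * S + 1).
have den0 : 0 < 4 * K * T + 4 * S + 1.
  by rewrite ltr_wpDl// addr_ge0// mulr_ge0// mulr_ge0.
have d0 : 0 < d by rewrite divr_gt0.
near (0 : R)^' => a.
have a0 : a != 0 by near: a; exact: nbhs_dnbhs_neq.
have HAp t : 0 <= t <= T -> nrm (fun x => dq a (A t) x - A1 t x) < d.
  by move: t; near: a; exact: dq_unif.
have HBp t : 0 <= t <= T -> nrm (fun x => dq a (B t) x - B1 t x) < d.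
  by move: t; near: a; exact: dq_unif.
have HAm t : 0 <= t <= T -> nrm (fun x => dq (- a) (A t) x - A1 t x) < d.
  move: t; near: a; apply: (near0_opp (P := fun a => forall t, 0 <= t <= T ->
    nrm (fun x => dq a (A t) x - A1 t x) < d)); exact: dq_unif.
have HBm t : 0 <= t <= T -> nrm (fun x => dq (- a) (B t) x - B1 t x) < d.
  move: t; near: a; apply: (near0_opp (P := fun a => forall t, 0 <= t <= T ->
    nrm (fun x => dq a (B t) x - B1 t x) < d)); exact: dq_unif.
have step : `|Ea a T - Ea a 0| <= 4 * K * d * T.
  have der t : 0 <= t <= T -> exists2 l, dat (Ea a) t l & `|l| <= 4 * K * d.
    move=> ht; have [AS BS nA nB] := HS t ht.
    have [NA [NB [hNA hNB kA kB]]] := HK t AS BS nA nB.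
    have [v0 hv0] := rs_V0 sol; have [v1 hv1] := rs_V1 sol.
    have sWB : sob (fun x => W t x * B t x)
        (fun x => m * (V1 x * B t x + V x * B1 t x) + NB x).
      have := sobD (sobZ m (sob_mulw (rs_V sol) hv0 hv1 (cB.1 t))) hNB.
      by congr sob; apply/funext => x; rewrite /W; ring.
    have sWA : sob (fun x => W t x * A t x)
        (fun x => m * (V1 x * A t x + V x * A1 t x) + NA x).
      have := sobD (sobZ m (sob_mulw (rs_V sol) hv0 hv1 (cA.1 t))) hNA.
      by congr sob; apply/funext => x; rewrite /W; ring.
    eexists; first exact: Ea_derive hNA hNB.
    have p1 := dq_pair a0 sWB (cA.1 t); have p2 := dq_pair a0 sWA (cB.1 t).
    apply: le_trans (ler_normB _ _) _; apply: le_trans (lerD p1 p2) _.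
    have q1 := HAp t ht; have q2 := HAm t ht; have q3 := HBp t ht; have q4 := HBm t ht.
    have r1 : nrm (fun x => m * (V1 x * B t x + V x * B1 t x) + NB x) *
      (nrm (fun x => dq a (A t) x - A1 t x) + nrm (fun x => dq (- a) (A t) x - A1 t x))
      <= K * (d + d) by rewrite ler_pM ?nrm_ge0 ?addr_ge0 ?nrm_ge0// ltW// ltrD.
    have r2 : nrm (fun x => m * (V1 x * A t x + V x * A1 t x) + NA x) *
      (nrm (fun x => dq a (B t) x - B1 t x) + nrm (fun x => dq (- a) (B t) x - B1 t x))
      <= K * (d + d) by rewrite ler_pM ?nrm_ge0 ?addr_ge0 ?nrm_ge0// ltW// ltrD.
    apply: le_trans (lerD r1 r2) _.
    by rewrite le_eqVlt; apply/orP; left; apply/eqP; ring.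
  have {}der (t : R) : exists l : R, 0 <= t <= T -> dat (Ea a) t l /\ `|l| <= 4 * K * d.
    have [ht|nt] := boolP (0 <= t <= T); last by exists 0.
    by have [l h1 h2] := der t ht; exists l.
  have [l hl] := choice der.
  have := dat_mvt_abs T0 (fun t ht => (hl t ht).1) (fun t ht => (hl t ht).2).
  by rewrite subr0.
have close t : 0 <= t <= T -> `|energy t - Ea a t| <= 2 * S * d.
  move=> ht; have [_ _ nA nB] := HS t ht; have [a2 a12 b2 b12] := sol_L2 t.
  have cl (X X1 : R -> R) : L2R X -> L2R X1 -> nrm X <= nrm X1 -> nrm (fun x => X x - X1 x) < d ->
     nrm X1 <= S -> `|ip X1 X1 - ip X X| <= 2 * S * d.
    move=> X2 X12 XX1 Xd X1S; rewrite distrC.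
    have -> : ip X X - ip X1 X1 = ip (fun x => X x - X1 x) X + ip (fun x => X x - X1 x) X1.
      by rewrite !ipBl// (ipC X1 X); ring.
    have h1 := CS (L2RB X2 X12) X2; have h2 := CS (L2RB X2 X12) X12.
    apply: le_trans (ler_normD _ _) _; apply: le_trans (lerD h1 h2) _.
    rewrite -mulrDr mulrC ler_pM ?addr_ge0 ?nrm_ge0// ?(ltW Xd)//.
    by have := le_trans XX1 X1S; move: X1S; lra.
  have A1S : nrm (A1 t) <= S by apply: le_trans nA; rewrite lerDr nrm_ge0.
  have B1S : nrm (B1 t) <= S by apply: le_trans nB; rewrite lerDr nrm_ge0.
  have h1 := cl _ _ (L2R_dq a a2) a12 (nrm_dq (cA.1 t) a0) (HAp t ht) A1S.
  have h2 := cl _ _ (L2R_dq a b2) b12 (nrm_dq (cB.1 t) a0) (HBp t ht) B1S.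
  have -> : energy t - Ea a t = (ip (A1 t) (A1 t) - ip (dq a (A t)) (dq a (A t)) +
     (ip (B1 t) (B1 t) - ip (dq a (B t)) (dq a (B t)))) / 2.
    by rewrite /energy /Ea -mulrBl; congr (_ / 2); ring.
  rewrite normrM [X in _ * X]ger0_norm// ler_pdivrMr//.
  apply: le_trans (ler_normD _ _) _; apply: le_trans (lerD h1 h2) _.
  by rewrite le_eqVlt; apply/orP; left; apply/eqP; ring.
have c1 : `|energy T - Ea a T| <= 2 * S * d by apply: close; rewrite T0 lexx.
have c2 : `|energy 0 - Ea a 0| <= 2 * S * d by apply: close; rewrite lexx.
have -> : energy T - energy 0 = (energy T - Ea a T) + (Ea a T - Ea a 0) -
  (energy 0 - Ea a 0) by ring.
apply: le_trans (ler_normB _ _) _.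
apply: le_trans (lerD (le_trans (ler_normD _ _) (lerD c1 step)) c2) _.
have <- : d * (4 * K * T + 4 * S + 1) = e by rewrite /d divfK// gt_eqF.
have -> : 2 * S * d + 4 * K * d * T + 2 * S * d = d * (4 * K * T + 4 * S) by ring.
by rewrite ler_wpM2l ?(ltW d0)// lerDl.
Unshelve. all: by end_near. Qed.

End conservation.

(** * The virial estimate *)

Section weights.
Context {R : realType}.
Local Notation mu := (@lebesgue_measure R).
Implicit Types (g h U u w X : R -> R).

Lemma dat_mono_lip (h dh : R -> R) (a b L : R) :
  (forall x, a <= x <= b -> dat h x (dh x)) ->
  (forall x, a <= x <= b -> `|dh x| <= L) ->
  forall x y, a <= x <= b -> a <= y <= b -> `|h x - h y| <= L * `|x - y|.
Proof.
move=> hd hL x y /andP[ax xb] /andP[ay yb].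
wlog yx : x y ax xb ay yb / y <= x.
  move=> H; have [yx|xy] := leP y x; first exact: H.
  by rewrite distrC [X in _ * X]distrC; apply: H => //; exact: ltW.
rewrite [X in _ * X]ger0_norm ?subr_ge0//.
apply: (dat_mvt_abs (l := dh) yx) => z /andP[yz zx].
  by apply: hd; rewrite (le_trans ay yz) (le_trans zx xb).
by apply: hL; rewrite (le_trans ay yz) (le_trans zx xb).
Qed.

Lemma ac_id : ac (fun x : R => x) (fun=> 1).
Proof. by split; [exact: lig_cst|move=> a b ab; rewrite itg_cst// mul1r]. Qed.

Lemma sg_abs (x : R) : sg x * x = `|x|.
Proof. by rewrite /sg; case: leP => x0; [rewrite mul1r ger0_norm|rewrite mulN1r ltr0_norm]. Qed.

Lemma ac_abs : ac (fun x : R => `|x|) sg.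
Proof.
apply: ac_ext (ac_sg ac_id (erefl _)) => x; first exact: sg_abs.
by rewrite mulr1.
Qed.

Definition ew (c x : R) : R := expR (- (c * `|x|)).

Lemma ew_ge0 c x : 0 <= ew c x. Proof. exact: expR_ge0. Qed.

Lemma ew_le1 c x : 0 <= c -> ew c x <= 1.
Proof. by move=> c0; rewrite expR_le1 oppr_le0 mulr_ge0. Qed.

Lemma ew_norm c x : 0 <= c -> `|ew c x| <= 1.
Proof. by move=> c0; rewrite ger0_norm ?ew_ge0// ew_le1. Qed.

Lemma ew2 (x : R) : ew 2 x = ew 1 x * ew 1 x.
Proof. by rewrite /ew -expRD; congr expR; ring. Qed.

Lemma ac_ew c : 0 <= c -> ac (ew c) (fun x => - c * ew c x * sg x).
Proof.
move=> c0.
have dd (s : R) : dat (fun s => expR (- (c * s))) s (- c * expR (- (c * s))).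
  have h1 : is_derive s 1 (fun s : R => - (c * s)) (- c).
    apply: is_derive_eq (is_deriveN (is_deriveZ c (is_derive_id s 1))) _.
    by rewrite /GRing.scale/= mulr1.
  have := @is_derive1_comp _ expR (fun s => - (c * s)) s _ _ (is_derive_expR _) h1.
  by rewrite mulrC.
apply: (ac_comp (P := fun s => 0 <= s) (L := c) (h := fun s => expR (- (c * s)))
  (dh := fun s => - c * expR (- (c * s))) ac_abs) => //.
- move=> a b a0 b0.
  apply: (@dat_mono_lip _ _ 0 (a + b) c (fun x _ => dd x)).
  + move=> x /andP[x0 _]; rewrite normrM normrN (ger0_norm c0) ger0_norm ?expR_ge0//.
    by rewrite ler_piMr// expR_le1 oppr_le0 mulr_ge0.
  + by rewrite a0 lerDl.
  + by rewrite b0 lerDr.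
- apply: measurable_funM => //; apply: measurableT_comp => //.
  apply: measurableT_comp => //; apply: measurable_funM => //.
Qed.

Lemma ew_meas c : 0 <= c -> measurable_fun setT (ew c).
Proof. by move=> /ac_ew /ac_meas. Qed.

Lemma ew1_bound c x : 0 <= c -> `|- c * ew c x * sg x| <= c.
Proof.
move=> c0; rewrite !normrM sg_norm mulr1 normrN (ger0_norm c0).
by rewrite ler_piMr// ew_norm.
Qed.

(* [A1 - sg A / 2] is [e^{|x|/2}] times the derivative of [e^{-|x|/2} A]. *)
Definition al U u (x : R) : R := u x - sg x * U x / 2.

Definition Dq U u : R := \int[mu]_x (ew 1 x * al U u x ^+ 2).

Lemma al_L2 U u : L2R U -> L2R u -> L2R (al U u).
Proof.
move=> hU hu; apply: L2RB => //.
have := L2R_mulb (L2RZ 2^-1 hU) sg_meas sg_le.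
by congr L2R; apply/funext => x; ring.
Qed.

Lemma igr_w w g C : measurable_fun setT w -> (forall x, `|w x| <= C) -> igr g ->
  igr (fun x => w x * g x).
Proof.
move=> mw wC hg; have := igr_mulb hg mw wC; congr igr.
by apply/funext => x; rewrite mulrC.
Qed.

Lemma igr_ew c g : 0 <= c -> igr g -> igr (fun x => ew c x * g x).
Proof.
by move=> c0; apply: igr_w (ew_meas c0) (fun x => ew_norm x c0).
Qed.

Lemma igr_sgw g : igr g -> igr (fun x => sg x * g x).
Proof. exact: igr_w sg_meas sg_le. Qed.

Lemma Dq_ge0 U u : 0 <= Dq U u.
Proof. by apply: int_ge0 => x; rewrite mulr_ge0 ?ew_ge0 ?sqr_ge0. Qed.

(** The integrand is the derivative of [sg * ew c * P], which is continuous at the origin because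
    [P 0 = 0]. The weighted inequalities below come from this identity with various [c] and [P]. *)
Lemma int_sg_weight c C P p : 0 <= c -> ac P p -> (forall x, `|P x| <= C) -> P 0 = 0 ->
  igr P -> igr p ->
  \int[mu]_x (ew c x * (sg x * p x - c * P x)) = 0.
Proof.
move=> c0 hP PC P0 iP ip_.
have h1 := acM (fun x => ew_norm x c0) PC (ac_ew c0) hP.
have h2 : ac (fun x => sg x * (ew c x * P x)) (fun x => ew c x * (sg x * p x - c * P x)).
  apply: ac_ext (ac_sg h1 _) => // [x|].
    rewrite mulrDr !mulrBr; have := sg_sq x => h.
    transitivity (sg x * sg x * (- c * ew c x * P x) + ew c x * (sg x * p x)); first by ring.
    by rewrite h; ring.
  by rewrite P0 mulr0.
apply: (int_deriv0 h2).
- by apply: igr_sgw; exact: igr_ew.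
- by apply: igr_ew => //; apply: igrB; [exact: igr_sgw|exact: igrZ].
Qed.

Lemma sob_sq U u : sob U u -> [/\ ac (fun x => U x ^+ 2) (fun x => 2 * (U x * u x)),
  igr (fun x => U x ^+ 2) & igr (fun x => 2 * (U x * u x))].
Proof.
move=> hU; have [U2 u2 _] := hU; split; last exact/igrZ/L2R_igrM.
  by apply: ac_ext (sob_acM hU hU) => x; [rewrite expr2|ring].
exact: U2.2.
Qed.

Lemma sob_sq_bound U u x : sob U u -> `|U x ^+ 2| <= 2 * nrm U * nrm u.
Proof. by move=> hU; rewrite ger0_norm ?sqr_ge0//; exact: sob_sup. Qed.

(** The left-hand side is the kinetic part of the virial derivative. The identity with [c = 1] and
    [P = U^2] says that the weighted integral of [U^2] is twice that of [sg U u], which supplies the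
    term completing the square. *)
Lemma kin_Dq U u : sob U u -> U 0 = 0 ->
  2 * \int[mu]_x (ew 1 x * u x ^+ 2) - \int[mu]_x (ew 1 x * sg x * (U x * u x)) =
  2 * Dq U u.
Proof.
move=> hU U0; have [U2 u2 _] := hU; have [aS iS iS1] := sob_sq hU.
have iUu := igr_ip U2 u2.
have i1 : igr (fun x => ew 1 x * u x ^+ 2) by apply: igr_ew => //; exact: u2.2.
have i2 : igr (fun x => ew 1 x * sg x * (U x * u x)).
  have := igr_ew ler01 (igr_sgw iUu); congr igr; by apply/funext => x; ring.
have i3 : igr (fun x => ew 1 x * U x ^+ 2) by apply: igr_ew => //; exact: U2.2.
have := int_sg_weight ler01 aS (fun x => sob_sq_bound x hU) _ iS iS1.
rewrite U0 expr0n/= => /(_ erefl) z.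
have z' : 2 * \int[mu]_x (ew 1 x * sg x * (U x * u x)) - \int[mu]_x (ew 1 x * U x ^+ 2) = 0.
  rewrite -z -intZ// -intB//; last exact: igrZ.
  by apply: int_ext => x; ring.
have -> : Dq U u = \int[mu]_x (ew 1 x * u x ^+ 2) -
    \int[mu]_x (ew 1 x * sg x * (U x * u x)) + 4^-1 * \int[mu]_x (ew 1 x * U x ^+ 2).
  rewrite -intB// -intZ// -intD//; [|exact: igrB|exact: igrZ].
  apply: int_ext => x; rewrite /al.
  transitivity (ew 1 x * u x ^+ 2 - ew 1 x * sg x * (U x * u x) +
     (sg x * sg x) * (4^-1 * (ew 1 x * U x ^+ 2))); first by field.
  by rewrite sg_sq mul1r.
lra.
Qed.

(** With [c = 2] and [P = U^2], the identity reads: the integral of [ew 2 U^2] is twice that of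
    [ew 2 sg U al]. Cauchy-Schwarz would then give the constant 4; here this is done pointwise, as a
    sum of squares, using [ew 2 <= ew 1]. *)
Lemma weight2_le U u : sob U u -> U 0 = 0 ->
  \int[mu]_x (ew 2 x * U x ^+ 2) <= 4 * Dq U u.
Proof.
move=> hU U0; have [U2 u2 _] := hU; have [aS iS iS1] := sob_sq hU.
have a2 := al_L2 U2 u2; have iUa := igr_ip U2 a2.
have := int_sg_weight (ler0n R 2) aS (fun x => sob_sq_bound x hU) _ iS iS1.
rewrite U0 expr0n/= => /(_ erefl) z.
have i1 : igr (fun x => ew 2 x * U x ^+ 2) by apply: igr_ew => //; exact: U2.2.
have i2 : igr (fun x => ew 1 x * al U u x ^+ 2) by apply: igr_ew => //; exact: a2.2.
have i3 : igr (fun x => ew 2 x * (sg x * (2 * (U x * u x)) - 2 * U x ^+ 2)).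
  by apply: igr_ew => //; apply: igrB; [exact: igr_sgw|exact: igrZ].
have : \int[mu]_x (ew 2 x * U x ^+ 2) <=
  \int[mu]_x (4 * (ew 1 x * al U u x ^+ 2) -
    2 * (ew 2 x * (sg x * (2 * (U x * u x)) - 2 * U x ^+ 2))).
  apply: int_le => //; first by apply: igrB; exact: igrZ.
  move=> x; rewrite -subr_ge0.
  have e21 : ew 2 x <= ew 1 x.
    by rewrite ew2 ler_piMr ?ew_ge0 ?ew_le1.
  (* The last summand is zero; carrying the factor [1 - sg x * sg x] lets [field] treat [sg x] as a
     free variable. *)
  have -> : 4 * (ew 1 x * al U u x ^+ 2) -
    2 * (ew 2 x * (sg x * (2 * (U x * u x)) - 2 * U x ^+ 2)) - ew 2 x * U x ^+ 2 =
    4 * ((ew 1 x - ew 2 x) * al U u x ^+ 2) +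
    ew 2 x * (2 * al U u x - sg x * U x) ^+ 2 +
     (1 - sg x * sg x) * (ew 2 x * (3 * U x ^+ 2)).
    by rewrite /al; field.
  rewrite sg_sq subrr mul0r addr0 addr_ge0//.
    by rewrite mulr_ge0// mulr_ge0 ?sqr_ge0// subr_ge0.
  by rewrite mulr_ge0 ?ew_ge0 ?sqr_ge0.
rewrite intB; [|exact: igrZ..].
by rewrite !intZ// z mulr0 subr0.
Qed.

(** [sob_sup] is applied to [ew 1 U]. Its derivative is [ew 1 (al - sg U / 2)], so both squared
    norms are at most [4 Dq], and twice their product is at most the sum of the squares. *)
Lemma sup_weight2_le U u x : sob U u -> U 0 = 0 -> ew 2 x * U x ^+ 2 <= 8 * Dq U u.
Proof.
move=> hU U0; have [U2 u2 _] := hU; have a2 := al_L2 U2 u2.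
have hw := sob_mulw (ac_ew ler01) (fun x => ew_norm x ler01)
   (fun x => ew1_bound x ler01) hU.
have := sob_sup x hw; have [w2 w12 _] := hw.
set w := (fun x => ew 1 x * U x) in hw w2 *; set w1 := (fun x => _ + _) in hw w12 *.
have n0 : nrm w ^+ 2 <= 4 * Dq U u.
  rewrite nrm_sq ip_int; apply: le_trans (weight2_le hU U0).
  by rewrite le_eqVlt; apply/orP; left; apply/eqP; apply: int_ext => y; rewrite /w ew2; ring.
have n1 : nrm w1 ^+ 2 <= 4 * Dq U u.
  rewrite nrm_sq ip_int.
  have i1 : igr (fun x => ew 2 x * U x ^+ 2) by apply: igr_ew => //; exact: U2.2.
  have i2 : igr (fun x => ew 1 x * al U u x ^+ 2) by apply: igr_ew => //; exact: a2.2.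
  apply: (@le_trans _ _ (\int[mu]_x (2 * (ew 1 x * al U u x ^+ 2) +
     2^-1 * (ew 2 x * U x ^+ 2)))).
    apply: int_le; [exact: w12.2|by apply: igrD; exact: igrZ|].
    move=> y; rewrite -subr_ge0.
    have e21 : ew 2 y <= ew 1 y by rewrite ew2 ler_piMr ?ew_ge0 ?ew_le1.
    have -> : 2 * (ew 1 y * al U u y ^+ 2) + 2^-1 * (ew 2 y * U y ^+ 2) - w1 y ^+ 2 =
      2 * ((ew 1 y - ew 2 y) * al U u y ^+ 2) +
      ew 2 y * (al U u y + sg y * U y / 2) ^+ 2 +
      (1 - sg y * sg y) * (ew 2 y * U y ^+ 2 / 2).
      by rewrite /w1 /al ew2; field.
    rewrite sg_sq subrr mul0r addr0 addr_ge0//.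
      by rewrite mulr_ge0// mulr_ge0 ?sqr_ge0// subr_ge0.
    by rewrite mulr_ge0 ?ew_ge0 ?sqr_ge0.
  rewrite intD; [|exact: igrZ..].
  rewrite !intZ//; have := weight2_le hU U0; rewrite /Dq; lra.
have -> : ew 2 x * U x ^+ 2 = w x ^+ 2 by rewrite /w ew2; ring.
move=> /le_trans; apply.
have := sqr_ge0 (nrm w - nrm w1); rewrite sqrrB -mulrA; lra.
Qed.

(** The odd extension of [s^(th + 1)]: it is differentiable at 0 in the two-sided sense, whereas
    only values at [s >= 0] are used. *)
Definition powa (th s : R) : R := s * `|s| `^ th.

Lemma powa_derive th s : 0 < th -> 0 <= s -> dat (powa th) s ((th + 1) * s `^ th).
Proof.
move=> th0; rewrite le_eqVlt => /predU1P[<-|s0].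
  rewrite powR0 ?gt_eqF// mulr0; apply: dat_intro => e e0.
  exists (e `^ th^-1) => /=; first exact: powR_gt0.
  move=> h; rewrite /ball_/= sub0r normrN => he h0.
  rewrite add0r subr0 /powa mul0r subr0 mulrA mulVf// mul1r ger0_norm ?powR_ge0//.
  have : `|h| `^ th <= (e `^ th^-1) `^ th.
    by rewrite ge0_ler_powR ?nnegrE ?powR_ge0// ltW.
  by rewrite -powRrM mulVf ?gt_eqF// powRr1// ltW.
have h1 : derivable (fun y : R => y `^ th) s 1.
  by apply: derivable_powR; rewrite in_itv/= s0.
have h2 : is_derive s 1 (fun y : R => y `^ th) (th * s `^ (th - 1)).
  apply: DeriveDef => //; rewrite -derive1E powR_derive1//.
  by rewrite in_itv/= s0.
have := is_deriveM (is_derive_id s 1) h2.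
have E : (th + 1) * s `^ th = s *: (th * s `^ (th - 1)) + s `^ th *: 1.
  rewrite /GRing.scale/= mulrCA mulr_powRB1 ?ltW//; ring.
rewrite -E; apply: near_eq_is_derive.
near=> y; rewrite /powa.
have y0 : 0 < y by near: y; exact: lt_nbhsr.
by rewrite gtr0_norm.
Unshelve. all: by end_near. Qed.

(* Integrate the derivative of [sg e^{-|x|} rho^{th+1}], [rho = A^2 + B^2], and complete
   the squares in [A + q sg al A A1] and [B + q sg al B B1], [q = 2 (th + 1) / th]. *)
Lemma weighted_power th s A A1 B B1 : 0 < th -> sob A A1 -> sob B B1 ->
  A 0 = 0 -> B 0 = 0 -> (forall x, A x ^+ 2 + B x ^+ 2 <= s) ->
  igr (fun x => ew 1 x * ((A x ^+ 2 + B x ^+ 2) * (A x ^+ 2 + B x ^+ 2) `^ th)) /\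
  \int[mu]_x (ew 1 x * ((A x ^+ 2 + B x ^+ 2) * (A x ^+ 2 + B x ^+ 2) `^ th)) <=
  4 * (th + 1) ^+ 2 / th ^+ 2 * s `^ th * (Dq A A1 + Dq B B1).
Proof.
move=> th0 hA hB A0 B0 rs.
have [A2 A12 _] := hA; have [B2 B12 _] := hB.
have [aA iA iA1] := sob_sq hA; have [aB iB iB1] := sob_sq hB.
pose r x := A x ^+ 2 + B x ^+ 2.
pose r1 x := 2 * (A x * A1 x) + 2 * (B x * B1 x).
have ar : ac r r1 by exact: acD.
have ir : igr r by exact: igrD.
have ir1 : igr r1 by exact: igrD.
have r0 x : 0 <= r x by rewrite addr_ge0 ?sqr_ge0.
have s0 : 0 <= s by apply: le_trans (r0 0) (rs 0).
have pw x : 0 <= x <= s -> x `^ th <= s `^ th.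
  by move=> /andP[x0 xs]; rewrite ge0_ler_powR ?nnegrE// ltW.
have mr : measurable_fun setT r by exact: ac_meas ar.
have mp : measurable_fun setT (fun x => r x `^ th).
  exact: (@measurableT_comp _ _ _ _ _ _ (@powR R ^~ th)).
have rp x : `|r x `^ th| <= s `^ th.
  by rewrite ger0_norm ?powR_ge0//; apply: pw; rewrite r0 rs.
have th1 : 0 <= th + 1 by rewrite addr_ge0// ltW.
have ah : ac (fun x => powa th (r x)) (fun x => ((th + 1) * r x `^ th) * r1 x).
  apply: (ac_comp (P := fun x => 0 <= x <= s) (L := (th + 1) * s `^ th)
     (dh := fun x => (th + 1) * x `^ th) ar).
  - by move=> x; rewrite r0 rs.
  - move=> a b ha hb; apply: (@dat_mono_lip _ (fun x => (th + 1) * x `^ th) 0 s) => //.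
      by move=> x /andP[x0 _]; exact: powa_derive.
    move=> x hx; rewrite normrM (ger0_norm th1) (ger0_norm (powR_ge0 _ _)).
    by rewrite ler_wpM2l// pw.
  - by move=> x /andP[x0 _]; exact: powa_derive.
  - exact: measurable_funM.
have hE x : powa th (r x) = r x * r x `^ th by rewrite /powa ger0_norm.
have ih : igr (fun x => powa th (r x)).
  have := igr_mulb ir mp rp; congr igr; by apply/funext => x; rewrite hE.
have ih1 : igr (fun x => ((th + 1) * r x `^ th) * r1 x).
  have := igrZ (th + 1) (igr_mulb ir1 mp rp); congr igr; by apply/funext => x; ring.
have hC x : `|powa th (r x)| <= s * s `^ th.
  rewrite hE normrM ler_pM// ger0_norm//; exact: rs.
have h0 : powa th (r 0) = 0 by rewrite /powa /r A0 B0 expr0n/= addr0 mul0r.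
have z := int_sg_weight ler01 ah hC h0 ih ih1.
have iZ : igr (fun x => ew 1 x * (r x * r x `^ th)).
  have := igr_ew ler01 ih; congr igr; by apply/funext => x; rewrite hE.
split=> //.
have a2 := al_L2 A2 A12; have b2 := al_L2 B2 B12.
have iDA : igr (fun x => ew 1 x * al A A1 x ^+ 2) by apply: igr_ew => //; exact: a2.2.
have iDB : igr (fun x => ew 1 x * al B B1 x ^+ 2) by apply: igr_ew => //; exact: b2.2.
(* The identity leaves [th] times the weighted power against a cross term with coefficient
   [2 (th + 1)]. Young's inequality absorbs the cross term with half of [th], and
   [2 (th + 1)^2 / th] is the price on the squares of [al]. *)
pose K := 2 * (th + 1) ^+ 2 / th.
have K0 : 0 <= K by rewrite divr_ge0 ?(ltW th0)// mulr_ge0// sqr_ge0.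
have iz : igr (fun x => ew 1 x * (sg x * ((th + 1) * r x `^ th * r1 x) - 1 * powa th (r x))).
  by apply: igr_ew => //; apply: igrB; [exact: igr_sgw|exact: igrZ].
have : \int[mu]_x (th / 2 * (ew 1 x * (r x * r x `^ th))) <=
   \int[mu]_x (K * s `^ th * (ew 1 x * al A A1 x ^+ 2 + ew 1 x * al B B1 x ^+ 2) +
    ew 1 x * (sg x * ((th + 1) * r x `^ th * r1 x) - 1 * powa th (r x))).
  apply: int_le; first exact: igrZ.
    by apply: igrD => //; apply: igrZ; exact: igrD.
  move=> x; rewrite hE -subr_ge0.
  have e1 : r1 x = 2 * (A x * al A A1 x + B x * al B B1 x) + sg x * r x.
    by rewrite /r1 /al /r; field.
  have P0 : 0 <= r x `^ th by exact: powR_ge0.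
  have PT : 0 <= s `^ th - r x `^ th by rewrite subr_ge0 pw// r0 rs.
  rewrite e1; set P := r x `^ th in P0 PT *; set T := s `^ th in PT *.
  set a := al A A1 x; set b := al B B1 x.
  pose q := 2 * (th + 1) / th.
  apply: (@le_trans _ _ (ew 1 x * (K * (T - P) * (a ^+ 2 + b ^+ 2) +
     P * (th / 2 * ((A x + q * sg x * a) ^+ 2 + (B x + q * sg x * b) ^+ 2))))).
    rewrite mulr_ge0 ?ew_ge0// addr_ge0//.
      by rewrite mulr_ge0 ?addr_ge0 ?sqr_ge0// mulr_ge0.
    by rewrite !mulr_ge0 ?addr_ge0 ?sqr_ge0// ltW.
  rewrite le_eqVlt; apply/orP; left; apply/eqP; rewrite /q /K /r.
  have tn : th != 0 by rewrite gt_eqF.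
  have sgE : sg x = 1 \/ sg x = -1 by rewrite /sg; case: ifP => _; [left|right].
  clearbody P T a b; case: sgE => ->; field => //.
rewrite intZ// intD//; last by apply: igrZ; exact: igrD.
rewrite z addr0 intZ; last exact: igrD.
rewrite intD// -/(Dq A A1) -/(Dq B B1) -/(r _).
set Z := \int[mu]_x _ => h.
have -> : Z = (2 / th) * (th / 2 * Z) by field; rewrite gt_eqF.
have -> : 4 * (th + 1) ^+ 2 / th ^+ 2 * s `^ th * (Dq A A1 + Dq B B1) =
  (2 / th) * (K * s `^ th * (Dq A A1 + Dq B B1)).
  by rewrite /K; field; rewrite gt_eqF.
by rewrite ler_wpM2l// divr_ge0// ltW.
Qed.

End weights.

(** * A priori bounds from mass and energy *)

Section apriori.
Context {R : realType}.
Local Notation mu := (@lebesgue_measure R).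
Implicit Types (g h U u w : R -> R).

Definition sqn U V : R := ip U U + ip V V.

Lemma sqn_ge0 U (V : R -> R) : 0 <= sqn U V.
Proof. by rewrite addr_ge0 ?ip_ge0. Qed.

Lemma sqn_int U (V : R -> R) : L2R U -> L2R V -> igr (rho U V) /\ \int[mu]_x rho U V x = sqn U V.
Proof.
move=> hU hV; split; first by apply: igrD; [exact: hU.2|exact: hV.2].
by rewrite /sqn !ip_int -intD//; [exact: hU.2|exact: hV.2].
Qed.

Lemma rho_ge0 U (V : R -> R) x : 0 <= rho U V x.
Proof. by rewrite addr_ge0 ?sqr_ge0. Qed.

Lemma rho_sup U U1 (V V1 : R -> R) x : sob U U1 -> sob V V1 ->
  rho U V x <= sqn U V + sqn U1 V1 /\ rho U V x ^+ 2 <= 4 * sqn U V * sqn U1 V1.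
Proof.
move=> hU hV; have := sob_sup x hU; have := sob_sup x hV.
rewrite /sqn -!nrm_sq /rho.
set a := nrm U; set b := nrm U1; set c := nrm V; set d := nrm V1 => h1 h2; split.
  have := sqr_ge0 (a - b); have := sqr_ge0 (c - d); rewrite !sqrrB; lra.
apply: (@le_trans _ _ ((2 * a * b + 2 * c * d) ^+ 2)).
  by rewrite ler_sqr ?nnegrE ?addr_ge0 ?sqr_ge0 ?mulr_ge0 ?nrm_ge0// lerD.
rewrite -subr_ge0.
have -> : 4 * (a ^+ 2 + c ^+ 2) * (b ^+ 2 + d ^+ 2) - (2 * a * b + 2 * c * d) ^+ 2 =
  4 * (a * d - b * c) ^+ 2 by ring.
by rewrite mulr_ge0 ?sqr_ge0.
Qed.

Lemma powR_le1sq (th s : R) : 0 < th <= 2 -> 0 <= s -> s `^ th <= 1 + s ^+ 2.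
Proof.
move=> /andP[th0 th2] s0; have [s1|s1] := leP s 1.
  apply: (@le_trans _ _ 1); last by rewrite lerDl sqr_ge0.
  have : s `^ th <= 1 `^ th by rewrite ge0_ler_powR ?nnegrE// ltW.
  by rewrite powR1.
apply: (@le_trans _ _ (s `^ 2)); first by rewrite ler_powR// ltW.
by rewrite powR_mulrn// lerDr.
Qed.

(** Since [th <= 2], [rho^th] is at most [1 + rho^2], and [rho^2] is bounded by four times the
    product of the mass and the squared norm of the derivative. The latter thus enters linearly,
    with the square of the mass as coefficient. *)
Lemma pot_le (f F : R -> R) (th C : R) U U1 (V V1 : R -> R) : nonlin f F -> 0 < th <= 2 -> 0 <= C ->
  (forall s, 0 <= s -> `|F s| <= C * (s * s `^ th)) ->
  sob U U1 -> sob V V1 ->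
  `|\int[mu]_x F (rho U V x)| <= C * (sqn U V * (1 + 4 * sqn U V * sqn U1 V1)).
Proof.
move=> hn hth C0 hF hU hV; have [U2 U12 _] := hU; have [V2 V12 _] := hV.
have [ir er] := sqn_int U2 V2.
pose S := Num.max (nrm U + nrm U1 + 1) (nrm V + nrm V1 + 1).
have iF : igr (fun x => F (rho U V x)).
  apply: (igr_F hn (S := S)) => // x; rewrite /S le_max.
    by rewrite sob_bounded.
  by rewrite (sob_bounded x hV) orbT.
set K := 1 + _.
have -> : C * (sqn U V * K) = \int[mu]_x (C * K * rho U V x).
  by rewrite intZ// er; ring.
apply: int_norm_le => //; first exact: igrZ.
move=> x; have r0 := rho_ge0 U V x.
apply: le_trans (hF _ r0) _; rewrite -mulrA ler_wpM2l// mulrC ler_wpM2r//.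
apply: le_trans (powR_le1sq hth r0) _; rewrite lerD2l.
by have [] := rho_sup x hU hV.
Qed.

Variables (m : R) (V V1 f F : R -> R) (A A1 B B1 : R -> R -> R).
Hypothesis sol : rsol m V V1 f F A A1 B B1.

Lemma vpot_le (v0 t : R) : (forall x, `|V x| <= v0) ->
  `|ip (A t) (fun x => V x * A t x) + ip (B t) (fun x => V x * B t x)| <=
  v0 * sqn (A t) (B t).
Proof.
move=> hv; have [A2 _ B2 _] := sol_L2 sol t.
have mV := ac_meas (rs_V sol).
have a2 := L2R_mulb A2 mV hv; have b2 := L2R_mulb B2 mV hv.
have v0p : 0 <= v0 by apply: le_trans (hv 0).
apply: le_trans (ler_normD _ _) _; rewrite mulrDr lerD//.
  apply: le_trans (CS A2 a2) _; rewrite -nrm_sq mulrC expr2 mulrA ler_wpM2r ?nrm_ge0//.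
  exact: nrm_mulb.
apply: le_trans (CS B2 b2) _; rewrite -nrm_sq mulrC expr2 mulrA ler_wpM2r ?nrm_ge0//.
exact: nrm_mulb.
Qed.

(** The mass is conserved, so the smallness of [E] applies at time [t] at once: by [8 C E <= 1], the
    potential energy uses at most half of the kinetic term plus [C E]. The bound therefore follows
    without a continuity argument in time. *)
Lemma apriori (th C v0 E t : R) : 0 <= m <= 1 -> (forall x, `|V x| <= v0) ->
  0 < th <= 2 -> 0 <= C -> (forall s, 0 <= s -> `|F s| <= C * (s * s `^ th)) ->
  E <= 1 -> 8 * C * E <= 1 -> sqn (A 0) (B 0) + sqn (A1 0) (B1 0) <= E -> 0 <= t ->
  sqn (A t) (B t) <= E /\ sqn (A1 t) (B1 t) <= 2 * E * (1 + 2 * v0 + 6 * C).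
Proof.
move=> /andP[m0 m1] hv hth C0 hF E1 CE h0 t0.
have v0p : 0 <= v0 by apply: le_trans (hv 0).
have sA s := (rs_A sol).1 s; have sB s := (rs_B sol).1 s.
have e0 := energy_const sol t0; have p0 := pot_le (rs_nl sol) hth C0 hF (sA 0) (sB 0).
have pt := pot_le (rs_nl sol) hth C0 hF (sA t) (sB t).
have q0 := vpot_le 0 hv; have qt := vpot_le t hv.
have nt : sqn (A t) (B t) = sqn (A 0) (B 0) by exact: (mass_const sol t0).
have k0 := sqn_ge0 (A1 0) (B1 0); have kt := sqn_ge0 (A1 t) (B1 t).
have n0 := sqn_ge0 (A 0) (B 0).
move: e0 p0 pt q0 qt h0; rewrite /energy -/(sqn _ _) -/(sqn (A1 0) (B1 0)) nt.
move: (sqn (A 0) (B 0)) (sqn (A1 0) (B1 0)) (sqn (A1 t) (B1 t)) k0 kt n0 => n k0 kt.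
move: (ip (A t) _ + _) (ip (A 0) _ + _) (\int[mu]_x F (rho (A t) (B t) x))
  (\int[mu]_x F (rho (A 0) (B 0) x)) => Qt Q0 Pt P0.
move=> hk0 hkt hn e0 p0 pt q0 qt h0.
have nE : n <= E by lra.
have k0E : k0 <= E by lra.
split=> //.
have mul_le x q : `|x| <= q -> `|m * x| <= q.
  move=> xq; rewrite normrM (ger0_norm m0); apply: le_trans xq.
  by rewrite ler_piMl.
(* The initial mass and kinetic term are at most [E <= 1], so the bracket is at most 5. Together
   with the [C E] at time [t] this gives the 6 in the conclusion. *)
have b0 : C * (n * (1 + 4 * n * k0)) <= C * (5 * E).
  rewrite ler_wpM2l//.
  have : n * k0 <= 1 by rewrite mulr_ile1//; lra.
  move=> h; have : n * (1 + 4 * n * k0) <= n * 5 by rewrite ler_wpM2l//; lra.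
  lra.
have bt : C * (n * (1 + 4 * n * kt)) <= C * E + kt / 2.
  have h1 : n * n * kt <= E * kt.
    rewrite ler_wpM2r//; apply: le_trans nE; rewrite ler_piMr//; lra.
  have h2 : C * (n * n * kt) <= C * (E * kt) by rewrite ler_wpM2l.
  have h3 : C * n <= C * E by rewrite ler_wpM2l.
  have h4 : 8 * C * E * kt <= 1 * kt by rewrite ler_wpM2r.
  lra.
have vn : v0 * n <= v0 * E by rewrite ler_wpM2l.
move: {q0} (mul_le _ _ q0) {qt} (mul_le _ _ qt) e0 p0 pt; rewrite !ler_norml.
move: (m * Q0) (m * Qt) => x1 x2 /andP[? ?] /andP[? ?] ? /andP[? ?] /andP[? ?].
lra.
Qed.

End apriori.

(** * Virial terms at a fixed time: kinetic part and potential *)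

Section virial_static.
Context {R : realType}.
Local Notation mu := (@lebesgue_measure R).
Implicit Types (g h U u w X : R -> R).

Definition ph (x : R) : R := sg x * (1 - ew 1 x).

Lemma ac_ph : ac ph (ew 1).
Proof.
have h : ac (fun x : R => 1 - ew 1 x) (fun x => 0 - - 1 * ew 1 x * sg x).
  by apply: acB (ac_cst 1) (ac_ew ler01).
apply: ac_ext (ac_sg h _) => // [x|].
  transitivity (sg x * sg x * ew 1 x); first by ring.
  by rewrite sg_sq mul1r.
by rewrite /ew normr0 mulr0 oppr0 expR0 subrr.
Qed.

Lemma ph_norm (x : R) : `|ph x| <= 1.
Proof.
rewrite normrM sg_norm mul1r ger0_norm ?subr_ge0 ?ew_le1//.
by rewrite lerBlDr lerDl ew_ge0.
Qed.

Lemma ph_meas : measurable_fun setT ph.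
Proof. exact: ac_meas ac_ph. Qed.

Lemma ph_diff (a b x : R) : a <= b -> (forall y, a <= y <= b -> `|y - x| <= 1) ->
  `|ph b - ph a| <= expR 1 * ew 1 x * (b - a).
Proof.
move=> ab hx; rewrite ac_ph.2// ger0_norm; last by apply: lig_itg_ge0 => y; exact: ew_ge0.
rewrite -itg_cst//; apply: itg_le => //; [exact: ac_ph.1|exact: lig_cst|].
move=> y /hx yx; rewrite /ew -expRD ler_expR !mul1r.
have := ler_normB y (y - x); have -> : y - (y - x) = x by ring.
by move=> h; have := le_trans h (lerD (lexx _) yx); lra.
Qed.

(** A step of length at most 1 changes the weight [ew 1] by at most a factor e. This is the origin
    of [expR 1] in the smallness conditions below. *)
Lemma dq_ph a (x : R) : `|a| <= 1 -> `|dq a ph x| <= expR 1 * ew 1 x.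
Proof.
move=> a1; have [->|a0] := eqVneq a 0.
  by rewrite /dq invr0 mul0r normr0 mulr_ge0 ?expR_ge0.
rewrite /dq normrM normfV mulrC ler_pdivrMr ?normr_gt0//.
move: a1; have [ap|an] := leP 0 a.
  rewrite (ger0_norm ap) => a1; have := @ph_diff x (x + a) x.
  have -> : x + a - x = a by ring.
  apply; first by rewrite lerDl.
  by move=> y /andP[y1 y2]; rewrite ler_norml; apply/andP; split; lra.
rewrite (ltr0_norm an) distrC => a1; have := @ph_diff (x + a) x x.
have -> : x - (x + a) = - a by ring.
apply; first by rewrite gerDl ltW.
by move=> y /andP[y1 y2]; rewrite ler_norml; apply/andP; split; lra.
Qed.

Lemma int_dq a g h C : igr g -> measurable_fun setT h -> (forall x, `|h x| <= C) ->
  \int[mu]_x (h x * dq a g x) = - \int[mu]_x (dq (- a) h x * g x).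
Proof.
move=> ig mh hC.
have i1 : igr (fun x => h x * g x) by exact: igr_w.
have i2 : igr (fun x => h x * g (x + a)) by apply: igr_w => //; exact: igr_shift.
have i3 : igr (fun x => h (x - a) * g x).
  by apply: igr_w => //; exact: measurable_shift.
have e : \int[mu]_x (h x * g (x + a)) = \int[mu]_x (h (x - a) * g x).
  rewrite -(@int_shift _ (fun x => h (x - a) * g x) a)//.
  by apply: int_ext => x; rewrite addrK.
transitivity (a^-1 * (\int[mu]_x (h x * g (x + a)) - \int[mu]_x (h x * g x))).
  rewrite -intB// -intZ//; last exact: igrB.
  by apply: int_ext => x; rewrite /dq; ring.
rewrite e -intB// -intZ; last exact: igrB.
rewrite -intN; first by apply: int_ext => x; rewrite /dq invrN; ring.
have := igrZ (- a^-1) (igrB i3 i1); congr igr; apply/funext => x; rewrite /dq invrN; ring.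
Qed.

(** As the step tends to 0, the first pairing tends to the integral of [ew 1 X1^2], and the second
    to the pairing of [X1] with the derivative of [ew 1 X]. [kin_Dq] identifies the sum with
    [2 Dq]. *)
Lemma kin_limit a X X1 : sob X X1 -> X 0 = 0 ->
  `|ip X1 (fun x => ew 1 x * dq a X x) + ip X1 (dq (- a) (fun x => ew 1 x * X x))
    - 2 * Dq X X1| <=
  nrm X1 * (nrm (fun x => dq a X x - X1 x) +
    nrm (fun x => dq (- a) (fun x => ew 1 x * X x) x -
       ((- 1 * ew 1 x * sg x) * X x + ew 1 x * X1 x))).
Proof.
move=> hX X0; have [X2 X12 _] := hX.
have hw := sob_mulw (ac_ew ler01) (fun x => ew_norm x ler01)
   (fun x => ew1_bound x ler01) hX.
have [w2 w12 _] := hw; have d2 := L2R_dq a X2; have d2' := L2R_dq (- a) w2.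
have mE := ew_meas (ler01 : 0 <= 1 :> R); have bE := fun x : R => ew_norm x ler01.
have eX := L2R_mulb X12 mE bE; have ed := L2R_mulb d2 mE bE.
have b2 := L2RB d2 X12; have eb := L2R_mulb b2 mE bE; have b2' := L2RB d2' w12.
have -> : ip X1 (fun x => ew 1 x * dq a X x) + ip X1 (dq (- a) (fun x => ew 1 x * X x))
    - 2 * Dq X X1 = ip X1 (fun x => ew 1 x * (dq a X x - X1 x)) +
   ip X1 (fun x => dq (- a) (fun x => ew 1 x * X x) x -
       ((- 1 * ew 1 x * sg x) * X x + ew 1 x * X1 x)).
  rewrite -(kin_Dq hX X0) (ipBr d2' w12 X12).
  have -> : ip X1 (fun x => ew 1 x * (dq a X x - X1 x)) =
     ip X1 (fun x => ew 1 x * dq a X x) - ip X1 (fun x => ew 1 x * X1 x).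
     by rewrite -ipBr//; apply: int_ext => x; ring.
  have -> : ip X1 (fun x => (- 1 * ew 1 x * sg x) * X x + ew 1 x * X1 x) =
    ip X1 (fun x => ew 1 x * X1 x) - \int[mu]_x (ew 1 x * sg x * (X x * X1 x)).
    rewrite /ip -intB; first by apply: int_ext => x; ring.
      exact: igr_ip.
    have := igr_ew ler01 (igr_sgw (igr_ip X2 X12)); congr igr.
    by apply/funext => x; ring.
  have -> : \int[mu]_x (ew 1 x * X1 x ^+ 2) = ip X1 (fun x => ew 1 x * X1 x).
    by apply: int_ext => x; ring.
  ring.
apply: le_trans (ler_normD _ _) _; rewrite mulrDr lerD//; last exact: CS.
apply: le_trans (CS X12 eb) _; rewrite ler_wpM2l ?nrm_ge0//.
by rewrite -[leRHS]mul1r; exact: nrm_mulb.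
Qed.

(** Replacing [A (x + a)] by [A x] costs an L^2 increment of size [|a| nrm A1], and likewise for
    [B]. *)
Lemma mass_flux_le a (A A1 B B1 : R -> R) g v : sob A A1 -> sob B B1 ->
  measurable_fun setT g -> (forall x, `|g x| <= v) ->
  igr (fun x => g x * (A x * A (x + a) + B x * B (x + a))) /\
  `|\int[mu]_x (g x * (A x * A (x + a) + B x * B (x + a)))| <=
  \int[mu]_x (`|g x| * rho A B x) +
    v * `|a| * (nrm A * nrm A1 + nrm B * nrm B1).
Proof.
move=> hA hB mg gv; have [A2 A12 _] := hA; have [B2 B12 _] := hB.
have v0 : 0 <= v by apply: le_trans (gv 0).
have As := L2R_shift a A2; have Bs := L2R_shift a B2.
have ir : igr (rho A B) by apply: igrD; [exact: A2.2|exact: B2.2].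
have ia := igr_ip A2 As; have ib := igr_ip B2 Bs.
have i0 : igr (fun x => g x * (A x * A (x + a) + B x * B (x + a))).
  by apply: igr_w => //; exact: igrD.
have ig1 : igr (fun x => `|g x| * rho A B x).
  apply: (igr_w (C := v)) => //; first exact: measurableT_comp.
  by move=> x; rewrite normr_id.
split=> //.
have dA := L2RB As A2; have dB := L2RB Bs B2.
have ja := igr_ip (L2R_norm A2) (L2R_norm dA); have jb := igr_ip (L2R_norm B2) (L2R_norm dB).
have j := igrZ v (igrD ja jb).
have k : igr (fun x => `|g x| * rho A B x + v * (`|A x| * `|A (x + a) - A x| +
    `|B x| * `|B (x + a) - B x|)) by exact: igrD.
apply: le_trans (int_norm_le i0 k _) _.
  move=> x; rewrite normrM.
  have -> : A x * A (x + a) + B x * B (x + a) = rho A B x +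
     (A x * (A (x + a) - A x) + B x * (B (x + a) - B x)) by rewrite /rho; ring.
  apply: le_trans (ler_wpM2l (normr_ge0 _) (ler_normD _ _)) _.
  rewrite mulrDr (ger0_norm (rho_ge0 _ _ _)) lerD2l ler_pM//.
  by apply: le_trans (ler_normD _ _) _; rewrite !normrM.
rewrite intD// intZ ?intD//; last exact: igrD.
have b X X1 : @sob R X X1 -> \int[mu]_x (`|X x| * `|X (x + a) - X x|) <=
    `|a| * (nrm X * nrm X1).
  move=> hX; have [X2 _ _] := hX; have dX := L2RB (L2R_shift a X2) X2.
  apply: le_trans (ler_norm _) _; apply: le_trans (CS (L2R_norm X2) (L2R_norm dX)) _.
  by rewrite !nrm_norm mulrCA ler_wpM2l ?nrm_ge0// nrm_shiftB.
by rewrite lerD2l -mulrA ler_wpM2l// mulrDr lerD// b.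
Qed.

(** The supremum bound on [ew 2 rho] is paired with the integrability of [V1] against the inverse
    weight. *)
Lemma weighted_rho (A A1 B B1 V1 : R -> R) : sob A A1 -> sob B B1 -> A 0 = 0 -> B 0 = 0 ->
  measurable_fun setT V1 ->
  igr (fun x => `|V1 x| * expR (2 * `|x|)) ->
  igr (fun x => `|V1 x| * rho A B x) /\
  \int[mu]_x (`|V1 x| * rho A B x) <=
  8 * (Dq A A1 + Dq B B1) * \int[mu]_x (`|V1 x| * expR (2 * `|x|)).
Proof.
move=> hA hB A0 B0 mV iV.
have le x : `|V1 x| * rho A B x <= 8 * (Dq A A1 + Dq B B1) * (`|V1 x| * expR (2 * `|x|)).
  rewrite mulrCA ler_wpM2l//.
  have := sup_weight2_le x hA A0; have := sup_weight2_le x hB B0; rewrite /rho.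
  have e0 := expR_gt0 (2 * `|x|); have := expRxMexpNx_1 (2 * `|x|).
  rewrite -/(ew 2 x) => E h1 h2.
  have -> : A x ^+ 2 + B x ^+ 2 = (ew 2 x * A x ^+ 2 + ew 2 x * B x ^+ 2) * expR (2 * `|x|).
    by rewrite -mulrDr mulrAC [ew 2 x * _]mulrC E mul1r.
  by rewrite ler_pM2r//; lra.
have [A2 _ _] := hA; have [B2 _ _] := hB.
have mr : measurable_fun setT (rho A B).
  by apply: measurable_funD; apply: measurable_funX; [exact: A2.1|exact: B2.1].
have i : igr (fun x => `|V1 x| * rho A B x).
  apply: igr_le (igrZ (8 * (Dq A A1 + Dq B B1)) iV).
    by apply: measurable_funM => //; exact: measurableT_comp.
  by move=> x; rewrite ger0_norm ?mulr_ge0 ?rho_ge0.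
by split=> //; rewrite -intZ//; apply: int_le => //; exact: igrZ.
Qed.

Lemma sum_le_sq (x y S : R) : 0 <= x -> 0 <= y -> x + y <= S ->
  x ^+ 2 <= S ^+ 2 /\ x * y <= S ^+ 2.
Proof.
move=> x0 y0 h; have S0 : 0 <= S by apply: le_trans h; exact: addr_ge0.
have xS : x <= S by apply: le_trans h; rewrite lerDl.
have yS : y <= S by apply: le_trans h; rewrite lerDr.
by split; [rewrite ler_sqr|rewrite expr2 ler_pM].
Qed.

Lemma potential_flux a (A A1 B B1 V V1 : R -> R) (S v1 v2 : R) : sob A A1 -> sob B B1 ->
  A 0 = 0 -> B 0 = 0 -> ac V V1 -> (forall x, `|dq a V x - V1 x| <= v2 * `|a|) ->
  (forall x, `|V1 x| <= v1) -> igr (fun x => `|V1 x| * expR (2 * `|x|)) ->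
  `|a| <= 1 -> nrm A + nrm A1 <= S -> nrm B + nrm B1 <= S -> 0 <= v2 ->
  igr (fun x => ph x * dq a V x * (A x * A (x + a) + B x * B (x + a))) /\
  `|\int[mu]_x (ph x * dq a V x * (A x * A (x + a) + B x * B (x + a)))| <=
  8 * (Dq A A1 + Dq B B1) * \int[mu]_x (`|V1 x| * expR (2 * `|x|)) +
    `|a| * (2 * S ^+ 2 * (v1 + 2 * v2)).
Proof.
move=> hA hB A0 B0 aV Va hv1 iV a1 nA nB v20.
have v10 : 0 <= v1 by apply: le_trans (hv1 0).
have mV := ac_meas aV; have mV1 := aV.1.1.
have [A2 A12 _] := hA; have [B2 B12 _] := hB.
have mg : measurable_fun setT (fun x => ph x * dq a V x).
  apply: measurable_funM; first exact: ph_meas.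
  apply: measurable_funM => //; apply: measurable_funB => //; exact: measurable_shift.
have dV x : `|dq a V x| <= `|V1 x| + v2 * `|a|.
  by have := ler_normD (dq a V x - V1 x) (V1 x); rewrite subrK; have := Va x; lra.
have gl x : `|ph x * dq a V x| <= `|V1 x| + v2 * `|a|.
  rewrite normrM; apply: le_trans (dV x); rewrite ler_piMl//; exact: ph_norm.
have gv x : `|ph x * dq a V x| <= v1 + v2.
  apply: le_trans (gl x) _; apply: lerD; first exact: hv1.
  by rewrite ler_piMr.
have [i h] := mass_flux_le a hA hB mg gv; split=> //; apply: le_trans h _.
have [j hj] := weighted_rho hA hB A0 B0 mV1 iV.
have [ir er] := sqn_int A2 B2.
have [ka la] := sum_le_sq (nrm_ge0 A) (nrm_ge0 A1) nA.
have [kb lb] := sum_le_sq (nrm_ge0 B) (nrm_ge0 B1) nB.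
have h1 : \int[mu]_x (`|ph x * dq a V x| * rho A B x) <=
   \int[mu]_x (`|V1 x| * rho A B x + v2 * `|a| * rho A B x).
  apply: int_le.
  - apply: (igr_w (C := v1 + v2)) => //; first exact: measurableT_comp.
    by move=> x; rewrite normr_id.
  - by apply: igrD => //; exact: igrZ.
  - by move=> x; rewrite -mulrDl ler_wpM2r ?rho_ge0.
rewrite intD ?intZ// in h1; last exact: igrZ.
rewrite er /sqn -!nrm_sq in h1.
have h2 : v2 * `|a| * (nrm A ^+ 2 + nrm B ^+ 2) <= v2 * `|a| * (2 * S ^+ 2).
  by rewrite ler_wpM2l ?mulr_ge0// (mulr_natl _ 2) mulr2n lerD.
have h3 : (v1 + v2) * `|a| * (nrm A * nrm A1 + nrm B * nrm B1) <=
   (v1 + v2) * `|a| * (2 * S ^+ 2).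
  by rewrite ler_wpM2l ?mulr_ge0// ?addr_ge0// (mulr_natl _ 2) mulr2n lerD.
have -> : `|a| * (2 * S ^+ 2 * (v1 + 2 * v2)) =
  v2 * `|a| * (2 * S ^+ 2) + (v1 + v2) * `|a| * (2 * S ^+ 2) by ring.
apply: le_trans (lerD (le_trans h1 (lerD hj h2)) h3) _.
by rewrite addrA.
Qed.

End virial_static.

(** * Virial terms at a fixed time: the nonlinearity *)

Section nonlinear_flux.
Context {R : realType}.
Local Notation mu := (@lebesgue_measure R).
Implicit Types (g h U u w X : R -> R).

(* Up to squares of increments, [(f(rho))' rho] is the derivative of [f(rho) rho - F(rho)]. *)
Lemma flux_remainder (f F : R -> R) (S : R) : nonlin f F -> 0 <= S ->
  exists2 K, 0 <= K & forall a b c d : R,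
    `|a| <= S -> `|b| <= S -> `|c| <= S -> `|d| <= S ->
    `|(f (c ^+ 2 + d ^+ 2) - f (a ^+ 2 + b ^+ 2)) * (a * c + b * d) -
      (f (c ^+ 2 + d ^+ 2) * (c ^+ 2 + d ^+ 2) - F (c ^+ 2 + d ^+ 2) -
      (f (a ^+ 2 + b ^+ 2) * (a ^+ 2 + b ^+ 2) - F (a ^+ 2 + b ^+ 2)))| <=
    K * ((c - a) ^+ 2 + (d - b) ^+ 2).
Proof.
move=> hn S0; have [L1 L10 h1] := nl_lip hn S; have [L2 L20 h2] := nl_taylor hn S.
have [C C0 h3] := nl_bound hn S.
exists (C + L2 + 2 * L1 * S); first by rewrite !addr_ge0// !mulr_ge0.
move=> a b c d ha hb hc hd.
move: (h1 a b c d ha hb hc hd) (h2 a b c d ha hb hc hd) (h3 a b ha hb) (h3 c d hc hd).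
set g1 := f (a ^+ 2 + b ^+ 2); set g2 := f (c ^+ 2 + d ^+ 2).
set F1 := F (a ^+ 2 + b ^+ 2); set F2 := F (c ^+ 2 + d ^+ 2) => k1 k2 k3 k4.
set D := (c - a) ^+ 2 + (d - b) ^+ 2.
have D0 : 0 <= D by rewrite addr_ge0 ?sqr_ge0.
have -> : (g2 - g1) * (a * c + b * d) -
      (g2 * (c ^+ 2 + d ^+ 2) - F2 - (g1 * (a ^+ 2 + b ^+ 2) - F1)) =
  - ((g2 - g1) * D / 2) + (F2 - F1 - g1 * (c ^+ 2 + d ^+ 2 - (a ^+ 2 + b ^+ 2)))
  - (g2 - g1) * (((c - a) * (c + a) + (d - b) * (d + b)) / 2) by rewrite /D; field.
have -> : (C + L2 + 2 * L1 * S) * D = C * D + L2 * D + 2 * L1 * S * D by ring.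
apply: le_trans (ler_normB _ _) _; apply: lerD.
  apply: le_trans (ler_normD _ _) _; apply: lerD => //.
  rewrite normrN -mulrA normrM [`|D / 2|]ger0_norm ?divr_ge0//.
  have gg : `|g2 - g1| <= 2 * C by apply: le_trans (ler_normB _ _) _; lra.
  have -> : C * D = (2 * C) * (D / 2) by field.
  by rewrite ler_wpM2r// divr_ge0.
rewrite normrM.
apply: (@le_trans _ _ (L1 * (`|c - a| + `|d - b|) * (S * (`|c - a| + `|d - b|)))).
  apply: ler_pM => //; rewrite normrM [`|2^-1|]ger0_norm// ler_pdivrMr//.
  apply: le_trans (ler_normD _ _) _; rewrite !normrM.
  have -> : S * (`|c - a| + `|d - b|) * 2 = `|c - a| * (S + S) + `|d - b| * (S + S) by ring.
  by apply: lerD; rewrite ler_wpM2l//; apply: le_trans (ler_normD _ _) _; exact: lerD.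
have -> : L1 * (`|c - a| + `|d - b|) * (S * (`|c - a| + `|d - b|)) =
  L1 * S * (`|c - a| + `|d - b|) ^+ 2 by ring.
have -> : 2 * L1 * S * D = L1 * S * (2 * D) by ring.
rewrite ler_wpM2l ?mulr_ge0// /D -!(real_normK (num_real (_ - _))).
have := sqr_ge0 (`|c - a| - `|d - b|); rewrite sqrrB sqrrD; lra.
Qed.

(** By [flux_remainder] the integrand is [ph] times the quotient of [H = f(rho) rho - F(rho)], up to
    [a^-1] times squares of increments. The main term is summed by parts: the quotient of [ph]
    decays like [ew 1] and [|H| <= 2 C rho^(th + 1)], so [weighted_power] applies. The squares have
    integral of order [a^2], hence the error [|a| K]. *)
Lemma nonlinear_flux (f F : R -> R) (th C S : R) : nonlin f F -> 0 < th -> 0 <= C ->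
  0 <= S -> (forall s, 0 <= s -> `|f s| <= C * s `^ th) ->
  (forall s, 0 <= s -> `|F s| <= C * (s * s `^ th)) ->
  exists2 K, 0 <= K & forall (A A1 B B1 : R -> R) a s, sob A A1 -> sob B B1 ->
  A 0 = 0 -> B 0 = 0 -> a != 0 -> `|a| <= 1 ->
  (forall x, `|A x| <= S) -> (forall x, `|B x| <= S) -> 
  nrm A + nrm A1 <= S -> nrm B + nrm B1 <= S -> (forall x, rho A B x <= s) ->
  igr (fun x => ph x * dq a (fun x => f (rho A B x)) x *
     (A x * A (x + a) + B x * B (x + a))) /\
  `|\int[mu]_x (ph x * dq a (fun x => f (rho A B x)) x *
     (A x * A (x + a) + B x * B (x + a)))| <=
  expR 1 * (2 * C * (4 * (th + 1) ^+ 2 / th ^+ 2 * s `^ th * (Dq A A1 + Dq B B1))) +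
  `|a| * K.
Proof.
move=> hn th0 C0 S0 hf hF; have [K0 K00 hK] := flux_remainder hn S0.
have [Cg Cg0 hg] := nl_bound hn S.
exists (2 * K0 * S ^+ 2); first by rewrite !mulr_ge0// sqr_ge0.
move=> A A1 B B1 a s hA hB A0 B0 a0 a1 AS BS nA nB rs.
have [A2 A12 _] := hA; have [B2 B12 _] := hB.
have As := L2R_shift a A2; have Bs := L2R_shift a B2.
pose g x := f (rho A B x); pose H x := g x * rho A B x - F (rho A B x).
have mg : measurable_fun setT g by apply: (nl_measf hn); [exact: A2.1|exact: B2.1].
have gC x : `|g x| <= Cg by exact: hg.
have mgs : measurable_fun setT (fun x : R => g (x + a)) by exact: measurable_shift.
have [ir er] := sqn_int A2 B2.
have iF : igr (fun x => F (rho A B x)) by exact: (igr_F hn AS BS).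
have iH : igr H by apply: igrB => //; exact: igr_w.
have iHs : igr (fun x => H (x + a)) by exact: igr_shift.
have iP : igr (fun x => A x * A (x + a) + B x * B (x + a)).
  by apply: igrD; exact: igr_ip.
have mph := @ph_meas R; have bph := @ph_norm R.
pose E x := (g (x + a) - g x) * (A x * A (x + a) + B x * B (x + a)) - (H (x + a) - H x).
have iE : igr E.
  apply: igrB; last exact: igrB.
  apply: (igr_w (C := 2 * Cg)) => //; first exact: measurable_funB.
  by move=> x; apply: le_trans (ler_normB _ _) _; have := gC x; have := gC (x + a); lra.
have iphE : igr (fun x => ph x * E x) by apply: igr_w.
have idH : igr (dq a H) by apply: igrZ; exact: igrB.
have iphH : igr (fun x => ph x * dq a H x) by apply: igr_w.
have e x : ph x * dq a g x * (A x * A (x + a) + B x * B (x + a)) =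
  ph x * dq a H x + a^-1 * (ph x * E x) by rewrite /dq /E; ring.
have i0 : igr (fun x => ph x * dq a g x * (A x * A (x + a) + B x * B (x + a))).
  have := igrD iphH (igrZ a^-1 iphE); congr igr; apply/funext => x; exact/esym/e.
split=> //; rewrite (int_ext e) intD//; last exact: igrZ.
rewrite intZ//; apply: le_trans (ler_normD _ _) _; apply: lerD.
  rewrite (int_dq a iH mph bph) normrN.
  have [iw hw] := weighted_power th0 hA hB A0 B0 rs.
  have mdq : measurable_fun setT (dq (- a) ph).
    apply: measurable_funM => //; apply: measurable_funB => //; exact: measurable_shift.
  have dqb x : `|dq (- a) ph x| <= expR 1 * ew 1 x by apply: dq_ph; rewrite normrN.
  apply: le_trans (ler_wpM2l (expR_ge0 1) (ler_wpM2l _ hw)); last by rewrite mulr_ge0.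
  rewrite -intZ// -intZ; last exact: igrZ.
  apply: int_norm_le.
  - apply: (igr_w (C := expR 1)) => // x; apply: le_trans (dqb x) _.
    by rewrite ler_piMr ?expR_ge0 ?ew_le1.
  - by apply: igrZ; exact: igrZ.
  move=> x; rewrite normrM; apply: le_trans (ler_wpM2r (normr_ge0 _) (dqb x)) _.
  rewrite -[leLHS]mulrA; apply: ler_wpM2l; first exact: expR_ge0.
  rewrite [leRHS]mulrCA; apply: ler_wpM2l; first exact: ew_ge0.
  have r0 := rho_ge0 A B x.
  apply: le_trans (ler_normB _ _) _; rewrite normrM (ger0_norm r0).
  have := hF _ r0; have := ler_wpM2r r0 (hf _ r0); rewrite -/(g x) -/(rho A B x); lra.
rewrite normrM normfV ler_pdivrMl ?normr_gt0//.
have iA : igr (fun x => (A (x + a) - A x) ^+ 2) by exact: (L2RB As A2).2.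
have iB : igr (fun x => (B (x + a) - B x) ^+ 2) by exact: (L2RB Bs B2).2.
apply: (@le_trans _ _ (\int[mu]_x (K0 * ((A (x + a) - A x) ^+ 2 + (B (x + a) - B x) ^+ 2)))).
  apply: int_norm_le => //; first by apply: igrZ; exact: igrD.
  move=> x; rewrite normrM.
  by apply: (@le_trans _ _ (1 * `|E x|)); [exact: ler_wpM2r|rewrite mul1r; exact: hK].
rewrite intZ ?intD//; last exact: igrD.
rewrite -!ip_int -!nrm_sq.
have nn X X1 : sob X X1 -> nrm X + nrm X1 <= S ->
  nrm (fun x => X (x + a) - X x) ^+ 2 <= `|a| ^+ 2 * S ^+ 2.
  move=> hX nX; rewrite -exprMn ler_sqr ?nnegrE ?mulr_ge0 ?nrm_ge0//.
  apply: le_trans (nrm_shiftB a hX) _; rewrite ler_wpM2l//.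
  by apply: le_trans nX; rewrite lerDr nrm_ge0.
have -> : `|a| * (`|a| * (2 * K0 * S ^+ 2)) =
  K0 * (`|a| ^+ 2 * S ^+ 2 + `|a| ^+ 2 * S ^+ 2) by ring.
by rewrite ler_wpM2l// lerD// (nn _ _ hA nA, nn _ _ hB nB).
Qed.

End nonlinear_flux.

(** * Time derivative of the discretised virial *)

Section virial.
Context {R : realType}.
Local Notation mu := (@lebesgue_measure R).
Implicit Types (g h U u w X : R -> R).

Lemma dq_N (a : R) g : dq a (fun x => - g x) = (fun x => - dq a g x).
Proof. by apply/funext => x; rewrite /dq; ring. Qed.

Variables (m : R) (V V1 f F : R -> R) (A A1 B B1 : R -> R -> R).
Hypothesis sol : rsol m V V1 f F A A1 B B1.
Let W t x := m * V x + f (rho (A t) (B t) x).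

(* The virial [virial] with difference quotients in place of derivatives. *)
Definition virq a t : R := ip (A t) (fun x => ph x * dq a (B t) x) -
  ip (B t) (fun x => ph x * dq a (A t) x).

Definition kinq a t : R :=
  ip (A1 t) (fun x => ew 1 x * dq a (A t) x) + ip (A1 t) (dq (- a) (fun x => ew 1 x * A t x)) +
  (ip (B1 t) (fun x => ew 1 x * dq a (B t) x) + ip (B1 t) (dq (- a) (fun x => ew 1 x * B t x))).

(** The products [A x * A (x + a)] make the discrete product rule exact: [dq (W A) A - W A dq A]
    equals [dq W] times this product. *)
Definition fluxq a t : R := \int[mu]_x (ph x * dq a (W t) x *
  (A t x * A t (x + a) + B t x * B t (x + a))).

(** The terms pairing [ph A1] with [dq A1], and [ph B1] with [dq B1], occur twice with opposite
    signs and cancel. The terms in which the derivative falls on the weight form [kinq] after a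
    summation by parts, and those containing [W] form the flux. *)
Lemma virial_derive a t : dat (virq a) t (kinq a t - fluxq a t).
Proof.
have [cA cB] := (rs_A sol, rs_B sol).
have A2 s := let: And4 h _ _ _ := sol_L2 sol s in h.
have B2 s := let: And4 _ _ h _ := sol_L2 sol s in h.
have dA := rs_dA sol; have dB := rs_dB sol.
have q := L2R_dq a; have mw := ew_meas (ler01 : 0 <= 1 :> R).
have ewn x : `|ew 1 x| <= 1 :> R by exact: ew_norm.
have phn := @ph_norm R; have mph := @ph_meas R.
have kB := leibniz t cA (curve_mulw (ac_ph (R := R)) phn ewn (curve_dq a cB)) dA
   (wder_mulw (ac_ph (R := R)) phn ewn (fun s => q _ (B2 s)) (wder_dq a B2 dB)).
have kA := leibniz t cB (curve_mulw (ac_ph (R := R)) phn ewn (curve_dq a cA)) dB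
   (wder_mulw (ac_ph (R := R)) phn ewn (fun s => q _ (A2 s)) (wder_dq a A2 dA)).
have := datB kB kA; rewrite -/(virq a) => H; apply: dat_eq H _.
have [a2 a12 b2 b12] := sol_L2 sol t; have [WB2 WA2] := sol_WL2 sol t.
rewrite -/(W t) -/(fun x => W t x * B t x) in WB2 WA2 *.
have phL g : L2R g -> L2R (fun x => ph x * g x) by move=> hg; exact: L2R_mulb hg mph phn.
have ewL g : L2R g -> L2R (fun x => ew 1 x * g x) by move=> hg; exact: L2R_mulb hg mw ewn.
have dqN s g h : L2R g -> L2R h -> ip g (dq (- s) h) = - ip (dq s g) h.
  by move=> hg hh; rewrite ip_dqN ?opprK.
rewrite /kinq !dqN; [|by []|exact: ewL|by []|exact: ewL].
rewrite !dq_N.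
have -> : fluxq a t = \int[mu]_x
   (ph x * ((dq a (fun x => W t x * A t x) x * A t x - (W t x * A t x) * dq a (A t) x) +
   (dq a (fun x => W t x * B t x) x * B t x - (W t x * B t x) * dq a (B t) x))).
  apply: int_ext => x; rewrite /dq; ring.
have n1 : L2R (fun x => - dq a (A1 t) x) by apply: L2RN; exact: q.
have n2 : L2R (fun x => - dq a (fun x0 => W t x0 * A t x0) x) by apply: L2RN; exact: q.
have n3 : L2R (fun x => - A1 t x) by exact: L2RN.
have n4 : L2R (fun x => - (W t x * A t x)) by exact: L2RN.
have n5 : L2R (dq a (fun x => W t x * B t x)) by exact: q.
have n6 : L2R (dq a (fun x => W t x * A t x)) by exact: q.
have [q1 q2 q3 q4] := And4 (q _ a2) (q _ a12) (q _ b2) (q _ b12).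
have iph g h : L2R g -> L2R h -> igr (fun x => ph x * (g x * h x)).
  by move=> hg hh; apply: igr_w (igr_ip hg hh).
have iph2 g h g' h' : L2R g -> L2R h -> L2R g' -> L2R h' ->
   igr (fun x => g x * h x - g' x * h' x).
  by move=> *; apply: igrB; exact: igr_ip.
have iph4 : igr (fun x => ph x *
  ((dq a (fun x => W t x * A t x) x * A t x - (W t x * A t x) * dq a (A t) x) +
   (dq a (fun x => W t x * B t x) x * B t x - (W t x * B t x) * dq a (B t) x))).
  by apply: igr_w => //; apply: igrD; exact: iph2.
have [e1 e2 e3 e4] := And4 (ewL _ q1) (ewL _ a2) (ewL _ q3) (ewL _ b2).
have [p1 p2 p3 p4] := And4 (phL _ q1) (phL _ q2) (phL _ q3) (phL _ q4).
have [p5 p6 p7 p8] := And4 (phL _ n1) (phL _ n2) (phL _ n5) (ewL _ n1).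
have p9 := ewL _ q2; have p10 := ewL _ q4.
have D := L2RD.
have i1 := D _ _ _ e3 p4; have i2 := D _ _ _ p6 p8.
have i3 := D _ _ _ e1 p2; have i4 := D _ _ _ p7 p10.
have g1 := igrD (igrD (igr_ip WB2 p3) (igr_ip b12 i1)) (igrD (igr_ip i2 a2) (igr_ip p5 a12)).
have g2 := igrD (igrD (igr_ip n4 p1) (igr_ip n3 i3)) (igrD (igr_ip i4 b2) (igr_ip p4 b12)).
rewrite /ip.
rewrite -!intD; try by [exact: igr_ip|apply: igrD; exact: igr_ip].
rewrite -!intN; try by [exact: igr_ip|exact: iph4|exact: g2].
have h1 := igrD (igr_ip a12 e1) (igrN (igr_ip q2 e2)).
have h2 := igrD (igr_ip b12 e3) (igrN (igr_ip q4 e4)).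
rewrite -!intD; try by [exact: igr_ip|exact: (igrN (igr_ip _ _))].
all: try by [exact: (igrD h1 h2)|exact: (igrN iph4)|exact: h1|exact: h2|exact: g1
  |exact: (igrN g2)|exact: g2].
by apply: int_ext => x; rewrite /dq /W; ring.
Qed.

End virial.

(** * Growth of the virial and decay of the local mass *)

Section decay.
Context {R : realType}.
Local Notation mu := (@lebesgue_measure R).
Implicit Types (g h U u w X : R -> R).

Variables (m : R) (V V1 f F : R -> R) (A A1 B B1 : R -> R -> R).
Variables (th C v0 v1 v2 E : R).
Hypothesis sol : rsol m V V1 f F A A1 B B1.
Hypothesis A0 : forall t, A t 0 = 0.
Hypothesis B0 : forall t, B t 0 = 0.
Hypothesis m01 : 0 <= m <= 1.
Hypothesis hv0 : forall x, `|V x| <= v0.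
Hypothesis hv1 : forall x, `|V1 x| <= v1.
Hypothesis v20 : 0 <= v2.
Hypothesis hv2 : forall a x, a != 0 -> `|dq a V x - V1 x| <= v2 * `|a|.
Hypothesis hQ : igr (fun x => `|V1 x| * expR (2 * `|x|)).
Hypothesis hth : 0 < th <= 2.
Hypothesis C0 : 0 <= C.
Hypothesis hf : forall s, 0 <= s -> `|f s| <= C * s `^ th.
Hypothesis hF : forall s, 0 <= s -> `|F s| <= C * (s * s `^ th).
Hypothesis E1 : E <= 1.
Hypothesis CE : 8 * C * E <= 1.
Hypothesis hE : sqn (A 0) (B 0) + sqn (A1 0) (B1 0) <= E.
Hypothesis hmQ : m * (8 * \int[mu]_x (`|V1 x| * expR (2 * `|x|))) <= 2^-1.
(** The sum of the two bounds of [apriori], [E] and [2 E (1 + 2 v0 + 6 C)]; it bounds the squared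
    H^1 norm at all nonnegative times, and [rho] with it. *)
Let s := E * (3 + 4 * v0 + 12 * C).
Hypothesis hs : expR 1 * (2 * C * (4 * (th + 1) ^+ 2 / th ^+ 2 * s `^ th)) <= 2^-1.

Lemma apriori_sup t x : 0 <= t -> rho (A t) (B t) x <= s.
Proof.
move=> t0; have [h1 h2] := apriori sol m01 hv0 hth C0 hF E1 CE hE t0.
have [+ _] := rho_sup x ((rs_A sol).1 t) ((rs_B sol).1 t).
by move=> /le_trans; apply; rewrite /s; lra.
Qed.

Lemma near0_small (K : R) (e : R) : 0 <= K -> 0 < e ->
  \forall a \near (0:R)^', [/\ a != 0, `|a| <= 1 & `|a| * K <= e].
Proof.
move=> K0 e0; exists (Num.min 1 (e / (K + 1))) => /=.
  by rewrite lt_min ltr01 divr_gt0// ltr_wpDl.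
move=> a; rewrite /ball_/= sub0r normrN lt_min => /andP[a1 a2] a0; split=> //.
  exact: ltW.
have : `|a| * (K + 1) < e by rewrite -ltr_pdivlMr// ltr_wpDl.
by rewrite mulrDr mulr1; have := normr_ge0 a; lra.
Qed.

(** The smallness conditions [hmQ] and [hs] let the potential and the nonlinearity each take at most
    half of [Dq (A t) (A1 t) + Dq (B t) (B1 t)]. The remainder is proportional to the step, with a
    constant valid on the whole of [[0, T]]. *)
Lemma flux_bound T : exists2 K, 0 <= K & forall a t, 0 <= t <= T -> a != 0 -> `|a| <= 1 ->
  `|fluxq m V f A B a t| <= Dq (A t) (A1 t) + Dq (B t) (B1 t) + `|a| * K.
Proof.
have [S0 hS0] := sol_unif_bound sol T.
pose S := Num.max 0 S0.
have S_0 : 0 <= S by rewrite le_max lexx.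
have S0S : S0 <= S by rewrite le_max lexx orbT.
have v10 : 0 <= v1 by apply: le_trans (hv1 0).
have [K K0 hK] := nonlinear_flux (rs_nl sol) (andP hth).1 C0 S_0 hf hF.
exists (2 * S ^+ 2 * (v1 + 2 * v2) + K).
  by rewrite addr_ge0// !mulr_ge0 ?addr_ge0 ?sqr_ge0// mulr_ge0.
move=> a t tT a0 a1; have [t0 _] := andP tT; have [hA hB] := ((rs_A sol).1 t, (rs_B sol).1 t).
have [AS BS nA nB] := hS0 t tT.
have AS' x := le_trans (AS x) S0S; have BS' x := le_trans (BS x) S0S.
have nA' := le_trans nA S0S; have nB' := le_trans nB S0S.
have [i1 h1] := hK _ _ _ _ a _ hA hB (A0 t) (B0 t) a0 a1 AS' BS' nA' nB'
  (fun x => apriori_sup x t0).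
have [i2 h2] := potential_flux hA hB (A0 t) (B0 t) (rs_V sol) (fun x => hv2 x a0) hv1 hQ
   a1 nA' nB' v20.
have D0 : 0 <= Dq (A t) (A1 t) + Dq (B t) (B1 t) by rewrite addr_ge0 ?Dq_ge0.
have -> : fluxq m V f A B a t = m * \int[mu]_x (ph x * dq a V x *
   (A t x * A t (x + a) + B t x * B t (x + a))) +
   \int[mu]_x (ph x * dq a (fun x => f (rho (A t) (B t) x)) x *
   (A t x * A t (x + a) + B t x * B t (x + a))).
  rewrite -intZ// -intD//; last exact: igrZ.
  by apply: int_ext => x; rewrite /dq; ring.
have [m0 m1] := andP m01.
apply: le_trans (ler_normD _ _) _; rewrite normrM (ger0_norm m0).
apply: le_trans (lerD (ler_wpM2l m0 h2) h1) _.
move: D0 hmQ hs; set D := (_ + Dq _ _); set Q := \int[mu]_x _; set k1 := 2 * S ^+ 2 * _.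
set k2 := _ / _; set k3 := s `^ th; move: (expR 1) => k4 D0 q1 q2.
have r1 : m * (8 * Q) * D <= 2^-1 * D by rewrite ler_wpM2r.
have r2 : k4 * (2 * C * (k2 * k3)) * D <= 2^-1 * D by rewrite ler_wpM2r.
have r3 : m * (`|a| * k1) <= `|a| * k1.
  by rewrite ler_piMl// mulr_ge0// /k1 !mulr_ge0 ?addr_ge0 ?sqr_ge0// mulr_ge0.
have -> : m * (8 * D * Q + `|a| * k1) = m * (8 * Q) * D + m * (`|a| * k1) by ring.
have -> : k4 * (2 * C * (k2 * k3 * D)) = k4 * (2 * C * (k2 * k3)) * D by ring.
have -> : D + `|a| * (k1 + K) = (2^-1 * D + `|a| * k1) + (2^-1 * D + `|a| * K) by field.
by rewrite lerD// lerD.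
Qed.

Lemma kin_bound T e : 0 < e -> \forall a \near (0:R)^', forall t, 0 <= t <= T ->
  2 * (Dq (A t) (A1 t) + Dq (B t) (B1 t)) - e <= kinq A A1 B B1 a t.
Proof.
move=> e0; have [S0 hS0] := sol_unif_bound sol T.
pose S := Num.max 0 S0.
have S_0 : 0 <= S by rewrite le_max lexx.
have S0S : S0 <= S by rewrite le_max lexx orbT.
pose d := e / (4 * (S + 1)).
have S1 : 0 < 4 * (S + 1) by rewrite mulr_gt0// ltr_wpDl.
have d0 : 0 < d by rewrite divr_gt0.
have [cA cB] := (rs_A sol, rs_B sol).
have cw (X X1 : R -> R -> R) (cX : curve X X1) := curve_mulw (ac_ew (ler01 : 0 <= 1 :> R))
   (fun x => ew_norm x ler01) (fun x => ew1_bound x ler01) cX.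
near=> a.
have h1' : forall t, 0 <= t <= T -> nrm (fun x => dq a (A t) x - A1 t x) < d.
  by near: a; exact: dq_unif.
have h2' : forall t, 0 <= t <= T -> nrm (fun x => dq a (B t) x - B1 t x) < d.
  by near: a; exact: dq_unif.
have h3' : forall t, 0 <= t <= T -> nrm (fun x => dq (- a) (fun x => ew 1 x * A t x) x -
       ((- 1 * ew 1 x * sg x) * A t x + ew 1 x * A1 t x)) < d.
  by near: a; exact: near0_opp (dq_unif 0 T (cw _ _ cA) d0).
have h4' : forall t, 0 <= t <= T -> nrm (fun x => dq (- a) (fun x => ew 1 x * B t x) x -
       ((- 1 * ew 1 x * sg x) * B t x + ew 1 x * B1 t x)) < d.
  by near: a; exact: near0_opp (dq_unif 0 T (cw _ _ cB) d0).
move=> t tT; have [_ _ nA nB] := hS0 t tT.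
have [h1 h2 h3 h4] := And4 (h1' t tT) (h2' t tT) (h3' t tT) (h4' t tT).
have nS X X1 : nrm X + nrm X1 <= S0 -> @nrm R X1 <= S.
  by move=> h; apply: le_trans S0S; apply: le_trans h; rewrite lerDr nrm_ge0.
have kA := kin_limit a (cA.1 t) (A0 t); have kB := kin_limit a (cB.1 t) (B0 t).
have bA : nrm (A1 t) * (nrm (fun x => dq a (A t) x - A1 t x) +
   nrm (fun x => dq (- a) (fun x => ew 1 x * A t x) x -
       ((- 1 * ew 1 x * sg x) * A t x + ew 1 x * A1 t x))) <= S * (d + d).
  apply: ler_pM; rewrite ?nrm_ge0// ?addr_ge0 ?nrm_ge0//; first exact: nS nA.
  by rewrite lerD// ltW.
have bB : nrm (B1 t) * (nrm (fun x => dq a (B t) x - B1 t x) +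
   nrm (fun x => dq (- a) (fun x => ew 1 x * B t x) x -
       ((- 1 * ew 1 x * sg x) * B t x + ew 1 x * B1 t x))) <= S * (d + d).
  apply: ler_pM; rewrite ?nrm_ge0// ?addr_ge0 ?nrm_ge0//; first exact: nS nB.
  by rewrite lerD// ltW.
have : S * (d + d) <= e / 2.
  have -> : e / 2 = (S + 1) * (d + d) by rewrite /d; field; rewrite lt0r_neq0// ltr_wpDl.
  by rewrite ler_wpM2r ?addr_ge0 ?(ltW d0)// lerDl.
move: (le_trans kA bA) (le_trans kB bB); rewrite /kinq !ler_norml => /andP[l1 _] /andP[l2 _].
move: (S * _) (Dq _ _) (Dq _ _) (ip _ _ + ip _ _) (ip _ _ + ip _ _) l1 l2.
by move=> k x1 x2 x3 x4 l1 l2 hk; lra.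
Unshelve. all: by end_near. Qed.

Definition locmass t : R := ip (A t) (fun x => ew 2 x * A t x) +
  ip (B t) (fun x => ew 2 x * B t x).

Lemma locmass_Dq t : locmass t <= 4 * (Dq (A t) (A1 t) + Dq (B t) (B1 t)).
Proof.
have := weight2_le ((rs_A sol).1 t) (A0 t); have := weight2_le ((rs_B sol).1 t) (B0 t).
have e X : ip X (fun x => ew 2 x * X x) = \int[mu]_x (ew 2 x * X x ^+ 2).
  by apply: int_ext => x; ring.
rewrite /locmass !e; lra.
Qed.

Definition virial t : R := ip (A t) (fun x => ph x * B1 t x) -
  ip (B t) (fun x => ph x * A1 t x).

Lemma virq_cvg t e : 0 < e -> \forall a \near (0:R)^', `|virq A B a t - virial t| <= e.
Proof.
move=> e0; have [cA cB] := (rs_A sol, rs_B sol).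
have [a2 a12 b2 b12] := sol_L2 sol t.
pose S := nrm (A t) + nrm (B t) + 1.
have S0 : 0 < S by rewrite ltr_wpDl// addr_ge0 ?nrm_ge0.
have d0 : 0 < e / S by rewrite divr_gt0.
near=> a.
have h1 : nrm (fun x => dq a (A t) x - A1 t x) < e / S.
  by near: a; apply: filterS (dq_unif t t cA d0) => a; apply; rewrite lexx.
have h2 : nrm (fun x => dq a (B t) x - B1 t x) < e / S.
  by near: a; apply: filterS (dq_unif t t cB d0) => a; apply; rewrite lexx.
have qa := L2R_dq a a2; have qb := L2R_dq a b2.
have phL g : L2R g -> L2R (fun x => ph x * g x).
  by move=> hg; exact: L2R_mulb hg (@ph_meas R) (@ph_norm R).
have e1 : ip (A t) (fun x => ph x * dq a (B t) x) - ip (A t) (fun x => ph x * B1 t x) =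
  ip (A t) (fun x => ph x * (dq a (B t) x - B1 t x)).
  by rewrite -ipBr ?phL//; [apply: int_ext => x; ring|exact: phL..].
have e2 : ip (B t) (fun x => ph x * dq a (A t) x) - ip (B t) (fun x => ph x * A1 t x) =
  ip (B t) (fun x => ph x * (dq a (A t) x - A1 t x)).
  by rewrite -ipBr ?phL//; [apply: int_ext => x; ring|exact: phL..].
have -> : virq A B a t - virial t =
  ip (A t) (fun x => ph x * (dq a (B t) x - B1 t x)) -
  ip (B t) (fun x => ph x * (dq a (A t) x - A1 t x)).
  by rewrite -e1 -e2 /virq /virial; ring.
have b X Y : L2R X -> L2R Y -> nrm Y < e / S ->
    `|ip X (fun x => ph x * Y x)| <= nrm X * (e / S).
  move=> hX hY nY; apply: le_trans (CS hX (phL _ hY)) _.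
  rewrite ler_wpM2l ?nrm_ge0//; apply: le_trans (ltW nY).
  by rewrite -[leRHS]mul1r; exact: nrm_mulb hY (@ph_meas R) (@ph_norm R).
apply: le_trans (ler_normB _ _) _.
apply: le_trans (lerD (b _ _ a2 (L2RB qb b12) h2) (b _ _ b2 (L2RB qa a12) h1)) _.
rewrite -mulrDl mulrCA ger_pMr// ler_pdivrMr// mul1r /S; lra.
Unshelve. all: by end_near. Qed.

(* The virial dominates the increments of every function whose derivative is at
   most [locmass / 4]. *)
Lemma virial_growth (G G1 : R -> R) t1 t2 : 0 <= t1 <= t2 ->
  (forall t, t1 <= t <= t2 -> dat G t (G1 t)) ->
  (forall t, t1 <= t <= t2 -> G1 t <= locmass t / 4) ->
  G t2 - G t1 <= virial t2 - virial t1.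
Proof.
move=> /andP[t10 t12] hG hG1; apply/ler_addgt0Pr => e e0.
have [K K0 hK] := flux_bound t2.
have T0 : 0 < t2 + 1 by rewrite ltr_wpDl// (le_trans t10).
pose d := e / (4 * (t2 + 1)).
have d0 : 0 < d by rewrite divr_gt0// mulr_gt0.
have dT : 2 * d * (t2 - t1) <= e / 2.
  have -> : e / 2 = 2 * d * (t2 + 1) by rewrite /d; field; rewrite lt0r_neq0.
  by apply: ler_wpM2l; [rewrite mulr_ge0// ltW|lra].
have e4 : 0 < e / 4 by rewrite divr_gt0.
near (0:R)^' => a.
have k : forall t, 0 <= t <= t2 ->
   2 * (Dq (A t) (A1 t) + Dq (B t) (B1 t)) - d <= kinq A A1 B B1 a t.
  by near: a; exact: kin_bound.
have [a0 a1 aK] : [/\ a != 0, `|a| <= 1 & `|a| * K <= d].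
  by near: a; exact: near0_small.
have c1 : `|virq A B a t1 - virial t1| <= e / 4 by near: a; exact: virq_cvg.
have c2 : `|virq A B a t2 - virial t2| <= e / 4 by near: a; exact: virq_cvg.
(* With D the sum of the two [Dq], the kinetic part gives [2 D - d] and the flux takes at most
   [D + d]. The D that is left pays for [locmass / 4] by [locmass_Dq]. *)
have : - (2 * d) * (t2 - t1) <= (virq A B a t2 - G t2) - (virq A B a t1 - G t1).
  apply: (dat_mvt t12 (F := fun t => virq A B a t - G t)
    (l := fun t => (kinq A A1 B B1 a t - fluxq m V f A B a t) - G1 t)).
    by move=> t tT; apply: datB; [exact: virial_derive sol a t|exact: hG].
  move=> t /andP[tt1 tt2].
  have tT : 0 <= t <= t2 by rewrite (le_trans t10 tt1).
  have tT' : t1 <= t <= t2 by rewrite tt1.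
  move: (k t tT) (hG1 t tT') (locmass_Dq t) (hK a t tT a0 a1).
  move: (locmass t) (Dq _ _ + _) (kinq _ _ _ _ _ _) => y D k1 q1 q2 q3.
  rewrite ler_norml => /andP[_ q4].
  lra.
move: c1 c2; rewrite !ler_norml => /andP[p1 p2] /andP[p3 p4].
move: (virq _ _ _ _) (virq _ _ _ _) p1 p2 p3 p4 => z1 z2 p1 p2 p3 p4 p5.
rewrite mulNr in p5; lra.
Unshelve. all: by end_near. Qed.


Lemma nrm_cross t : 0 <= t ->
  2 * (nrm (A t) * nrm (B1 t) + nrm (B t) * nrm (A1 t)) <= s.
Proof.
move=> t0; have [h1 h2] := apriori sol m01 hv0 hth C0 hF E1 CE hE t0.
have h3 : sqn (A t) (B t) + sqn (A1 t) (B1 t) <= s by rewrite /s; lra.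
apply: le_trans h3; rewrite /sqn -!nrm_sq.
have := sqr_ge0 (nrm (A t) - nrm (B1 t)); have := sqr_ge0 (nrm (B t) - nrm (A1 t)).
rewrite !sqrrB; lra.
Qed.

Lemma s_ge0 : 0 <= s.
Proof. exact: le_trans (rho_ge0 _ _ 0) (apriori_sup 0 (lexx 0)). Qed.

Lemma virial_bound t : 0 <= t -> `|virial t| <= s.
Proof.
move=> t0; have := nrm_cross t0; have [a2 a12 b2 b12] := sol_L2 sol t.
have b X Y : L2R X -> L2R Y -> `|ip X (fun x => ph x * Y x)| <= nrm X * nrm Y.
  move=> hX hY.
  apply: le_trans (CS hX (L2R_mulb hY (@ph_meas R) (@ph_norm R))) _.
  rewrite ler_wpM2l ?nrm_ge0// -[leRHS]mul1r; exact: nrm_mulb hY (@ph_meas R) (@ph_norm R).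
have := ler_normB (ip (A t) (fun x => ph x * B1 t x)) (ip (B t) (fun x => ph x * A1 t x)).
rewrite -/(virial t); have := b _ _ a2 b12; have := b _ _ b2 a12; have := s_ge0.
move: (nrm _ * nrm _) (nrm _ * nrm _) => *; lra.
Qed.

Lemma locmass_ge0 t : 0 <= locmass t.
Proof. by rewrite addr_ge0// int_ge0// => x; rewrite mulrCA mulr_ge0 ?ew_ge0// -expr2 sqr_ge0. Qed.

Lemma locmass_derive : exists2 y1 : R -> R, (forall t, dat locmass t (y1 t)) &
  forall t, 0 <= t -> `|y1 t| <= 4 * s.
Proof.
pose w1 (x : R) := - 2 * ew 2 x * sg x.
have hw := ac_ew (ler0n R 2); have w_1 := fun x => ew_norm x (ler0n R 2).
have w1_2 := fun x => ew1_bound x (ler0n R 2).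
have mw1 : measurable_fun setT w1 := hw.1.1.
exists (fun t => 2 * (ip (B1 t) (fun x => w1 x * A t x) - ip (A1 t) (fun x => w1 x * B t x))).
  by move=> t; exact: (weight_derive sol t hw w_1 w1_2).
move=> t t0; have := nrm_cross t0; have [a2 a12 b2 b12] := sol_L2 sol t.
have b X Y : L2R X -> L2R Y -> `|ip X (fun x => w1 x * Y x)| <= 2 * (nrm Y * nrm X).
  move=> hX hY; apply: le_trans (CS hX (L2R_mulb hY mw1 w1_2)) _.
  by rewrite mulrC mulrA ler_wpM2r ?nrm_ge0// nrm_mulb.
rewrite normrM (ger0_norm (ler0n R 2)).
have := ler_normB (ip (B1 t) (fun x => w1 x * A t x)) (ip (A1 t) (fun x => w1 x * B t x)).
have := b _ _ b12 a2; have := b _ _ a12 b2.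
move: (nrm _ * nrm _) (nrm _ * nrm _) `|_ - _| `|_| `|_| s_ge0 => *; lra.
Qed.

(** With y the local mass, [y' <= 4 s + 1] bounds [2 y y'] by [32 s + 8] times [y / 4], which is the
    rate that [virial_growth] permits. The added 1, hence the 8, keeps the divisor positive. *)
Lemma locmass_sq_le t1 t2 : 0 <= t1 <= t2 ->
  locmass t2 ^+ 2 - locmass t1 ^+ 2 <= (32 * s + 8) * (virial t2 - virial t1).
Proof.
move=> t12; have [y1 hy hb] := locmass_derive; have s0 := s_ge0.
have K0 : 0 < 32 * s + 8 by lra.
rewrite mulrC -ler_pdivrMr// mulrBl.
apply: (@virial_growth (fun t => locmass t ^+ 2 / (32 * s + 8))
   (fun t => (32 * s + 8)^-1 * (2 * (locmass t * y1 t)))) => // t /andP[tt1 tt2].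
  have := datZ (32 * s + 8)^-1 (is_deriveM (hy t) (hy t)) => H.
  apply: dat_eq; first by apply: dat_ext H => x /=; rewrite -expr2 mulrC.
  by rewrite /GRing.scale/=; ring.
have t0 : 0 <= t by case/andP: t12 => t10 _; exact: le_trans t10 tt1.
have := hb t t0; rewrite ler_norml => /andP[_ yb].
rewrite ler_pdivrMl//; have h : y1 t <= 4 * s + 1 by lra.
by have := ler_wpM2l (locmass_ge0 t) h; lra.
Qed.

Lemma virial_nd t1 t2 : 0 <= t1 <= t2 -> virial t1 <= virial t2.
Proof.
move=> h; have := @virial_growth (fun=> 0) (fun=> 0) t1 t2 h.
rewrite subrr subr_ge0; apply=> [t _|t _]; first exact: is_derive_cst.
by rewrite divr_ge0 ?locmass_ge0.
Qed.

(** The virial is nondecreasing and bounded, so after [t1] it stays within [e^2 / (4 K)] of its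
    supremum, and the square of the local mass can then increase by at most [e^2 / 4]. It remains to
    find a later time at which the local mass is at most [e / 2]; otherwise the virial would grow
    linearly. *)
Lemma locmass_decay e : 0 < e -> exists T, forall t, T <= t -> locmass t < e.
Proof.
move=> e0; have s0 := s_ge0; pose K := 32 * s + 8.
have K0 : 0 < K by rewrite /K; lra.
pose M := [set virial t | t in [set t | 0 <= t]].
have bM : has_sup M.
  split; first by exists (virial 0); exists 0 => //=.
  by exists s => _ [t /= t0 <-]; apply: le_trans (ler_norm _) _; exact: virial_bound.
have d0 : 0 < e ^+ 2 / (4 * K) by rewrite divr_gt0 ?mulr_gt0// exprn_gt0.
have [_ [t1 /= t10 <-] ht1] := sup_adherent d0 bM.
have ub t : 0 <= t -> virial t <= sup M by move=> t0; apply: sup_upper_bound => //; exists t.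
have [t3 t13 ht3] : exists2 t3, t1 <= t3 & locmass t3 <= e / 2.
  (* At rate [e / 8] the virial would gain [2 s + 1] over this length of time, while its values lie
     in [[- s, s]]. *)
  apply: contrapT => H; pose t2 := t1 + 8 * (2 * s + 1) / e.
  have t12 : t1 <= t2 by rewrite lerDl divr_ge0 ?(ltW e0)//; lra.
  have := @virial_growth (fun t => e / 8 * t) (fun=> e / 8) t1 t2.
  rewrite t10 t12 => /(_ isT) G.
  have : e / 8 * t2 - e / 8 * t1 <= virial t2 - virial t1.
    apply: G => [t _|t /andP[tt _]].
      by apply: dat_eq (datZ (e / 8) (is_derive_id t 1)) _; rewrite mulr1.
    have [|] := leP (locmass t) (e / 2); last by lra.
    by move=> ht; case: H; exists t.
  have t20 := le_trans t10 t12.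
  have := virial_bound t10; have := virial_bound t20.
  rewrite !ler_norml => /andP[_ l1] /andP[l2 _].
  have -> : e / 8 * t2 - e / 8 * t1 = 2 * s + 1 by rewrite /t2; field; rewrite gt_eqF.
  by move=> l3; lra.
exists t3 => t t3t.
have t30 := le_trans t10 t13; have t0 := le_trans t30 t3t.
have q1 : 0 <= t3 <= t by rewrite t30.
have q2 : 0 <= t1 <= t3 by rewrite t10.
have h1 := locmass_sq_le q1; have h2 := virial_nd q2; have h3 := ub t t0.
have h4 : locmass t3 ^+ 2 <= (e / 2) ^+ 2.
  by rewrite ler_sqr ?nnegrE ?locmass_ge0// divr_ge0// ltW.
rewrite -ltr_sqr ?nnegrE ?locmass_ge0 ?(ltW e0)//.
have h5 : K * (virial t - virial t3) <= K * (e ^+ 2 / (4 * K)).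
  by rewrite ler_wpM2l ?(ltW K0)//; lra.
have h6 : K * (e ^+ 2 / (4 * K)) = e ^+ 2 / 4 by field; rewrite gt_eqF.
have e2 : 0 < e ^+ 2 by rewrite exprn_gt0.
rewrite -/K in h1; have h7 : (e / 2) ^+ 2 = e ^+ 2 / 4 by field.
have h8 := le_trans h1 h5; rewrite h6 in h8; rewrite h7 in h4; lra.
Qed.

End decay.

(** * The primitive of the nonlinearity *)

Section make_nonlin.
Context {R : realType}.
Local Notation mu := (@lebesgue_measure R).

(** The hypothesis gives a Lipschitz bound near each pair of points, not only near the diagonal, so
    the compact set to be covered is the square of the segment. *)
Lemma locally_lipschitz_segment (g : R -> R) (S : R) : locally_lipschitz g ->
  exists2 L, 0 <= L & forall x y, `|x| <= S -> `|y| <= S -> `|g x - g y| <= L * `|x - y|.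
Proof.
move=> hg; pose K := (`[- S, S] `*` `[- S, S] : set (R * R))%classic.
have cK : compact K by apply: compact_setX; exact: segment_compact.
pose P (M : R) (z : R * R) := `|g z.1 - g z.2| <= M * `|z.1 - z.2|.
have [+ _] := compact_near_coveringP K.
move=> /(_ cK _ (pinfty_nbhs R) P _) [].
  move=> z _; have := hg z (conj I I).
  move=> [M1 [_ hM]]; pose M0 := Num.max 0 M1 + 1.
  have M00 : 0 <= M0 by rewrite addr_ge0// le_max lexx.
  have := hM M0; rewrite /M0 -/M0 ltr_pwDr// ?le_max ?lexx ?orbT// => /(_ isT) [].
  move=> e /= e0 he; exists (e.1 `*` e.2, [set M | M0 < M]) => /=.
    by split; [exists e|exists M0; split=> //; exact: num_real].
  move=> [y M] [/= yz M0M]; have := he y yz (conj I I); rewrite /self_sub/= /P => /le_trans; apply.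
  by rewrite ler_wpM2r// ltW.
move=> M0 [_ hM]; exists (Num.max 0 (M0 + 1)); first by rewrite le_max lexx.
move=> x y xS yS; have := hM (Num.max 0 (M0 + 1)); rewrite lt_max ltrDl ltr01 orbT.
by move=> /(_ isT (x, y)); apply; split; rewrite /= in_itv/= -ler_norml.
Qed.

(** Since [f] is regular only as a function of the modulus, Lipschitz bounds are transferred to the
    real and imaginary parts through this inequality, the triangle inequality in the plane. *)
Lemma sqrt_lip (a b c d : R) :
  `|Num.sqrt (c ^+ 2 + d ^+ 2) - Num.sqrt (a ^+ 2 + b ^+ 2)| <= `|c - a| + `|d - b|.
Proof.
have key : forall a b c d : R, Num.sqrt (c ^+ 2 + d ^+ 2) - Num.sqrt (a ^+ 2 + b ^+ 2) <=
   `|c - a| + `|d - b|.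
  clear; move=> a b c d; rewrite lerBlDr.
  set r := Num.sqrt (a ^+ 2 + b ^+ 2); set k := _ + `|d - b|.
  have r0 : 0 <= r by exact: sqrtr_ge0.
  have k0 : 0 <= k by rewrite addr_ge0.
  rewrite -(ger0_norm (addr_ge0 k0 r0)) -sqrtr_sqr ler_wsqrtr//.
  have r2 : r ^+ 2 = a ^+ 2 + b ^+ 2 by rewrite sqr_sqrtr// addr_ge0 ?sqr_ge0.
  have ra : `|a| <= r by rewrite -sqrtr_sqr ler_wsqrtr// lerDl sqr_ge0.
  have rb : `|b| <= r by rewrite -sqrtr_sqr ler_wsqrtr// lerDr sqr_ge0.
  have h1 : a * (c - a) <= r * `|c - a|.
    by apply: le_trans (ler_norm _) _; rewrite normrM ler_wpM2r.
  have h2 : b * (d - b) <= r * `|d - b|.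
    by apply: le_trans (ler_norm _) _; rewrite normrM ler_wpM2r.
  have h3 : (c - a) ^+ 2 + (d - b) ^+ 2 <= k ^+ 2.
    rewrite -!(real_normK (num_real (_ - _))) /k sqrrD.
    have := mulr_ge0 (normr_ge0 (c - a)) (normr_ge0 (d - b)); lra.
  rewrite sqrrD r2.
  have -> : c ^+ 2 + d ^+ 2 = (c - a) ^+ 2 + (d - b) ^+ 2 + 2 * (a * (c - a) + b * (d - b))
     + (a ^+ 2 + b ^+ 2) by ring.
  have -> : k * r *+ 2 = 2 * (r * `|c - a| + r * `|d - b|) by rewrite /k; ring.
  by rewrite lerD2r lerD// ler_wpM2l// lerD.
rewrite ler_norml key andbT lerNl opprB; apply: le_trans (key c d a b) _.
by rewrite distrC [`|b - d|]distrC.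
Qed.

Variables (f : R -> R) (C th : R).
Hypothesis th0 : 0 < th.
Hypothesis hf : forall s : R, 0 <= s -> `|f s| <= C * s `^ th.
Hypothesis hlip : locally_lipschitz (fun s => f (s ^+ 2)).

(* Agrees with [f] on [0, +oo[, where alone [f] is known to be regular. *)
Definition nlpos (s : R) : R := f (Num.sqrt s ^+ 2).
Definition nlprim : R -> R := prim nlpos.

Lemma nlposE s : 0 <= s -> nlpos s = f s.
Proof. by move=> s0; rewrite /nlpos sqr_sqrtr. Qed.

Lemma sqrt_plane_le (S a b : R) : `|a| <= S -> `|b| <= S ->
  `|Num.sqrt (a ^+ 2 + b ^+ 2)| <= 2 * S.
Proof.
move=> ha hb; have := sqrt_lip 0 0 a b.
by rewrite expr0n/= addr0 sqrtr0 !subr0 => /le_trans; apply; lra.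
Qed.

Lemma nlpos_cont : continuous nlpos.
Proof.
move=> s; apply: (@continuous_comp _ _ _ Num.sqrt (fun p => f (p ^+ 2))).
  exact: sqrt_continuous.
set p := Num.sqrt s; have [L L0 hL] := locally_lipschitz_segment (`|p| + 1) hlip.
apply/cvgrPdist_le => e e0; exists (Num.min 1 (e / (L + 1))) => /=.
  by rewrite lt_min ltr01 divr_gt0// ltr_wpDl.
move=> q; rewrite /ball_/= lt_min => /andP[pq pq2].
have hp : `|p| <= `|p| + 1 by rewrite lerDl.
have hq : `|q| <= `|p| + 1.
  have -> : q = p - (p - q) by ring.
  by apply: le_trans (ler_normB _ _) _; rewrite lerD2l ltW.
apply: le_trans (hL p q hp hq) _.
apply: (@le_trans _ _ ((L + 1) * `|p - q|)); first by rewrite ler_wpM2r// lerDl.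
by rewrite mulrC -ler_pdivlMr ?(ltW pq2)// ltr_wpDl.
Qed.

Lemma nlpos_meas : measurable_fun setT nlpos.
Proof. exact: continuous_measurable_fun nlpos_cont. Qed.

Lemma nlC_ge0 : 0 <= C.
Proof. by have := hf ler01; rewrite powR1 mulr1; apply: le_trans. Qed.

Lemma nlpos_lig : lig nlpos.
Proof.
split; first exact: nlpos_meas.
move=> a b; apply: continuous_compact_integrable; first exact: segment_compact.
by apply: continuous_subspaceT => x; exact: nlpos_cont.
Qed.

Lemma nlprim_ac : ac nlprim nlpos.
Proof. exact: ac_prim nlpos_lig. Qed.

Lemma nlprim_bound s : 0 <= s -> `|nlprim s| <= C * (s * s `^ th).
Proof.
move=> s0; rewrite /nlprim /prim s0; apply: le_trans (itg_norm _ _ nlpos_lig) _.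
have -> : C * (s * s `^ th) = itg 0 s (fun=> C * s `^ th).
  by rewrite itg_cst// subr0; ring.
apply: itg_le; [exact: lig_norm nlpos_lig|exact: lig_cst|].
move=> x /andP[x0 xs]; rewrite nlposE//; apply: le_trans (hf x0) _.
by rewrite ler_wpM2l ?nlC_ge0// ge0_ler_powR ?nnegrE// ltW.
Qed.

(** For the Taylor bound, let p and q be the two moduli. The remainder is the integral of
    [f(t) - f(p^2)] over t between p^2 and q^2; the integrand is at most [L |q - p|], and the length
    is [|q - p| (q + p)], so the bound is quadratic in [q - p] although [f] is not
    differentiable. *)
Lemma nonlin_nlprim : nonlin f nlprim.
Proof.
have sq0 (a b : R) : 0 <= a ^+ 2 + b ^+ 2 by rewrite addr_ge0 ?sqr_ge0.
have fE (a b : R) : f (a ^+ 2 + b ^+ 2) = f (Num.sqrt (a ^+ 2 + b ^+ 2) ^+ 2).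
  by rewrite sqr_sqrtr.
split.
- by rewrite /nlprim /prim lexx itg_refl.
- move=> S; have [L L0 hL] := locally_lipschitz_segment (2 * S) hlip.
  exists L => // a b c d ha hb hc hd; rewrite !fE.
  apply: le_trans (hL _ _ (sqrt_plane_le hc hd) (sqrt_plane_le ha hb)) _.
  by rewrite ler_wpM2l// sqrt_lip.
- move=> S; have [L L0 hL] := locally_lipschitz_segment (2 * S) hlip.
  exists (8 * `|S| * L); first by rewrite !mulr_ge0.
  move=> a b c d ha hb hc hd.
  set p := Num.sqrt (a ^+ 2 + b ^+ 2); set q := Num.sqrt (c ^+ 2 + d ^+ 2).
  have p2 : p ^+ 2 = a ^+ 2 + b ^+ 2 by exact: sqr_sqrtr.
  have q2 : q ^+ 2 = c ^+ 2 + d ^+ 2 by exact: sqr_sqrtr.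
  have p0 : 0 <= p by exact: sqrtr_ge0.
  have q0 : 0 <= q by exact: sqrtr_ge0.
  rewrite -p2 -q2.
  have pS : p <= 2 * S by apply: le_trans (ler_norm _) (sqrt_plane_le ha hb).
  have qS : q <= 2 * S by apply: le_trans (ler_norm _) (sqrt_plane_le hc hd).
  have inc x y z : 0 <= x -> 0 <= y -> 0 <= z -> x <= 2 * S -> y <= 2 * S -> z <= 2 * S ->
     x <= y -> z = x \/ z = y ->
     `|nlprim (y ^+ 2) - nlprim (x ^+ 2) - f (z ^+ 2) * (y ^+ 2 - x ^+ 2)| <=
       4 * `|S| * L * (y - x) ^+ 2.
    move=> x0 y0 z0 xS yS zS xy zxy.
    have xy2 : x ^+ 2 <= y ^+ 2 by rewrite ler_sqr.
    rewrite (nlprim_ac.2 _ _ xy2) -itg_cst// -itgB; [|exact: nlpos_lig|exact: lig_cst].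
    have lB := ligD nlpos_lig (lig_cst (- f (z ^+ 2))).
    apply: le_trans (itg_norm _ _ lB) _.
    apply: (@le_trans _ _ (itg (x ^+ 2) (y ^+ 2) (fun=> L * (y - x)))).
      apply: itg_le; [exact: lig_norm|exact: lig_cst|].
      move=> t /andP[t1 t2]; have t0 : 0 <= t by apply: le_trans t1; exact: sqr_ge0.
      have xt : x <= Num.sqrt t by rewrite -(ger0_norm x0) -sqrtr_sqr ler_wsqrtr.
      have ty : Num.sqrt t <= y by rewrite -(ger0_norm y0) -sqrtr_sqr ler_wsqrtr.
      rewrite /nlpos; apply: le_trans (hL (Num.sqrt t) z _ _) _.
      + by rewrite ger0_norm ?sqrtr_ge0// (le_trans ty).
      + by rewrite ger0_norm.
      + rewrite ler_wpM2l// ler_norml.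
        by case: zxy => ->; apply/andP; split; lra.
    rewrite itg_cst//.
    have -> : L * (y - x) * (y ^+ 2 - x ^+ 2) = (y + x) * (L * (y - x) ^+ 2) by ring.
    have -> : 4 * `|S| * L * (y - x) ^+ 2 = (4 * `|S|) * (L * (y - x) ^+ 2) by ring.
    rewrite ler_wpM2r ?mulr_ge0 ?sqr_ge0//; have := ler_norm S; lra.
  have main : `|nlprim (q ^+ 2) - nlprim (p ^+ 2) - f (p ^+ 2) * (q ^+ 2 - p ^+ 2)| <=
     4 * `|S| * L * (q - p) ^+ 2.
    have [pq|/ltW qp] := leP p q; first by apply: inc => //; left.
    have -> : (q - p) ^+ 2 = (p - q) ^+ 2 by ring.
    rewrite -normrN.
    have -> : - (nlprim (q ^+ 2) - nlprim (p ^+ 2) - f (p ^+ 2) * (q ^+ 2 - p ^+ 2)) =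
      nlprim (p ^+ 2) - nlprim (q ^+ 2) - f (p ^+ 2) * (p ^+ 2 - q ^+ 2) by ring.
    by apply: inc => //; right.
  apply: le_trans main _.
  have -> : 8 * `|S| * L * ((c - a) ^+ 2 + (d - b) ^+ 2) =
    4 * `|S| * L * (2 * ((c - a) ^+ 2 + (d - b) ^+ 2)) by ring.
  rewrite ler_wpM2l ?mulr_ge0//.
  have h : `|q - p| <= `|c - a| + `|d - b| by exact: sqrt_lip.
  apply: (@le_trans _ _ ((`|c - a| + `|d - b|) ^+ 2)).
    by rewrite -(real_normK (num_real (q - p))) ler_sqr ?nnegrE ?addr_ge0.
  rewrite -!(real_normK (num_real (_ - _))) sqrrD.
  have := sqr_ge0 (`|c - a| - `|d - b|); rewrite sqrrB; lra.
- move=> U u mU mu'.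
  have -> : (fun x => f (U x ^+ 2 + u x ^+ 2)) = (fun x => nlpos (U x ^+ 2 + u x ^+ 2)).
    by apply/funext => x; rewrite nlposE.
  apply: measurableT_comp; first exact: nlpos_meas.
  by apply: measurable_funD; exact: measurable_funX.
- move=> U u mU mu'; apply: measurableT_comp; first exact: ac_meas nlprim_ac.
  by apply: measurable_funD; exact: measurable_funX.
Qed.

End make_nonlin.

(** * Test functions and weak derivatives *)

Section smooth_functions.
Context {R : realType}.
Local Notation mu := (@lebesgue_measure R).
Implicit Types (g h U u w : R -> R).

Lemma datM (F G : R -> R) x l k : dat F x l -> dat G x k ->
  dat (fun x => F x * G x) x (l * G x + F x * k).
Proof.
move=> hF hG; have := is_deriveM hF hG => H; apply: dat_eq H _.
by rewrite /GRing.scale/=; ring.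
Qed.

Lemma dat_affine (F : R -> R) a b x l : dat F (a * x + b) l ->
  dat (fun x => F (a * x + b)) x (a * l).
Proof.
move=> hF; have h : is_derive x 1 (fun x : R => a * x + b) a.
  apply: dat_eq (datD (datZ a (is_derive_id x 1)) (is_derive_cst b x 1)) _.
  by rewrite mulr1 addr0.
have := @is_derive1_comp _ F (fun x => a * x + b) x _ _ hF h.
by rewrite mulrC.
Qed.

Lemma derive1_dat (g g' : R -> R) : (forall x, dat g x (g' x)) -> (g^`())%classic = g'.
Proof.
by move=> h; apply/funext => x; rewrite derive1E; exact: (@derive_val _ _ _ _ _ _ _ (h x)).
Qed.

(** Membership in a class closed under differentiation replaces explicit formulas for iterated
    derivatives. *)
Lemma smooth_class (S : (R -> R) -> Prop) :
  (forall g, S g -> exists2 g', S g' & forall x, dat g x (g' x)) ->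
  forall g, S g -> smooth g.
Proof.
move=> H g Sg n.
suff Sn : S (g^`(n))%classic by have [g' _ h] := H _ Sn => x; exact: @ex_derive _ _ _ _ _ _ _ (h x).
elim: n => [//|n IH]; rewrite derive1nS; have [g' Sg' h] := H _ IH.
by rewrite (derive1_dat h).
Qed.

(** For [k = 0] this is the classical flat function e^{-1/x}; the powers of 1/x are included because
    its derivatives generate them. *)
Definition eta k (x : R) : R := if 0 < x then x^-1 ^+ k * expR (- x^-1) else 0.

(** The inequality [1 + x <= expR x] is taken at [x = s / (k + 1)] and raised to the power [k]. With
    [s = h^-1], it shows that every [eta k] is flat at the origin. *)
Lemma pow_exp_bound k (s : R) : 0 <= s -> s ^+ k <= (k.+1)%:R ^+ k * expR s.
Proof.
move=> s0; have k0 : 0 < (k.+1)%:R :> R by [].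
apply: (@le_trans _ _ (((k.+1)%:R * expR (s / (k.+1)%:R)) ^+ k)).
  rewrite lerXn2r ?nnegrE ?mulr_ge0 ?expR_ge0//.
  apply: (@le_trans _ _ ((k.+1)%:R * (1 + s / (k.+1)%:R))).
    by rewrite mulrDr mulr1 mulrCA divff ?lt0r_neq0// mulr1 lerDr.
  by rewrite ler_wpM2l// expR_ge1Dx// divr_ge0.
rewrite exprMn ler_wpM2l ?exprn_ge0// -expRM_natl ler_expR.
by rewrite mulrCA ler_piMr// ler_pdivrMr// mul1r ler_nat.
Qed.

Lemma eta_derive k x : dat (eta k) x (eta k.+2 x - k%:R * eta k.+1 x).
Proof.
have [x0|x0|->] := ltgtP x 0.
- have -> : eta k.+2 x - k%:R * eta k.+1 x = 0.
    by rewrite /eta ltNge (ltW x0)/= mulr0 subrr.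
  have h0 : is_derive x 1 (fun=> 0 : R) 0 by exact: is_derive_cst.
  apply: (near_eq_is_derive _ h0).
  near=> y; rewrite /eta ltNge; have -> //: y <= 0.
  by apply: ltW; near: y; exact: lt_nbhsl.
- have i : is_derive x 1 (fun y : R => y^-1) (- x^-1 ^+ 2).
    have := is_deriveV (lt0r_neq0 x0) (is_derive_id x 1) => H; apply: dat_eq H _.
    by rewrite /GRing.scale/= mulr1 exprVn.
  have e : is_derive x 1 (fun y : R => expR (- y^-1)) (x^-1 ^+ 2 * expR (- x^-1)).
    have := @is_derive1_comp _ expR (fun y => - y^-1) x _ _ (is_derive_expR _) (is_deriveN i).
    by rewrite opprK mulrC.
  have p : is_derive x 1 (fun y : R => y^-1 ^+ k) (- (k%:R * x^-1 ^+ k.+1)).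
    elim: k => [|k IH].
      rewrite mul0r oppr0; exact: (is_derive_cst (1 : R) x 1).
    have H : dat (fun y => y^-1 * y^-1 ^+ k) x _ := datM i IH.
    by apply: dat_eq (dat_ext _ H) _ => [y|]; rewrite ?exprS// -natr1; ring.
  have q : dat (fun y => y^-1 ^+ k * expR (- y^-1)) x (eta k.+2 x - k%:R * eta k.+1 x).
    by apply: dat_eq (datM p e) _; rewrite /eta x0 !exprS; ring.
  apply: (near_eq_is_derive _ q).
    near=> y; rewrite /eta; have -> //: 0 < y.
    by near: y; exact: lt_nbhsr.
- have -> : eta k.+2 0 - k%:R * eta k.+1 0 = 0 by rewrite /eta ltxx mulr0 subrr.
  apply: dat_intro => d d0; pose C : R := (k.+3)%:R ^+ k.+2.
  have C0 : 0 < C by rewrite exprn_gt0.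
  exists (d / C) => /=; first exact: divr_gt0.
  move=> h; rewrite /ball_/= sub0r normrN => hd h0.
  rewrite add0r /eta ltxx !subr0; have [hp|_] := ltP 0 h; last first.
    by rewrite mulr0 normr0 ltW.
  have v0 : 0 <= h^-1 by rewrite invr_ge0 ltW.
  rewrite ger0_norm ?mulr_ge0 ?exprn_ge0 ?expR_ge0//.
  have := pow_exp_bound k.+2 v0; rewrite -/C => hb.
  rewrite (gtr0_norm hp) ltr_pdivlMr// in hd; apply: le_trans (ltW hd).
  have -> : h^-1 * (h^-1 ^+ k * expR (- h^-1)) = h * (h^-1 ^+ k.+2 * expR (- h^-1)).
    by rewrite !exprS; field; rewrite lt0r_neq0.
  rewrite ler_pM2l// expRN ler_pdivrMr ?expR_gt0//.
Unshelve. all: by end_near. Qed.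

(** The syntactic closure of the flat functions under the operations used to build cut-offs;
    differentiating a constructor gives an expression of the same kind. *)
Inductive bumpy : (R -> R) -> Prop :=
| bumpy_eta k : bumpy (eta k)
| bumpyD g h : bumpy g -> bumpy h -> bumpy (fun x => g x + h x)
| bumpyM g h : bumpy g -> bumpy h -> bumpy (fun x => g x * h x)
| bumpyZ c g : bumpy g -> bumpy (fun x => c * g x)
| bumpy_affine a b g : bumpy g -> bumpy (fun x => g (a * x + b)).

Lemma bumpy_derive g : bumpy g -> exists2 g', bumpy g' & forall x, dat g x (g' x).
Proof.
elim=> {g} [k|g h _ [g' Sg hg] _ [h' Sh hh]|g h Sg0 [g' Sg hg] Sh0 [h' Sh hh]|
  c g _ [g' Sg hg]|a b g _ [g' Sg hg]].
- exists (fun x => eta k.+2 x + (- k%:R) * eta k.+1 x).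
    by apply: bumpyD; [|apply: bumpyZ]; exact: bumpy_eta.
  by move=> x; rewrite mulNr; exact: eta_derive.
- by exists (fun x => g' x + h' x) => [|x]; [exact: bumpyD|exact: datD].
- exists (fun x => g' x * h x + g x * h' x) => [|x]; last exact: datM.
  by apply: bumpyD; exact: bumpyM.
- by exists (fun x => c * g' x) => [|x]; [exact: bumpyZ|exact: datZ].
- exists (fun x => a * g' (a * x + b)) => [|x]; last exact: dat_affine.
  by apply: bumpyZ; exact: bumpy_affine.
Qed.

Lemma bumpy_cont g : bumpy g -> continuous g.
Proof. by move=> /bumpy_derive[g' _ h] x; exact: dat_cont (h x). Qed.

Lemma smooth_antiderivative G g : bumpy g -> (forall x, dat G x (g x)) -> smooth G.
Proof.
move=> Sg hG; apply: (@smooth_class (fun h => bumpy h \/ h = G)); last by right.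
move=> h [Sh|->]; last by exists g => //; left.
by have [h' Sh' H] := bumpy_derive Sh; exists h' => //; left.
Qed.

Lemma ac_C1 K G g : measurable_fun setT g -> (forall x, `|g x| <= K) ->
  (forall x, dat G x (g x)) -> ac G g.
Proof.
move=> mg gK hG; apply: (@ac_intro _ _ (fun=> K)) => //; last exact: aeT.
split; [exact: lig_cst|by move=> _; apply: le_trans (gK 0)|].
by move=> a b ab; rewrite itg_cst//; apply: dat_mvt_abs ab _ _ => x _; [exact: hG|exact: gK].
Qed.

Lemma dat_ac G g x : ac G g -> {for x, continuous g} -> dat G x (g x).
Proof.
move=> aG cg; apply: dat_intro => e e0.
move/cvgrPdist_le : cg => /(_ e e0) [d /= d0 hd].
have key (a b : R) : a <= b -> x - d < a -> b < x + d ->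
    `|G b - G a - g x * (b - a)| <= e * (b - a).
  move=> ab xa xb; have lB := ligD aG.1 (lig_cst (- g x)).
  rewrite aG.2// -itg_cst// -itgB; [|exact: aG.1|exact: lig_cst].
  apply: le_trans (itg_norm _ _ lB) _; rewrite -itg_cst//.
  apply: itg_le; [exact: lig_norm|exact: lig_cst|].
  move=> y /andP[ay yb]; rewrite distrC; apply: hd; rewrite /ball_/= ltr_norml.
  by apply/andP; split; lra.
exists d => //= h; rewrite /ball_/= sub0r normrN => hd' h0.
have hn : 0 < `|h| by rewrite normr_gt0.
have -> : h^-1 * (G (x + h) - G x) - g x = h^-1 * (G (x + h) - G x - g x * h) by field.
rewrite normrM normfV ler_pdivrMl//.
have [hp|hm] := leP 0 h.
  have := key x (x + h); rewrite (ger0_norm hp) in hd' *.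
  have -> : x + h - x = h by ring.
  by rewrite [h * e]mulrC; apply; lra.
have := key (x + h) x; rewrite (ltr0_norm hm) in hd' *.
have -> : x - (x + h) = - h by ring.
rewrite -normrN [- h * e]mulrC.
have -> : - (G x - G (x + h) - g x * - h) = G (x + h) - G x - g x * h by ring.
by apply; lra.
Qed.

Lemma eta_ge0 k x : 0 <= eta k x.
Proof.
by rewrite /eta; case: ltP => // x0; rewrite mulr_ge0 ?expR_ge0// exprn_ge0// invr_ge0 ltW.
Qed.

Lemma eta0_le1 x : eta 0 x <= 1.
Proof.
rewrite /eta; case: ltP => // x0; rewrite expr0 mul1r expR_le1 oppr_le0 invr_ge0; exact: ltW.
Qed.

Definition bump0 (x : R) : R := eta 0 x * eta 0 (- 1 * x + 1).

Lemma bump0_bumpy : bumpy bump0.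
Proof. by apply: bumpyM; [|apply: bumpy_affine]; exact: bumpy_eta. Qed.

Lemma bump0_ge0 x : 0 <= bump0 x.
Proof. by rewrite mulr_ge0 ?eta_ge0. Qed.

Lemma bump0_le1 x : `|bump0 x| <= 1.
Proof. by rewrite ger0_norm ?bump0_ge0// mulr_ile1 ?eta_ge0 ?eta0_le1. Qed.

Lemma bump0_out x : ~~ (0 < x < 1) -> bump0 x = 0.
Proof.
rewrite negb_and -!leNgt => /orP[x0|x1]; rewrite /bump0 /eta.
  by rewrite ltNge x0 mul0r.
have -> : (0 < - 1 * x + 1) = false by apply/negbTE; rewrite -leNgt mulN1r addrC subr_le0.
by rewrite mulr0.
Qed.

Lemma bump0_meas : measurable_fun setT bump0.
Proof. exact: continuous_measurable_fun (bumpy_cont bump0_bumpy). Qed.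

Lemma bump0_lig : lig bump0.
Proof. by apply: lig_le bump0_meas (lig_cst 1) _ => x; exact: bump0_le1. Qed.

Lemma bump0_mass : 0 < itg 0 1 bump0.
Proof.
have h (y : R) : 4^-1 <= y -> expR (- 4) <= eta 0 y.
  move=> y4; have y0 : 0 < y by apply: lt_le_trans y4.
  by rewrite /eta y0 expr0 mul1r ler_expR lerN2 -[leRHS]invrK lef_pV2 ?posrE.
(* On [[1/4, 1/2]] both [x] and [1 - x] are at least 1/4, so each factor of the bump is at least
   e^{-4}. *)
apply: (@lt_le_trans _ _ (itg 4^-1 2^-1 (fun=> expR (- 4) * expR (- 4)))).
  rewrite itg_cst; last by lra.
  by rewrite mulr_gt0 ?mulr_gt0 ?expR_gt0//; lra.
apply: (@le_trans _ _ (itg 4^-1 2^-1 bump0)).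
  apply: itg_le; [exact: lig_cst|exact: bump0_lig|move=> x /andP[x1 x2]].
  by apply: ler_pM; rewrite ?expR_ge0//; apply: h => //; lra.
by apply: itg_sub; [exact: bump0_lig|exact: bump0_ge0|lra..].
Qed.

Definition bump (x : R) : R := (itg 0 1 bump0)^-1 * bump0 x.

Lemma bump_bumpy : bumpy bump.
Proof. exact: bumpyZ bump0_bumpy. Qed.

Lemma bump_ge0 x : 0 <= bump x.
Proof. by rewrite mulr_ge0 ?bump0_ge0// invr_ge0 ltW// bump0_mass. Qed.

Lemma bump_le x : `|bump x| <= (itg 0 1 bump0)^-1.
Proof.
rewrite normrM ger0_norm ?invr_ge0 ?(ltW bump0_mass)//.
by rewrite ler_piMr ?bump0_le1// invr_ge0 ltW// bump0_mass.
Qed.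

Lemma bump_out x : ~~ (0 < x < 1) -> bump x = 0.
Proof. by move=> /bump0_out h; rewrite /bump h mulr0. Qed.

Lemma bump_meas : measurable_fun setT bump.
Proof. exact: continuous_measurable_fun (bumpy_cont bump_bumpy). Qed.

Lemma bump_lig : lig bump.
Proof. exact: ligZ bump0_lig. Qed.

Definition step : R -> R := prim bump.

Lemma step_ac : ac step bump. Proof. exact: ac_prim bump_lig. Qed.

Lemma step_derive x : dat step x (bump x).
Proof. apply: dat_ac step_ac _; exact: (bumpy_cont bump_bumpy). Qed.

Lemma step_nd x y : x <= y -> step x <= step y.
Proof. by move=> xy; rewrite -subr_ge0 step_ac.2//; apply: lig_itg_ge0; exact: bump_ge0. Qed.

Lemma step0 x : x <= 0 -> step x = 0.
Proof.
have z : step 0 = 0 by rewrite /step /prim lexx itg_refl.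
move=> x0; apply/eqP; rewrite -z eq_sym -subr_eq0 step_ac.2//; apply/eqP.
rewrite (@itg_ext _ _ _ _ (fun=> 0)) ?itg_cst ?mul0r// => y /andP[_ y0].
by rewrite bump_out// negb_and -leNgt y0.
Qed.

Lemma step1 x : 1 <= x -> step x = 1.
Proof.
have z : step 1 = 1.
  rewrite -[LHS]subr0 -(step0 (lexx 0)) step_ac.2// /bump itgZ; last exact: bump0_lig.
  by rewrite mulVf// gt_eqF// bump0_mass.
move=> x1; apply/eqP; rewrite -z -subr_eq0 step_ac.2//; apply/eqP.
rewrite (@itg_ext _ _ _ _ (fun=> 0)) ?itg_cst ?mul0r// => y /andP[y1 _].
by rewrite bump_out// negb_and -!leNgt y1 orbT.
Qed.

Lemma step_ge0 x : 0 <= step x.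
Proof. by have [x0|/ltW x0] := leP x 0; [rewrite step0|rewrite -(step0 (lexx 0)) step_nd]. Qed.

Lemma step_le1 x : step x <= 1.
Proof. by have [x1|/ltW x1] := leP 1 x; [rewrite step1|rewrite -(step1 (lexx 1)) step_nd]. Qed.

End smooth_functions.

(** * Weak derivatives and continuous representatives *)

Section weak_derivative.
Context {R : realType}.
Local Notation mu := (@lebesgue_measure R).
Implicit Types (g h U u w : R -> R).

Lemma ligB U u : lig U -> lig u -> lig (fun x => U x - u x).
Proof.
move=> hU hu; have := ligD hU (ligZ (-1) hu); congr lig.
by apply/funext => x; rewrite mulN1r.
Qed.

(** A Lebesgue point in one-sided form: the approximate identities below are supported to the right
    of their centre. *)
Definition leb_right U (a : R) : Prop := forall e, 0 < e ->
  exists2 d, 0 < d & forall r, 0 < r < d -> itg a (a + r) (fun y => `|U y - U a|) <= e * r.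

Lemma ae_leb_right U : lig U -> {ae mu, forall a, leb_right U a}.
Proof.
move=> hU; apply: aeS (lebesgue_differentiation (lig_locally hU)) => a ha e e0.
have /fine_cvgP[[d1 /= d10 fin] /cvgrPdist_lt/(_ (e / 4))] := ha.
rewrite divr_gt0// => /(_ isT)[d2 /= d20 lim].
(* The ball of radius [2 r] contains the closed segment [[a, a + r]] and has measure [4 r], which
   explains the [e / 4] above and the halving of the radius here. *)
exists (Num.min d1 d2 / 2); first by rewrite divr_gt0// lt_min d10.
move=> r /andP[r0]; rewrite ltr_pdivlMr// lt_min => /andP[r1 r2].
have rr0 : 0 < r * 2 by rewrite mulr_gt0.
have dist (d : R) : r * 2 < d -> `|0 - r * 2| < d by rewrite sub0r normrN gtr0_norm.
have := fin (r * 2) (dist _ r1) rr0; have := lim (r * 2) (dist _ r2) rr0.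
rewrite /davg /iavg lebesgue_measure_ball ?(ltW rr0)//= sub0r normrN.
set I := (\int[mu]_(y in _) _)%E => lt4 fn.
have lB := ligD hU (lig_cst (- U a)).
have hI : ((itg a (a + r) (fun y => `|U y - U a|))%:E <= I)%E.
  rewrite /itg /Rintegral fineK; last first.
    by apply: integrable_fin_num => //; exact: (lig_norm lB).2.
  apply: ge0_subset_integral => //.
  - exact: measurable_ball.
  - apply/measurable_EFinP; apply: measurableT_comp => //.
    by apply: (measurable_funS measurableT) => //; exact: lB.1.
  - move=> y /=; rewrite in_itv/= => /andP[y1 y2].
    by rewrite /ball/= ltr_norml; apply/andP; split; lra.
have r4 : 0 < r * 2 *+ 2 by rewrite pmulrn_lgt0.
have := lee_wpmul2l _ hI; move=> /(_ ((r * 2 *+ 2)%:E^-1)%E).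
rewrite inver gt_eqF// lee_fin invr_ge0 (ltW r4) => /(_ isT).
rewrite inver gt_eqF// in lt4 fn.
rewrite -(fineK fn) -EFinM lee_fin => /le_lt_trans/(_ (le_lt_trans (ler_norm _) lt4)).
rewrite ltr_pdivrMl// => /ltW /le_trans; apply.
by rewrite le_eqVlt; apply/orP; left; apply/eqP; rewrite -mulr_natl; field.
Qed.

Definition wk U u : Prop := forall phi, test_function phi ->
  ip U (phi^`())%classic = - ip u phi.

Lemma ae_neq (a : R) : {ae mu, forall x, x != a}.
Proof.
exists [set a]; split => //; first by rewrite lebesgue_measure_set1.
by move=> x /= /negP; rewrite negbK => /eqP.
Qed.

Lemma ae_exists_itv (P : R -> Prop) a b : a < b -> {ae mu, forall x, P x} ->
  exists2 x, a <= x <= b & P x.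
Proof.
move=> ab h; apply: contrapT => H.
have : itg a b (fun=> 1 : R) = itg a b (fun=> 0 : R).
  by apply: itg_ae => //; apply: aeS h => x Px xab; case: H; exists x.
by rewrite !itg_cst ?(ltW ab)// mul0r mul1r => /eqP; rewrite subr_eq0 gt_eqF.
Qed.

Lemma ae_exists (P : R -> Prop) : {ae mu, forall x, P x} -> exists x, P x.
Proof. by move=> h; have [x _ Px] := ae_exists_itv ltr01 h; exists x. Qed.

Lemma supp_int a b g : (forall x, ~~ (a <= x <= b) -> g x = 0) ->
  \int[mu]_x g x = itg a b g.
Proof.
move=> hg; rewrite itgE; apply: int_ext => x; rewrite /ind.
by case: ifPn => [_|/hg ->]; rewrite ?mulr1 ?mulr0.
Qed.

(* For large [n] the derivative of [step (n (x - a)) - step (n (x - b))] tests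
   against approximate identities at [a] and [b]. *)
Let stn (n : nat) (a x : R) : R := step (n.+1%:R * x + - (n.+1%:R * a)).
Let btn (n : nat) (a x : R) : R := n.+1%:R * bump (n.+1%:R * x + - (n.+1%:R * a)).

Lemma stn_derive n a x : dat (stn n a) x (btn n a x).
Proof. exact: dat_affine (step_derive _). Qed.

Lemma btn_meas n a : measurable_fun setT (btn n a).
Proof.
apply: measurable_funM => //; apply: measurableT_comp; first exact: bump_meas.
by apply: measurable_funD => //; exact: measurable_funM.
Qed.

Lemma btn_le n a x : `|btn n a x| <= n.+1%:R * (itg 0 1 bump0)^-1.
Proof. by rewrite normrM ger0_norm// ler_wpM2l// bump_le. Qed.

Lemma stn_ac n a : ac (stn n a) (btn n a).
Proof. exact: ac_C1 (btn_meas n a) (btn_le n a) (stn_derive n a). Qed.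

Lemma stn_arg n (a x : R) : n.+1%:R * x + - (n.+1%:R * a) = n.+1%:R * (x - a) :> R.
Proof. by ring. Qed.

Lemma btn_out n a x : ~~ (a <= x <= a + (n.+1%:R)^-1) -> btn n a x = 0.
Proof.
move=> h; rewrite /btn bump_out ?mulr0// stn_arg; apply: contra h => /andP[h1 h2].
have n0 : 0 < n.+1%:R :> R by [].
rewrite pmulr_rgt0// subr_gt0 in h1; rewrite (ltW h1)/=.
by rewrite mulrC -ltr_pdivlMr// mul1r in h2; rewrite -lerBlDl ltW.
Qed.

Lemma btn_mass n a : itg a (a + (n.+1%:R)^-1) (btn n a) = 1.
Proof.
have n0 : 0 < n.+1%:R :> R by [].
have e1 : step (n.+1%:R * (a + (n.+1%:R)^-1 - a)) = 1 :> R.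
  by rewrite step1// [a + _]addrC addrK mulfV// gt_eqF.
by rewrite -(stn_ac n a).2 ?lerDl ?invr_ge0// /stn !stn_arg e1 subrr mulr0 step0 ?subr0.
Qed.

Lemma btn_limit U a : L2R U -> leb_right U a ->
  ip U (btn n a) @[n --> \oo] --> U a.
Proof.
move=> hU ha; apply/cvgrPdist_le => e e0; have c0 := @bump0_mass R.
(* The kernel [btn n a] is bounded by [n + 1] divided by the mass of [bump0] and lives on a segment
   of length [1 / (n + 1)], so this tolerance at the Lebesgue point becomes [e] in the end. *)
have ec : 0 < e * itg 0 1 bump0 by rewrite mulr_gt0.
have [d d0 hd] := ha _ ec; near=> n.
have n0 : 0 < n.+1%:R :> R by [].
have nd : (n.+1%:R)^-1 < d.
  rewrite -[ltRHS]invrK ltf_pV2 ?posrE ?invr_gt0//.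
  apply: (@lt_trans _ _ n%:R); last by rewrite ltr_nat.
  by near: n; exact: nbhs_infty_gtr.
have -> : ip U (btn n a) = itg a (a + (n.+1%:R)^-1) (fun x => U x * btn n a x).
  by apply: supp_int => x /btn_out ->; rewrite mulr0.
have lb := (stn_ac n a).1; have lU := L2R_lig hU.
have lUb := ligM lU (btn_meas n a) (btn_le n a).
have -> : U a = itg a (a + (n.+1%:R)^-1) (fun x => U a * btn n a x).
  by rewrite itgZ// btn_mass mulr1.
rewrite -itgB//; last exact: ligZ.
have lB := ligD lU (lig_cst (- U a)).
apply: le_trans (itg_norm _ _ _) _; first by apply: ligB => //; exact: ligZ.
apply: (@le_trans _ _ (itg a (a + (n.+1%:R)^-1)
   (fun x => (n.+1%:R * (itg 0 1 bump0)^-1) * `|U x - U a|))).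
  apply: itg_le.
  - by apply: lig_norm; apply: ligB => //; exact: ligZ.
  - by apply: ligZ; exact: lig_norm lB.
  - by move=> x _; rewrite -mulrBl normrM mulrC distrC ler_wpM2r// btn_le.
rewrite itgZ; last exact: lig_norm lB.
have nv : 0 < (n.+1%:R)^-1 :> R by rewrite invr_gt0.
have hr := introT andP (conj nv nd).
apply: le_trans (ler_wpM2l _ (hd _ hr)) _; first by rewrite divr_ge0// ltW.
by rewrite le_eqVlt; apply/orP; left; apply/eqP; field; rewrite !gt_eqF.
Unshelve. all: by end_near. Qed.

Lemma stn_test n a b : test_function (fun x => stn n a x - stn n b x).
Proof.
have hd x := datB (stn_derive n a x) (stn_derive n b x).
split.
  apply: (@smooth_antiderivative _ _ (fun x => btn n a x + (-1) * btn n b x)).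
    have bb c : bumpy (btn n c) := bumpyZ _ (bumpy_affine _ _ bump_bumpy).
    by apply: bumpyD; [|apply: bumpyZ].
  by move=> x; rewrite mulN1r.
exists (`|a| + `|b| + 1) => x hx.
have n1 : 1 <= n.+1%:R :> R by rewrite ler1n.
have [x0|x0] := leP 0 x.
  rewrite (ger0_norm x0) in hx.
  have ha : 1 <= x - a by have := ler_norm a; have := normr_ge0 b; lra.
  have hb : 1 <= x - b by have := ler_norm b; have := normr_ge0 a; lra.
  by rewrite /stn !stn_arg !step1 ?subrr// -[leLHS]mul1r ler_pM.
rewrite (ltr0_norm x0) in hx.
have ha : x - a <= 0 by have := ler_norm (- a); rewrite normrN; have := normr_ge0 b; lra.
have hb : x - b <= 0 by have := ler_norm (- b); rewrite normrN; have := normr_ge0 a; lra.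
by rewrite /stn !stn_arg !step0 ?subrr// pmulr_rle0.
Qed.

Lemma stn_bound n a x : 0 <= stn n a x <= 1.
Proof. by rewrite step_ge0 step_le1. Qed.

Lemma stn_limit (a x : R) : x != a -> stn n a x @[n --> \oo] --> (if a < x then 1 else 0 : R).
Proof.
move=> xa; have [ax|ax] := ltP a x; last first.
  apply: cvg_near_cst; near=> n; rewrite /stn stn_arg step0//.
  by rewrite pmulr_rle0// subr_le0.
apply: cvg_near_cst; near=> n; rewrite /stn stn_arg step1//.
rewrite -ler_pdivrMr ?subr_gt0// mul1r.
apply: (@le_trans _ _ n%:R); last by rewrite ler_nat.
by near: n; exact: nbhs_infty_ger.
Unshelve. all: by end_near. Qed.

(** The weak derivative is tested against a smoothed indicator of the segment. The left side tends
    to [U a - U b] because both ends are Lebesgue points, and the right side converges by dominated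
    convergence. *)
Lemma wk_diff U u a b : L2R U -> L2R u -> wk U u -> a <= b -> leb_right U a -> leb_right U b ->
  U b - U a = itg a b u.
Proof.
move=> hU hu hw ab ha hb.
have e1 n : ip U (btn n a) - ip U (btn n b) = - \int[mu]_x (u x * (stn n a x - stn n b x)).
  have := hw _ (stn_test n a b).
  rewrite (derive1_dat (fun x => datB (stn_derive n a x) (stn_derive n b x))) => <-.
  have bL c : L2R (btn n c).
    apply: (@L2R_le _ _ (fun x => (n.+1%:R * (itg 0 1 bump0)^-1) * ind c (c + (n.+1%:R)^-1) x)).
    - exact: btn_meas.
    - move=> x; rewrite /ind; case: ifPn => [_|/btn_out ->].
        by rewrite mulr1 btn_le.
      by rewrite mulr0 normr0.
    - by apply: L2RZ; exact: L2R_ind.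
  by rewrite -ipBr.
have l1 : (ip U (btn n a) - ip U (btn n b)) @[n --> \oo] --> U a - U b.
  by apply: cvgB; exact: btn_limit.
have ms c n : measurable_fun setT (stn n c) by exact: ac_meas (stn_ac n c).
have l2 : \int[mu]_x (u x * (stn n a x - stn n b x)) @[n --> \oo] -->
    \int[mu]_x (u x * ind a b x).
  apply: (DCT (g := fun x => `|u x * ind a (b + 1) x|)).
  - by move=> n; apply: measurable_funM; [exact: hu.1|exact: measurable_funB].
  - exact: lig_ind (L2R_lig hu).
  - exact: igr_norm (lig_ind _ _ (L2R_lig hu)).
  - move=> n x; rewrite !normrM ler_wpM2l//.
    have n1 : 1 <= n.+1%:R :> R by rewrite ler1n.
    have /andP[sa0 sa1] := stn_bound n a x; have /andP[sb0 sb1] := stn_bound n b x.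
    rewrite /ind; case: ifPn => [_|]; first by rewrite normr1 ler_norml; apply/andP; split; lra.
    rewrite negb_and -!ltNge => /orP[xa|bx].
      rewrite /stn !stn_arg !step0 ?subrr// pmulr_rle0// subr_le0; last exact: ltW.
      by rewrite (le_trans (ltW xa)).
    rewrite /stn !stn_arg !step1 ?subrr// -[leLHS]mul1r ler_pM//; lra.
  - apply: aeS (aeI (ae_neq a) (ae_neq b)) => x [xa xb].
    apply: cvgM; first exact: cvg_cst.
    have -> : ind a b x = (if a < x then 1 else 0) - (if b < x then 1 else 0) :> R.
      rewrite /ind [a <= x]le_eqVlt eq_sym (negbTE xa)/=.
      have [bx|xb'] := ltP b x; first by rewrite (le_lt_trans ab bx) subrr.
      by rewrite andbT subr0.
    by apply: cvgB; exact: stn_limit.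
have l3 : (ip U (btn n a) - ip U (btn n b)) @[n --> \oo] --> - \int[mu]_x (u x * ind a b x).
  by rewrite (funext e1); exact: cvgN.
have h : U a - U b = - itg a b u.
  by rewrite itgE; exact: (cvg_unique (@norm_hausdorff _ _) l1 l3).
by rewrite -[RHS]opprK -h opprB.
Qed.

(** The representative is the primitive of [u] normalised at one Lebesgue point of [U]; by [wk_diff]
    it agrees with [U] at all of them. *)
Lemma wk_sob U u : L2R U -> L2R u -> wk U u ->
  exists2 X, sob X u & {ae mu, forall x, X x = U x}.
Proof.
move=> hU hu hw; have lU := L2R_lig hU; have lu := L2R_lig hu.
have aeG := ae_leb_right lU; have [a ha] := ae_exists aeG.
pose X x := prim u x + (U a - prim u a).
have aX : ac X u by apply: ac_ext (acD (ac_prim lu) (ac_cst _)) => // x; rewrite addr0.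
have eX : {ae mu, forall x, X x = U x}.
  apply: aeS aeG => x hx; have [ax|/ltW xa] := leP a x.
    have := wk_diff hU hu hw ax ha hx; have := (ac_prim lu).2 _ _ ax; rewrite /X; lra.
  have := wk_diff hU hu hw xa hx ha; have := (ac_prim lu).2 _ _ xa; rewrite /X; lra.
exists X => //; split=> //; exact: L2R_ae (ac_meas aX) eX hU.
Qed.

Lemma test_sob (phi : R -> R) : test_function phi -> sob phi (phi^`())%classic.
Proof.
move=> [sm [M hM]].
have d1 x : dat phi x ((phi^`())%classic x).
  by rewrite derive1E; apply: DeriveDef => //; exact: (sm 0%N).
have c1 : continuous (phi^`())%classic.
  move=> x; have := sm 1%N x; rewrite derive1n1 => /derivable1_diffP /differentiable_continuous.
  exact.
have z1 x : M < `|x| -> (phi^`())%classic x = 0.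
  move=> Mx; apply: (@dat_uniq _ phi x) => //.
  have h0 : is_derive x 1 (fun=> 0 : R) 0 by exact: is_derive_cst.
  apply: (near_eq_is_derive _ h0); near=> y; rewrite hM//.
  near: y; have : {for x, continuous (fun y : R => `|y|)} by exact: norm_continuous.
  by move=> /(_ _ (lt_nbhsr Mx)).
have [K hK] : exists K, forall x, `|(phi^`())%classic x| <= K.
  have cK := @segment_compact R (- M) M.
  have := compact_bounded (continuous_compact (continuous_subspaceT c1) cK).
  move=> [N [_ hN]]; exists (`|N| + 1) => x.
  have [/z1 ->|xM] := ltP M `|x|; first by rewrite normr0 addr_ge0.
  apply: (hN (`|N| + 1)); first by have := ler_norm N; lra.
  by exists x => //=; rewrite in_itv/= -ler_norml.
have m1 : measurable_fun setT (phi^`())%classic by exact: continuous_measurable_fun.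
have aph := ac_C1 m1 hK d1.
have K0 : 0 <= K by apply: le_trans (hK 0).
have m0 := ac_meas aph.
have lsup g C : measurable_fun setT g -> (forall x, `|g x| <= C) ->
    (forall x, M < `|x| -> g x = 0) -> L2R g.
  move=> mg gC gM; apply: (@L2R_le _ _ (fun x => C * ind (- M) M x)) => //.
    move=> x; rewrite /ind -ler_norml; case: (leP `|x| M) => [_|xM]; first by rewrite mulr1.
    by rewrite (gM _ xM) normr0 mulr0.
  by apply: L2RZ; exact: L2R_ind.
have [K' hK'] : exists K, forall x, `|phi x| <= K.
  exists (K * (2 * (`|M| + 1))) => x.
  have [/hM ->|xM] := ltP M `|x|; first by rewrite normr0 !mulr_ge0// addr_ge0.
  have z : phi (- (`|M| + 1)) = 0 by apply: hM; 
    rewrite normrN ger0_norm ?addr_ge0//; have := ler_norm M; lra.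
  have xx : - (`|M| + 1) <= x by have := ler_norm M; have := ler_norm (- x); rewrite normrN; lra.
  have := dat_mvt_abs (c := K) xx (fun y _ => d1 y) (fun y _ => hK y).
  rewrite z subr0 => /le_trans; apply; rewrite ler_wpM2l//.
  by have := ler_norm M; have := ler_norm x; lra.
by split=> //; [exact: lsup hK' hM|exact: lsup hK z1].
Unshelve. all: by end_near. Qed.

Lemma sob_wk U u : sob U u -> wk U u.
Proof. by move=> hU phi /test_sob hphi; rewrite (sob_ibp hU hphi) opprK. Qed.

End weak_derivative.

(** * From complex solutions to the real system *)

Section sobolev_bridge.
Context {R : realType}.
Local Notation mu := (@lebesgue_measure R).
Implicit Types (g h U : R -> R) (u v w : R -> R[i]).

Definition re u (x : R) : R := complex.Re (u x).
Definition im u (x : R) : R := complex.Im (u x).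

Lemma cmodulus_sq (z : R[i]) : cmodulus z ^+ 2 = complex.Re z ^+ 2 + complex.Im z ^+ 2.
Proof. by case: z => a b; rewrite /cmodulus /= sqr_sqrtr// addr_ge0 ?sqr_ge0. Qed.

Lemma cmodulus_ge0 (z : R[i]) : 0 <= cmodulus z.
Proof. by case: z => a b; rewrite /cmodulus /= sqrtr_ge0. Qed.

Lemma cmodulus_Re (z : R[i]) : `|complex.Re z| <= cmodulus z.
Proof. by case: z => a b; rewrite /cmodulus /= -sqrtr_sqr ler_wsqrtr// lerDl sqr_ge0. Qed.

Lemma cmodulus_Im (z : R[i]) : `|complex.Im z| <= cmodulus z.
Proof. by case: z => a b; rewrite /cmodulus /= -sqrtr_sqr ler_wsqrtr// lerDr sqr_ge0. Qed.

Lemma Lnorm2_int g : ('N[mu]_2%:E[(fun x => (g x)%:E)] =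
  (\int[mu]_x ((g x ^+ 2)%:E)) `^ 2^-1)%E.
Proof.
rewrite unlock; congr (_ `^ _)%E; apply: eq_integral => x _.
by rewrite abse_EFin poweR_EFin powR_mulrn// real_normK ?num_real.
Qed.

Lemma Lnorm2E g : L2R g -> ('N[mu]_2%:E[(fun x => (g x)%:E)] = (nrm g)%:E)%E.
Proof.
move=> [_ ig]; rewrite Lnorm2_int /nrm ip_int.
have -> : (\int[mu]_x ((g x ^+ 2)%:E))%E = (\int[mu]_x (g x ^+ 2))%:E.
  by rewrite /Rintegral fineK//; exact: integrable_fin_num.
by rewrite poweR_EFin powR12_sqrt// int_ge0// => x; exact: sqr_ge0.
Qed.

Lemma Lnorm2_fin g : measurable_fun setT g ->
  ('N[mu]_2%:E[(fun x => (g x)%:E)] < +oo)%E -> L2R g.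
Proof.
move=> mg; rewrite Lnorm2_int => h; split=> //.
have mg2 : measurable_fun setT (fun x => g x ^+ 2) by exact: measurable_funX.
apply/integrableP; split; first exact/measurable_EFinP.
have -> : (\int[mu]_x `|(EFin \o (fun x => (g x ^+ 2)%R)) x| = \int[mu]_x (g x ^+ 2)%:E)%E.
  by apply: eq_integral => x _; rewrite /= ger0_norm ?sqr_ge0.
by apply: lty_poweRy h; rewrite invr_eq0.
Qed.

Lemma L2normP u : L2norm u = ('N[mu]_2%:E[(fun x => (cmodulus (u x))%:E)])%E.
Proof. by rewrite /L2norm /Lnorm_on patch_setT. Qed.

Lemma cmod_meas u : cmeasurable u -> measurable_fun setT (fun x => cmodulus (u x)).
Proof.
move=> [m1 m2].
have -> : (fun x => cmodulus (u x)) = (fun x => Num.sqrt (re u x ^+ 2 + im u x ^+ 2)).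
  by apply/funext => x; rewrite /re /im -cmodulus_sq sqrtr_sqr ger0_norm ?cmodulus_ge0.
apply: (@measurableT_comp _ _ _ _ _ _ (@Num.sqrt R)).
  by apply: continuous_measurable_fun; exact: sqrt_continuous.
by apply: measurable_funD; exact: measurable_funX.
Qed.

Lemma L2P u : L2 u <-> L2R (re u) /\ L2R (im u).
Proof.
split=> [[cu]|[h1 h2]].
  rewrite L2normP => /(Lnorm2_fin (cmod_meas cu)) h; have [m1 m2] := cu.
  by split; apply: L2R_le h => // x; [exact: cmodulus_Re|exact: cmodulus_Im].
have cu : cmeasurable u by split; [exact: h1.1|exact: h2.1].
split=> //; rewrite L2normP Lnorm2E ?ltry//; split; first exact: cmod_meas.
have := igrD h1.2 h2.2; congr igr; by apply/funext => x; rewrite cmodulus_sq.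
Qed.

Lemma L2normE u : L2 u -> L2norm u = (Num.sqrt (sqn (re u) (im u)))%:E.
Proof.
move=> /[dup] hu /L2P[h1 h2]; rewrite L2normP Lnorm2E.
  congr (Num.sqrt _)%:E; rewrite ip_int -(sqn_int h1 h2).2.
  by apply: int_ext => x; rewrite cmodulus_sq.
split; first exact: cmod_meas hu.1.
have := igrD h1.2 h2.2; congr igr; by apply/funext => x; rewrite cmodulus_sq.
Qed.

Lemma Re_mulr (z : R[i]) (c : R) : complex.Re (z * c%:C%C) = complex.Re z * c.
Proof. by case: z => a b /=; rewrite mulr0 subr0. Qed.

Lemma Im_mulr (z : R[i]) (c : R) : complex.Im (z * c%:C%C) = complex.Im z * c.
Proof. by case: z => a b /=; rewrite mulr0 add0r. Qed.

Lemma weak_derivP u v : weak_deriv u v <-> wk (re u) (re v) /\ wk (im u) (im v).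
Proof.
split=> [h|[h1 h2] phi tphi].
  split=> phi tphi; have := h phi tphi; rewrite /cintegral => -[].
    by under eq_Rintegral do rewrite Re_mulr; under [in RHS]eq_Rintegral do rewrite Re_mulr.
  move=> _; by under eq_Rintegral do rewrite Im_mulr; under [in RHS]eq_Rintegral do rewrite Im_mulr.
have := h1 phi tphi; have := h2 phi tphi; rewrite /ip => e2 e1.
rewrite /cintegral.
under eq_Rintegral do rewrite Re_mulr; under [in RHS]eq_Rintegral do rewrite Re_mulr.
under [X in Complex _ X = _]eq_Rintegral do rewrite Im_mulr.
under [X in _ = - Complex _ X]eq_Rintegral do rewrite Im_mulr.
by rewrite [LHS](_ : _ = Complex (- ip (re v) phi) (- ip (im v) phi))// /ip; congr Complex.
Qed.

Lemma wkB (U V u1 v1 : R -> R) : L2R U -> L2R V -> L2R u1 -> L2R v1 -> wk U u1 -> wk V v1 ->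
  wk (fun x => U x - V x) (fun x => u1 x - v1 x).
Proof.
move=> hU hV hu hv h1 h2 phi tphi; have [p0 p1 _] := test_sob tphi.
by rewrite !ipBl// h1// h2//; ring.
Qed.

Lemma wderivP u : H1 u -> L2 (wderiv u) /\ weak_deriv u (wderiv u).
Proof.
by move=> [_ [v hv]]; exact: (@xgetPex _ _ [set v | L2 v /\ weak_deriv u v] (ex_intro _ v hv)).
Qed.

Lemma H1_L2 u : H1 u ->
  [/\ L2R (re u), L2R (im u), L2R (re (wderiv u)) & L2R (im (wderiv u))].
Proof. by move=> /[dup] -[/L2P[? ?] _] /wderivP[/L2P[? ?] _]. Qed.

Definition h1sq u : R := sqn (re u) (im u) + sqn (re (wderiv u)) (im (wderiv u)).

Lemma H1normE u : H1 u -> H1norm u = (Num.sqrt (h1sq u))%:E.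
Proof.
move=> /[dup] -[hu _] /wderivP[hv _]; rewrite /H1norm !L2normE//.
have s0 U V : 0 <= @sqn R U V by exact: sqn_ge0.
have sq (a : R) : 0 <= a -> ((Num.sqrt a)%:E `^ 2 = a%:E)%E.
  by move=> a0; rewrite poweR_EFin powR_mulrn ?sqrtr_ge0// sqr_sqrtr.
rewrite !sq//; rewrite -EFinD poweR_EFin.
by rewrite powR12_sqrt// addr_ge0.
Qed.

Lemma H1_rep u : H1 u -> exists A B,
  [/\ sob A (re (wderiv u)), sob B (im (wderiv u)),
   {ae mu, forall x, A x = re u x} & {ae mu, forall x, B x = im u x}].
Proof.
move=> /[dup] /H1_L2[h1 h2 h3 h4] /wderivP[_ /weak_derivP[w1 w2]].
have [A hA eA] := wk_sob h1 h3 w1; have [B hB eB] := wk_sob h2 h4 w2.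
by exists A, B.
Qed.

Lemma cont_ae_eq (X Y : R -> R) : continuous X -> continuous Y ->
  {ae mu, forall x, X x = Y x} -> forall x, X x = Y x.
Proof.
move=> cX cY h x; apply/eqP; rewrite -subr_eq0; apply/negP => /negP n0.
have n1 : 0 < `|X x - Y x| / 2 by rewrite divr_gt0// normr_gt0.
have := cX x => /cvgrPdist_lt/(_ _ n1)[d1 /= d10 h1].
have := cY x => /cvgrPdist_lt/(_ _ n1)[d2 /= d20 h2].
pose d := Num.min d1 d2 / 2.
have d0 : 0 < d by rewrite divr_gt0// lt_min d10.
have xd : x < x + d by rewrite ltrDl.
have [y /andP[y1 y2] e] := ae_exists_itv xd h.
have yd : `|x - y| < Num.min d1 d2.
  rewrite distrC ger0_norm ?subr_ge0//; apply: (@le_lt_trans _ _ d); first by lra.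
  by rewrite ltr_pdivrMr// ltr_pMr ?ltr1n// lt_min d10.
rewrite lt_min in yd; have /andP[yd1 yd2] := yd.
have := h1 y yd1; have := h2 y yd2; rewrite e => k1 k2.
have : `|X x - Y x| < `|X x - Y x|.
  rewrite {1}(_ : X x - Y x = (X x - Y y) - (Y x - Y y)); last by ring.
  by apply: le_lt_trans (ler_normB _ _) _; lra.
by rewrite ltxx.
Qed.

Lemma sob_ae_uniq (X X1 Y Y1 : R -> R) : sob X X1 -> sob Y Y1 ->
  {ae mu, forall x, X x = Y x} ->
  (forall x, X x = Y x) /\ {ae mu, forall x, X1 x = Y1 x}.
Proof.
move=> hX hY e; have [_ _ aX] := hX; have [_ _ aY] := hY.
have E := cont_ae_eq (ac_cont aX) (ac_cont aY) e; split=> //.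
by apply: (ac_uniq aX); apply: ac_ext aY => // x; rewrite E.
Qed.

(** As [wderiv] is a chosen value, it can be identified with the given derivatives only almost
    everywhere. The identification passes through continuous representatives, whose densities are
    unique up to null sets. *)
Lemma H1_sob A a B b : sob A a -> sob B b -> H1 (fun x => Complex (A x) (B x)) /\
  {ae mu, forall x, re (wderiv (fun x => Complex (A x) (B x))) x = a x} /\
  {ae mu, forall x, im (wderiv (fun x => Complex (A x) (B x))) x = b x}.
Proof.
move=> hA hB; have [A2 a2 _] := hA; have [B2 b2 _] := hB.
set u := (fun x => _).
have hu : H1 u.
  split; first exact/L2P.
  exists (fun x => Complex (a x) (b x)); split; first exact/L2P.
  by apply/weak_derivP; split; exact: sob_wk.
have [X [Y [hX hY eX eY]]] := H1_rep hu; split=> //; split.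
  exact: (sob_ae_uniq hX hA eX).2.
exact: (sob_ae_uniq hY hB eY).2.
Qed.

Lemma H1B u v : H1 u -> H1 v -> H1 (fun x => u x - v x) /\
  {ae mu, forall x, re (wderiv (fun x => u x - v x)) x = re (wderiv u) x - re (wderiv v) x} /\
  {ae mu, forall x, im (wderiv (fun x => u x - v x)) x = im (wderiv u) x - im (wderiv v) x}.
Proof.
move=> hu hv; have [u1 u2 u3 u4] := H1_L2 hu; have [v1 v2 v3 v4] := H1_L2 hv.
have reB (f g : R -> R[i]) x : re (fun x => f x - g x) x = re f x - re g x.
  by rewrite /re; case: (f x) (g x) => ? ? [].
have imB (f g : R -> R[i]) x : im (fun x => f x - g x) x = im f x - im g x.
  by rewrite /im; case: (f x) (g x) => ? ? [].
have [_ /weak_derivP[w1 w2]] := wderivP hu; have [_ /weak_derivP[w3 w4]] := wderivP hv.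
have hw : H1 (fun x => u x - v x).
  split; first by apply/L2P; rewrite (funext (reB u v)) (funext (imB u v)); split; exact: L2RB.
  exists (fun x => wderiv u x - wderiv v x); split.
    by apply/L2P; rewrite (funext (reB _ _)) (funext (imB _ _)); split; exact: L2RB.
  apply/weak_derivP; rewrite !(funext (reB _ _)) !(funext (imB _ _)).
  by split; exact: wkB.
split=> //.
have [A [B [hA hB eA eB]]] := H1_rep hu; have [A' [B' [hA' hB' eA' eB']]] := H1_rep hv.
have [X [Y [hX hY eX eY]]] := H1_rep hw; split.
  apply: (sob_ae_uniq hX (sobB hA hA') _).2.
  by apply: aeS (aeI eX (aeI eA eA')) => x [-> [-> ->]]; rewrite reB.
apply: (sob_ae_uniq hY (sobB hB hB') _).2.
by apply: aeS (aeI eY (aeI eB eB')) => x [-> [-> ->]]; rewrite imB.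
Qed.

End sobolev_bridge.

(** * The evolution equation in real and imaginary parts *)

Section evolution_bridge.
Context {R : realType}.
Local Notation mu := (@lebesgue_measure R).
Implicit Types (g h U : R -> R).

Lemma cvge0_lt (T : Type) (F : set_system T) {FF : Filter F} (g : T -> \bar R) (e : R) :
  (g @ F --> 0)%E -> 0 < e -> \forall x \near F, (g x < e%:E)%E.
Proof.
move=> h e0; have e0' : (0 < e%:E)%E by rewrite lte_fin.
exact: (h _ (open_ereal_lt' e0')).
Qed.

Lemma nrm_le_sqrt U (h : R) : ip U U <= h -> nrm U <= Num.sqrt h.
Proof. exact: ler_wsqrtr. Qed.

(** Since the pairing is bilinear, without conjugation, a real test function separates the real and
    imaginary parts of the equation. *)
Definition rtest (p : R -> R) : R -> R[i] := fun x => Complex (p x) 0.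

Lemma rtest_H1 p p1 : sob p p1 -> H1 (rtest p) /\
  {ae mu, forall x, re (wderiv (rtest p)) x = p1 x} /\
  {ae mu, forall x, im (wderiv (rtest p)) x = 0}.
Proof. by move=> hp; exact: H1_sob hp sob0. Qed.

Lemma rtest_norm p p1 : sob p p1 -> nrm p + nrm p1 <= 1 -> (H1norm (rtest p) <= 1)%E.
Proof.
move=> hp n1; have [hH [e1 e2]] := rtest_H1 hp; rewrite H1normE// lee_fin.
rewrite -[leRHS]sqrtr1 ler_wsqrtr//.
have [p2 p12 _] := hp; have [_ _ d1 d2] := H1_L2 hH.
have -> : h1sq (rtest p) = nrm p ^+ 2 + nrm p1 ^+ 2.
  rewrite /h1sq /sqn -!nrm_sq (nrm_ae d1.1 p12.1 e1).
  rewrite (nrm_ae d2.1 (g := fun=> 0) _ e2)//.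
  rewrite (_ : nrm (im (rtest p)) = 0); last exact: (@nrm0 R).
  by rewrite expr0n/= !addr0.
have := nrm_ge0 p; have := nrm_ge0 p1; move: (nrm p) (nrm p1) n1 => x y xy y0 x0.
have : (x + y) ^+ 2 <= 1 by rewrite exprn_ile1// addr_ge0.
have := mulr_ge0 x0 y0; rewrite sqrrD; lra.
Qed.

Lemma pairing_rtest u p : pairing u (rtest p) = Complex (ip (re u) p) (ip (im u) p).
Proof.
rewrite /pairing /cintegral /ip; congr Complex; apply: eq_Rintegral => x _.
  by rewrite /rtest /re; case: (u x) => a b /=; rewrite mulr0 subr0.
by rewrite /rtest /im; case: (u x) => a b /=; rewrite mulr0 add0r.
Qed.

Lemma dxx_rtest u p p1 : H1 u -> sob p p1 ->
  Hm1_dxx u (rtest p) = Complex (- ip (re (wderiv u)) p1) (- ip (im (wderiv u)) p1).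
Proof.
move=> hu hp; have [hH [e1 e2]] := rtest_H1 hp.
have [p2 p12 _] := hp; have [_ _ d1 d2] := H1_L2 hH; have [_ _ u1 u2] := H1_L2 hu.
rewrite /Hm1_dxx /cintegral.
have oE (a b : R) : - Complex a b = Complex (- a) (- b) by [].
rewrite oE.
have eR x : complex.Re (wderiv u x * wderiv (rtest p) x) =
  re (wderiv u) x * re (wderiv (rtest p)) x - im (wderiv u) x * im (wderiv (rtest p)) x.
  by rewrite /re /im; case: (wderiv u x) (wderiv (rtest p) x) => ? ? [].
have eI x : complex.Im (wderiv u x * wderiv (rtest p) x) =
  re (wderiv u) x * im (wderiv (rtest p)) x + im (wderiv u) x * re (wderiv (rtest p)) x.
  by rewrite /re /im; case: (wderiv u x) (wderiv (rtest p) x) => ? ? [].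
have [m1 m2 m3 m4] := And4 u1.1 u2.1 d1.1 d2.1.
congr Complex; congr (- _); rewrite /ip.
  rewrite (int_ext eR); apply: int_ae.
  - exact: (measurable_funB (measurable_funM m1 m3) (measurable_funM m2 m4)).
  - exact: (measurable_funM m1 p12.1).
  - by apply: aeS (aeI e1 e2) => x [-> ->]; rewrite mulr0 subr0.
rewrite (int_ext eI); apply: int_ae.
- exact: (measurable_funD (measurable_funM m1 m4) (measurable_funM m2 m3)).
- exact: (measurable_funM m2 p12.1).
- by apply: aeS (aeI e1 e2) => x [-> ->]; rewrite mulr0 add0r.
Qed.

Lemma Hm1norm_ge (G : (R -> R[i]) -> R[i]) phi (e : R) : H1 phi -> (H1norm phi <= 1)%E ->
  (Hm1norm G < e%:E)%E -> cmodulus (G phi) < e.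
Proof.
move=> h1 h2; rewrite -lte_fin; apply: le_lt_trans.
by apply: ereal_sup_ubound; exists phi.
Qed.

Variables (m : R) (V f : R -> R) (u : R -> R -> R[i]).
Hypothesis sol : global_odd_solution m V f u.
Let N t x := m * V x + f (rho (re (u t)) (im (u t)) x).

Lemma sol_H1 t : H1 (u t).
Proof. by have [[h _] _ _] := sol. Qed.

Lemma rtest_equation t (ut : (R -> R[i]) -> R[i]) p p1 : sob p p1 ->
  (forall phi, H1 phi -> 'i%C * ut phi + Hm1_dxx (u t) phi =
      pairing (fun x => ((m * V x)%:C)%C * u t x +
                        ((f (cmodulus (u t x) ^+ 2))%:C)%C * u t x) phi) ->
  ut (rtest p) = Complex (ip (fun x => N t x * im (u t) x) p + ip (im (wderiv (u t))) p1)
   (- (ip (fun x => N t x * re (u t) x) p + ip (re (wderiv (u t))) p1)).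
Proof.
move=> hp /(_ _ (rtest_H1 hp).1); rewrite (dxx_rtest (sol_H1 t) hp) pairing_rtest.
have -> : re (fun x => ((m * V x)%:C)%C * u t x +
   ((f (cmodulus (u t x) ^+ 2))%:C)%C * u t x) = (fun x => N t x * re (u t) x).
  apply/funext => x; rewrite /N /re /rho /im cmodulus_sq.
  by case: (u t x) => a b /=; ring.
have -> : im (fun x => ((m * V x)%:C)%C * u t x +
   ((f (cmodulus (u t x) ^+ 2))%:C)%C * u t x) = (fun x => N t x * im (u t) x).
  apply/funext => x; rewrite /N /re /rho /im cmodulus_sq.
  by case: (u t x) => a b /=; ring.
case: (ut _) => a b [] /=.
rewrite !mul0r !mul1r sub0r add0r => e1 e2; congr Complex; lra.
Qed.

Lemma sol_test_bound t e : 0 < e -> \forall h \near (0:R)^', forall p p1, sob p p1 ->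
  nrm p + nrm p1 <= 1 ->
  `|h^-1 * (ip (re (u (t + h))) p - ip (re (u t)) p) -
    (ip (fun x => N t x * im (u t) x) p + ip (im (wderiv (u t))) p1)| < e /\
  `|h^-1 * (ip (im (u (t + h))) p - ip (im (u t)) p) +
    (ip (fun x => N t x * re (u t) x) p + ip (re (wderiv (u t))) p1)| < e.
Proof.
move=> e0; have [_ /(_ t)[ut [_ hlim] heq] _] := sol.
apply: filterS (cvge0_lt hlim e0) => h hh p p1 hp n1.
have := Hm1norm_ge (rtest_H1 hp).1 (rtest_norm hp n1) hh.
rewrite (rtest_equation hp heq) !pairing_rtest.
set z := (X in cmodulus X); move=> hz.
have eR : complex.Re z = h^-1 * (ip (re (u (t + h))) p - ip (re (u t)) p) -
    (ip (fun x => N t x * im (u t) x) p + ip (im (wderiv (u t))) p1).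
  by rewrite /z /=; ring.
have eI : complex.Im z = h^-1 * (ip (im (u (t + h))) p - ip (im (u t)) p) +
    (ip (fun x => N t x * re (u t) x) p + ip (re (wderiv (u t))) p1).
  by rewrite /z /=; ring.
by rewrite -eR -eI; split; apply: le_lt_trans hz; [exact: cmodulus_Re|exact: cmodulus_Im].
Qed.

Lemma sol_rep : exists A B : R -> R -> R, forall t,
  [/\ sob (A t) (re (wderiv (u t))), sob (B t) (im (wderiv (u t))),
   {ae mu, forall x, A t x = re (u t) x} & {ae mu, forall x, B t x = im (u t) x}].
Proof.
have H t : exists AB : (R -> R) * (R -> R),
  [/\ sob AB.1 (re (wderiv (u t))), sob AB.2 (im (wderiv (u t))),
   {ae mu, forall x, AB.1 x = re (u t) x} & {ae mu, forall x, AB.2 x = im (u t) x}].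
  by have [A [B h]] := H1_rep (sol_H1 t); exists (A, B).
by have [X hX] := choice H; exists (fun t => (X t).1), (fun t => (X t).2).
Qed.

Lemma sol_curve_norm t0 e : 0 < e -> \forall t \near t0,
  [/\ nrm (fun x => re (u t) x - re (u t0) x) < e,
      nrm (fun x => im (u t) x - im (u t0) x) < e,
      nrm (fun x => re (wderiv (u t)) x - re (wderiv (u t0)) x) < e &
      nrm (fun x => im (wderiv (u t)) x - im (wderiv (u t0)) x) < e].
Proof.
move=> e0; have [[_ /(_ t0) hc] _ _] := sol.
apply: filterS (cvge0_lt hc e0) => t.
have [hw [d1 d2]] := H1B (sol_H1 t) (sol_H1 t0).
have [_ _ w3 w4] := H1_L2 hw.
have [_ _ u3 u4] := H1_L2 (sol_H1 t); have [_ _ v3 v4] := H1_L2 (sol_H1 t0).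
rewrite H1normE// lte_fin => hlt.
have reB x : re (fun x => u t x - u t0 x) x = re (u t) x - re (u t0) x.
  by rewrite /re; case: (u t x) (u t0 x) => ? ? [].
have imB x : im (fun x => u t x - u t0 x) x = im (u t) x - im (u t0) x.
  by rewrite /im; case: (u t x) (u t0 x) => ? ? [].
have := ip_ge0 (re (fun x => u t x - u t0 x)); have := ip_ge0 (im (fun x => u t x - u t0 x)).
have := ip_ge0 (re (wderiv (fun x => u t x - u t0 x))).
have := ip_ge0 (im (wderiv (fun x => u t x - u t0 x))).
move=> i1 i2 i3 i4.
split; (apply: le_lt_trans hlt).
- by rewrite -(nrm_ext reB); apply: nrm_le_sqrt; rewrite /h1sq /sqn; lra.
- by rewrite -(nrm_ext imB); apply: nrm_le_sqrt; rewrite /h1sq /sqn; lra.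
- rewrite -(nrm_ae w3.1 _ d1); last exact: measurable_funB u3.1 v3.1.
  by apply: nrm_le_sqrt; rewrite /h1sq /sqn; lra.
- rewrite -(nrm_ae w4.1 _ d2); last exact: measurable_funB u4.1 v4.1.
  by apply: nrm_le_sqrt; rewrite /h1sq /sqn; lra.
Qed.

(** Homogeneity turns an error bound on the unit ball, as given by the H^{-1} norm, into one
    proportional to the norm of the test function. Scaling by [(n + d / e)^-1] instead of [n^-1]
    includes the case of norm 0. *)
Lemma scale_bound (X p p1 : R -> R) (K0 K1 : R -> R) (c e : R) :
  L2R X -> L2R K0 -> L2R K1 -> sob p p1 -> 0 < e ->
  (forall q q1, sob q q1 -> nrm q + nrm q1 <= 1 -> `|c * ip X q - (ip K0 q + ip K1 q1)| < e) ->
  `|c * ip X p - (ip K0 p + ip K1 p1)| <= e * (nrm p + nrm p1).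
Proof.
move=> hX h0 h1 hp e0 H; apply/ler_addgt0Pr => d d0.
have [p2 p12 _] := hp; set n := nrm p + nrm p1.
have n0 : 0 <= n by rewrite addr_ge0 ?nrm_ge0.
pose s := (n + d / e)^-1; have nd : 0 < n + d / e by rewrite ltr_wpDl// divr_gt0.
have s0 : 0 < s by rewrite invr_gt0.
have := H _ _ (sobZ s hp); rewrite !nrmZ// (gtr0_norm s0) -mulrDr -/n.
rewrite mulrC ler_pdivrMr// mul1r lerDl divr_ge0 ?(ltW d0) ?(ltW e0)// => /(_ isT).
rewrite !ipZr//.
have -> : c * (s * ip X p) - (s * ip K0 p + s * ip K1 p1) =
  s * (c * ip X p - (ip K0 p + ip K1 p1)) by ring.
rewrite normrM (gtr0_norm s0) mulrC ltr_pdivrMr// => /ltW /le_trans; apply.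
by rewrite mulrDr mulrCA mulfV ?gt_eqF// mulr1.
Qed.

Lemma sol_rsol V1 F : nonlin f F -> ac V V1 -> (exists v0 : R, forall x, `|V x| <= v0) ->
  (exists v1 : R, forall x, `|V1 x| <= v1) -> exists A B,
  [/\ rsol m V V1 f F A (fun t => re (wderiv (u t))) B (fun t => im (wderiv (u t))),
    (forall t, {ae mu, forall x, A t x = re (u t) x}),
    (forall t, {ae mu, forall x, B t x = im (u t) x}) &
    forall t, A t 0 = 0 /\ B t 0 = 0].
Proof.
move=> hn aV bV bV1; have [A [B hAB]] := sol_rep.
have sA t : sob (A t) (re (wderiv (u t))) by have [] := hAB t.
have sB t : sob (B t) (im (wderiv (u t))) by have [] := hAB t.
have eA t : {ae mu, forall x, A t x = re (u t) x} by have [] := hAB t.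
have eB t : {ae mu, forall x, B t x = im (u t) x} by have [] := hAB t.
have A2 t : L2R (A t) by have [] := sA t.
have A12 t : L2R (re (wderiv (u t))) by have [] := sA t.
have B2 t : L2R (B t) by have [] := sB t.
have B12 t : L2R (im (wderiv (u t))) by have [] := sB t.
have U2 t : L2R (re (u t)) by have [] := H1_L2 (sol_H1 t).
have W2 t : L2R (im (u t)) by have [] := H1_L2 (sol_H1 t).
have ip_ae (X Y q : R -> R) : measurable_fun setT X -> measurable_fun setT Y ->
    measurable_fun setT q -> {ae mu, forall x, X x = Y x} -> ip X q = ip Y q.
  move=> hX hY hq e; apply: int_ae; [exact: measurable_funM..|].
  by apply: aeS e => x ->.
have mV := ac_meas aV; have [v0 hv0] := bV.
pose W t x := m * V x + f (rho (A t) (B t) x).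
have mN t : measurable_fun setT (N t).
  apply: measurable_funD; first exact: measurable_funM.
  by apply: (nl_measf hn); [exact: (U2 t).1|exact: (W2 t).1].
have WL2 t v : L2R v -> L2R (fun x => W t x * v x).
  move=> hv.
  pose S := Num.max (nrm (A t) + nrm (re (wderiv (u t))) + 1)
     (nrm (B t) + nrm (im (wderiv (u t))) + 1).
  have SA x : `|A t x| <= S by rewrite le_max sob_bounded.
  have SB x : `|B t x| <= S by rewrite le_max (sob_bounded x (sB t)) orbT.
  have := L2RD (L2RZ m (L2R_mulb hv mV hv0)) (L2R_nl hn SA SB (A2 t).1 (B2 t).1 hv).
  by congr L2R; apply/funext => x; rewrite /W; ring.
have eW t : {ae mu, forall x, W t x = N t x}.
  by apply: aeS (aeI (eA t) (eB t)) => x [e1 e2]; rewrite /N /W /rho e1 e2.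
have eWB t q : L2R q -> ip (fun x => N t x * im (u t) x) q = ip (fun x => W t x * B t x) q.
  move=> hq; apply/esym; apply: ip_ae; [exact: (WL2 t _ (B2 t)).1| |exact: hq.1|].
    by apply: measurable_funM => //; exact: (W2 t).1.
  by apply: aeS (aeI (eW t) (eB t)) => x [-> ->].
have eWA t q : L2R q -> ip (fun x => N t x * re (u t) x) q = ip (fun x => W t x * A t x) q.
  move=> hq; apply/esym; apply: ip_ae; [exact: (WL2 t _ (A2 t)).1| |exact: hq.1|].
    by apply: measurable_funM => //; exact: (U2 t).1.
  by apply: aeS (aeI (eW t) (eA t)) => x [-> ->].
have dA (t h : R) q : L2R q -> ip (fun x => A (t + h) x - A t x) q =
    ip (re (u (t + h))) q - ip (re (u t)) q.
  move=> hq; rewrite ipBl//.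
  by rewrite (ip_ae _ _ _ (A2 (t + h)).1 (U2 _).1 hq.1 (eA _))
    (ip_ae _ _ _ (A2 t).1 (U2 _).1 hq.1 (eA _)).
have dB (t h : R) q : L2R q -> ip (fun x => B (t + h) x - B t x) q =
    ip (im (u (t + h))) q - ip (im (u t)) q.
  move=> hq; rewrite ipBl//.
  by rewrite (ip_ae _ _ _ (B2 (t + h)).1 (W2 _).1 hq.1 (eB _))
    (ip_ae _ _ _ (B2 t).1 (W2 _).1 hq.1 (eB _)).
have nA t t0 : nrm (fun x => A t x - A t0 x) = nrm (fun x => re (u t) x - re (u t0) x).
  apply: nrm_ae; [exact: (L2RB (A2 t) (A2 t0)).1|exact: (L2RB (U2 t) (U2 t0)).1|].
  by apply: aeS (aeI (eA t) (eA t0)) => x [-> ->].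
have nB t t0 : nrm (fun x => B t x - B t0 x) = nrm (fun x => im (u t) x - im (u t0) x).
  apply: nrm_ae; [exact: (L2RB (B2 t) (B2 t0)).1|exact: (L2RB (W2 t) (W2 t0)).1|].
  by apply: aeS (aeI (eB t) (eB t0)) => x [-> ->].
(* Oddness of [u] passes to the continuous representative only almost everywhere, then everywhere by
   continuity, and so forces the value 0 at the origin. *)
have odd X Z : sob X Z -> forall g, {ae mu, forall x, X x = g x} ->
    (forall x, g (- x) = - g x) -> X 0 = 0.
  move=> [_ _ aX] g eg og.
  have cX := ac_cont aX.
  have cXN : continuous (fun x => - X (- x)).
    move=> x; apply: cvgN; apply: (@continuous_comp _ _ _ -%R X); first exact: opp_continuous.
    exact: cX.
  have : X 0 = - X (- 0).
    apply: (cont_ae_eq cX cXN); apply: aeS (aeI eg (ae_opp eg)) => x [-> ->].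
    by rewrite og opprK.
  rewrite oppr0; lra.
exists A, B; split=> //; last first.
  move=> t; have [_ _ hodd] := sol; split.
    apply: (odd _ _ (sA t) _ (eA t)) => x; rewrite /re hodd; by case: (u t x).
  apply: (odd _ _ (sB t) _ (eB t)) => x; rewrite /im hodd; by case: (u t x).
split=> //.
- split=> // t0 e e0; have e2 : 0 < e / 2 by rewrite divr_gt0.
  by apply: filterS (sol_curve_norm t0 e2) => t [h1 h2 h3 h4]; rewrite nA; lra.
- split=> // t0 e e0; have e2 : 0 < e / 2 by rewrite divr_gt0.
  by apply: filterS (sol_curve_norm t0 e2) => t [h1 h2 h3 h4]; rewrite nB; lra.
- split=> [t|//|t e e0]; first exact: WL2.
  apply: filterS (sol_test_bound t e0) => h hh phi phi1 hphi.
  apply: scale_bound => //; [exact: L2RB|exact: WL2|].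
  move=> q q1 hq n1; have [q2 _ _] := hq; have [+ _] := hh q q1 hq n1.
  by rewrite dA// eWB.
- split=> [t|t|t e e0]; [by apply: L2RN; exact: WL2|exact: L2RN|].
  apply: filterS (sol_test_bound t e0) => h hh phi phi1 hphi.
  have n1 := L2RN (WL2 t _ (A2 t)); have n2 := L2RN (A12 t).
  apply: scale_bound => //; first exact: L2RB.
  move=> q q1 hq nq; have [q2 q12 _] := hq; have [_ +] := hh q q1 hq nq.
  rewrite dB// eWA//; congr (`|_| < _).
  by rewrite !ipNl//; [ring|exact: WL2].
Qed.

End evolution_bridge.

(** * Bounds on the potential, local norms and the choice of constants *)

Section conclusion.
Context {R : realType}.
Local Notation mu := (@lebesgue_measure R).
Implicit Types (g h U : R -> R).

(** Only the Schwartz bounds without polynomial weight on the function and its first two derivatives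
    are used. The second derivative makes the error of the difference quotient uniform in [x] and
    linear in the step, by the mean value theorem for [V] minus its linear part at [x]. *)
Lemma schwartz_potential (V : R -> R) : schwartz V ->
  exists v0 v1 v2 : R, [/\ ac V (V^`())%classic, (forall x, `|V x| <= v0),
    (forall x, `|(V^`())%classic x| <= v1), 0 <= v2 &
    forall a x, a != 0 -> `|dq a V x - (V^`())%classic x| <= v2 * `|a|].
Proof.
move=> [sm hb]; set V1 := (V^`())%classic; set V2 := (V^`(2))%classic.
have [v0 h0] := hb 0%N 0%N; have [v1 h1] := hb 0%N 1%N; have [v2 h2] := hb 0%N 2%N.
have k0 x : `|V x| <= v0 by have := h0 x; rewrite expr0 mul1r derive1n0.
have k1 x : `|V1 x| <= v1 by have := h1 x; rewrite expr0 mul1r derive1n1.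
have k2 x : `|V2 x| <= v2 by have := h2 x; rewrite expr0 mul1r.
have d1 x : dat V x (V1 x) by rewrite /V1 derive1E; apply: DeriveDef => //; exact: (sm 0%N).
have d2 x : dat V1 x (V2 x).
  have := sm 1%N x; rewrite derive1n1 => hd.
  by rewrite /V2 derive1nS derive1n1 derive1E; apply: DeriveDef.
have c1 : continuous V1 by move=> x; exact: dat_cont (d2 x).
have v20 : 0 <= v2 by apply: le_trans (k2 0).
exists v0, v1, v2; split=> //.
  by apply: ac_C1 k1 d1; exact: continuous_measurable_fun.
move=> a x a0; have dd y : dat (fun y => V y - V1 x * y) y (V1 y - V1 x).
  apply: datB => //; apply: dat_eq (datZ (V1 x) (is_derive_id y 1)) _; exact: mulr1.
have lip y : `|V1 y - V1 x| <= v2 * `|y - x|.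
  have := @dat_mono_lip _ V1 V2 (Num.min x y) (Num.max x y) v2.
  move=> H; apply: H => [z _|z _||]; [exact: d2|exact: k2| |].
    by rewrite ge_min le_max !lexx !orbT.
  by rewrite ge_min le_max !lexx.
have -> : dq a V x - V1 x = a^-1 * ((V (x + a) - V1 x * (x + a)) - (V x - V1 x * x)).
  by rewrite /dq; field.
rewrite normrM normfV ler_pdivrMl ?normr_gt0//.
have [ap|an] := leP 0 a.
  have := @dat_mvt_abs _ _ _ x (x + a) (v2 * `|a|) _ (fun y _ => dd y).
  have -> : x + a - x = a by ring.
  have -> : `|a| * (v2 * `|a|) = v2 * `|a| * a by rewrite {1}(ger0_norm ap); ring.
  apply; first by rewrite lerDl.
  move=> y /andP[y1 y2]; apply: le_trans (lip y) _; rewrite ler_wpM2l//.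
  by rewrite !ger0_norm//; lra.
have := @dat_mvt_abs _ _ _ (x + a) x (v2 * `|a|) _ (fun y _ => dd y).
have -> : x - (x + a) = - a by ring.
have -> : `|a| * (v2 * `|a|) = v2 * `|a| * - a by rewrite {1}(ltr0_norm an); ring.
rewrite distrC; apply; first by rewrite gerDl ltW.
move=> y /andP[y1 y2]; apply: le_trans (lip y) _; rewrite ler_wpM2l//.
by rewrite distrC (ltr0_norm an) ger0_norm; lra.
Qed.

(** The comparison used is [expR (2 * |x|) <= 2 * cosh (2 * x)], one of the two exponentials in cosh
    being the required one. *)
Lemma cosh_weight (V V1 : R -> R) : measurable_fun setT V -> measurable_fun setT V1 ->
  (\int[mu]_x ((`|V x| + `|V1 x|) * cosh (2 * x))%:E < +oo)%E ->
  igr (fun x => `|V1 x| * expR (2 * `|x|)).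
Proof.
move=> mV mV1 hV.
have c0 (x : R) : 0 <= cosh x by rewrite divr_ge0// addr_ge0 ?expR_ge0.
have mc : measurable_fun setT (fun x : R => cosh (2 * x)).
  have m1 (c : R) : measurable_fun setT (fun x : R => expR (c * x)).
    by apply: measurableT_comp => //; exact: measurable_funM.
  rewrite (_ : (fun x => _) = (fun x => (expR (2 * x) + expR (- 2 * x)) / 2)).
    by apply: measurable_funM => //; exact: measurable_funD.
  by apply/funext => x; rewrite /cosh mulNr.
have mg : measurable_fun setT (fun x : R => (`|V x| + `|V1 x|) * cosh (2 * x)).
  by apply: measurable_funM => //; apply: measurable_funD; exact: measurableT_comp.
have ig : igr (fun x : R => (`|V x| + `|V1 x|) * cosh (2 * x)).
  apply/integrableP; split; first exact/measurable_EFinP.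
  apply: le_lt_trans hV; rewrite le_eqVlt; apply/orP; left; apply/eqP.
  apply: eq_integral => x _ /=; rewrite ger0_norm// mulr_ge0 ?addr_ge0//.
apply: igr_le (igrZ 2 ig).
  apply: measurable_funM; first exact: measurableT_comp.
  by do 2!apply: measurableT_comp => //; apply: measurable_funM => //; exact: measurableT_comp.
move=> x; rewrite ger0_norm ?mulr_ge0 ?expR_ge0//.
have ex : expR (2 * `|x|) <= 2 * cosh (2 * x).
  have -> : 2 * cosh (2 * x) = expR (2 * x) + expR (- (2 * x)) by rewrite /cosh; field.
  have [x0|x0] := leP 0 x; first by rewrite ger0_norm// lerDl expR_ge0.
  by rewrite ltr0_norm// mulrN lerDr expR_ge0.
have := normr_ge0 (V1 x); have := normr_ge0 (V x) => p q.
apply: le_trans (ler_wpM2l q ex) _.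
by have := mulr_ge0 p (c0 (2 * x)); lra.
Qed.

Lemma smallness (K th : R) : 0 <= K -> 0 < th ->
  exists2 s, 0 < s & K * s `^ th <= 2^-1.
Proof.
move=> K0 th0; pose b := (2 * (K + 1))^-1.
have K1 : 0 < K + 1 by rewrite ltr_wpDl.
have b0 : 0 < b by rewrite invr_gt0 mulr_gt0.
exists (b `^ th^-1); first exact: powR_gt0.
rewrite -powRrM mulVf ?gt_eqF// powRr1 ?(ltW b0)// /b ler_pdivrMr ?mulr_gt0//.
by rewrite mulrA mulVf// mul1r lerDl.
Qed.

Lemma ew_low (M x : R) : `|x| <= M -> expR (- (2 * M)) <= ew 2 x.
Proof. by move=> h; rewrite ler_expR lerN2 ler_wpM2l. Qed.

(** On the bounded set the weight [ew 2] is at least e^{-2M}, which settles the L^2 norm. For the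
    supremum, [sob_sup] is applied to [ew 1 A] and [ew 1 B]: their L^2 norms are at most the square
    root of [y], and their derivatives are bounded by [K]. *)
Lemma local_norms (u : R -> R[i]) (A A1 B B1 : R -> R) (I : set R) (M y K : R) :
  is_interval I -> (forall x, I x -> `|x| <= M) -> sob A A1 -> sob B B1 ->
  {ae mu, forall x, A x = re u x} -> {ae mu, forall x, B x = im u x} -> L2 u ->
  ip A (fun x => ew 2 x * A x) + ip B (fun x => ew 2 x * B x) <= y ->
  nrm A + nrm A1 <= K -> nrm B + nrm B1 <= K ->
  (Lnorm_on 2%:E I u + Lnorm_on +oo I u <=
    (Num.sqrt (expR (2 * M) * y) + Num.sqrt (expR (2 * M) * (4 * K * Num.sqrt y)))%:E)%E.
Proof.
move=> itvI hM hA hB eA eB hu hy nA nB.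
have [A2 A12 _] := hA; have [B2 B12 _] := hB.
have mI : measurable I by exact: is_interval_measurable.
have eE := expR_gt0 (2 * M).
pose g x := (cmodulus (u x) : R) * \1_I x.
have mg : measurable_fun setT g.
  apply: measurable_funM; first exact: cmod_meas hu.1.
  exact: measurable_indic.
have gE : ((fun x => (cmodulus (u x))%:E) \_ I = (fun x => (g x)%:E))%E.
  apply/funext => x; rewrite /patch /g indicE; case: ifPn => xI; rewrite ?mulr1 ?mulr0//.
have ew2L X : @L2R R X -> igr (fun x => ew 2 x * X x ^+ 2).
  by move=> hX; apply: igr_ew => //; exact: hX.2.
have ipE X : ip X (fun x => ew 2 x * X x) = \int[mu]_x (ew 2 x * X x ^+ 2) :> R.
  by apply: int_ext => x; ring.
rewrite !ipE in hy.
have pw X : 0 <= \int[mu]_x (ew 2 x * X x ^+ 2).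
  by apply: int_ge0 => x; rewrite mulr_ge0 ?ew_ge0 ?sqr_ge0.
have [pA pB] := (pw A, pw B).
have y0 : 0 <= y by lra.
have iR : igr (fun x => ew 2 x * rho A B x).
  by have := igrD (ew2L _ A2) (ew2L _ B2); congr igr; apply/funext => x; rewrite /rho; ring.
have gI x : rho A B x * \1_I x <= expR (2 * M) * (ew 2 x * rho A B x).
  rewrite indicE; have r0 := rho_ge0 A B x.
  have [/set_mem xI|_] := boolP (x \in I); last first.
    by rewrite mulr0 mulr_ge0 ?(ltW eE)// mulr_ge0 ?ew_ge0.
  rewrite mulr1 mulrA ler_peMl//; have := ew_low (hM _ xI) => h3.
  by apply: le_trans (ler_wpM2l (ltW eE) h3); rewrite -expRD subrr expR0.
have gS : {ae mu, forall x, g x ^+ 2 = rho A B x * \1_I x}.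
  apply: aeS (aeI eA eB) => x [h1 h2].
  rewrite /g exprMn cmodulus_sq -/(re u x) -/(im u x) -h1 -h2 -/(rho A B x) indicE.
  by case: (_ \in _); rewrite ?expr1n ?expr0n.
have hG : L2R g.
  have [h1 h2] := (L2P u).1 hu.
  apply: (@L2R_le _ _ (fun x => cmodulus (u x))) => //.
    move=> x; rewrite /g normrM (ger0_norm (cmodulus_ge0 _)).
    by rewrite ler_piMr ?cmodulus_ge0// indicE; case: (_ \in _); rewrite ?normr1 ?normr0.
  split; first exact: cmod_meas hu.1.
  by have := igrD h1.2 h2.2; congr igr; apply/funext => x; rewrite cmodulus_sq.
have wB (X X1 : R -> R) x : sob X X1 -> nrm X + nrm X1 <= K ->
    \int[mu]_x (ew 2 x * X x ^+ 2) <= y -> ew 2 x * X x ^+ 2 <= 2 * K * Num.sqrt y.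
  move=> hX nX iX; have [X2 X12 _] := hX.
  have hw := sob_mulw (ac_ew ler01) (fun x => ew_norm x ler01)
     (fun x => ew1_bound x ler01) hX.
  have := sob_sup x hw; have -> : (ew 1 x * X x) ^+ 2 = ew 2 x * X x ^+ 2 by rewrite ew2; ring.
  move=> /le_trans; apply; rewrite -!mulrA ler_wpM2l// mulrC.
  apply: ler_pM; rewrite ?nrm_ge0//.
    have m1 : measurable_fun setT (fun x : R => - 1 * ew 1 x * sg x).
      by have := (ac_ew (ler01 : 0 <= 1 :> R)).1.1.
    apply: le_trans (nrmD (L2R_mulb X2 m1 (fun x => ew1_bound x ler01))
      (L2R_mulb X12 (ew_meas ler01) (fun x => ew_norm x ler01))) _.
    apply: le_trans nX; apply: lerD; rewrite -[leRHS]mul1r; apply: nrm_mulb => //.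
    - by move=> z; exact: ew1_bound.
    - exact: ew_meas.
    - by move=> z; exact: ew_norm.
  rewrite ler_wsqrtr// ip_int; apply: le_trans iX.
  by rewrite le_eqVlt; apply/orP; left; apply/eqP; apply: int_ext => z; rewrite ew2; ring.
have n1 : (Lnorm_on 2%:E I u <= (Num.sqrt (expR (2 * M) * y))%:E)%E.
  rewrite /Lnorm_on gE Lnorm2E// lee_fin ler_wsqrtr// ip_int.
  have mr : measurable_fun setT (rho A B).
    by apply: measurable_funD; apply: measurable_funX; [exact: A2.1|exact: B2.1].
  have mrI : measurable_fun setT (fun x => rho A B x * \1_I x).
    by apply: measurable_funM => //; exact: measurable_indic.
  rewrite (int_ae _ mrI gS); last exact: measurable_funX.
  apply: (@le_trans _ _ (\int[mu]_x (expR (2 * M) * (ew 2 x * rho A B x)))).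
    apply: int_le => //; last exact: igrZ.
    apply: igr_le mrI _ (igrZ (expR (2 * M)) iR) => x.
    by rewrite ger0_norm ?gI// mulr_ge0 ?rho_ge0// indicE.
  rewrite intZ// ler_wpM2l ?(ltW eE)//.
  have -> : \int[mu]_x (ew 2 x * rho A B x) =
    \int[mu]_x (ew 2 x * A x ^+ 2) + \int[mu]_x (ew 2 x * B x ^+ 2).
    rewrite -intD; [|exact: ew2L..].
    by apply: int_ext => x; rewrite /rho; ring.
  exact: hy.
have n2 : (Lnorm_on +oo I u <= (Num.sqrt (expR (2 * M) * (4 * K * Num.sqrt y)))%:E)%E.
  rewrite /Lnorm_on gE unlock; case: ifP => [_|_]; last by rewrite lee_fin sqrtr_ge0.
  apply/ess_supP; apply: aeS gS => x h /=; rewrite lee_fin.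
  rewrite -sqrtr_sqr ler_wsqrtr// h; apply: le_trans (gI _) _.
  rewrite ler_wpM2l ?(ltW eE)// /rho mulrDr.
  have -> : 4 * K * Num.sqrt y = 2 * K * Num.sqrt y + 2 * K * Num.sqrt y by ring.
  by apply: lerD; [apply: (wB _ _ _ hA)|apply: (wB _ _ _ hB)] => //; lra.
by rewrite EFinD; exact: leeD n1 n2.
Qed.

Lemma cvge0_intro (g : R -> \bar R) : (forall t, 0 <= g t)%E ->
  (forall e : R, 0 < e -> exists T, forall t, T <= t -> (g t <= e%:E)%E) ->
  (g t @[t --> +oo%R] --> 0)%E.
Proof.
move=> g0 H; apply/fine_cvgP; split.
  have [T hT] := H 1 ltr01; exists T; split; first exact: num_real.
  move=> t /ltW /hT h; rewrite ge0_fin_numE//; exact: le_lt_trans h (ltry _).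
apply/cvgrPdist_le => e e0; have [T hT] := H e e0; exists T; split; first exact: num_real.
move=> t /ltW /hT h /=; have fn : g t \is a fin_num.
  by rewrite ge0_fin_numE//; exact: le_lt_trans h (ltry _).
rewrite sub0r normrN ger0_norm ?fine_ge0//.
by rewrite -lee_fin fineK.
Qed.

Lemma sqrt_small (E1 K e : R) : 0 < E1 -> 0 <= K -> 0 < e -> exists2 d, 0 < d &
  forall y, 0 <= y <= d -> Num.sqrt (E1 * y) + Num.sqrt (E1 * (4 * K * Num.sqrt y)) <= e.
Proof.
move=> E10 K0 e0; pose r := e / 2; have r0 : 0 < r by rewrite divr_gt0.
have r20 : 0 < r ^+ 2 by rewrite exprn_gt0.
pose c := r ^+ 2 / (E1 * (4 * K) + 1).
have D0 : 0 < E1 * (4 * K) + 1 by rewrite ltr_wpDl// !mulr_ge0// ltW.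
have c0 : 0 < c by rewrite divr_gt0.
exists (Num.min (r ^+ 2 / E1) (c ^+ 2)); first by rewrite lt_min divr_gt0//= exprn_gt0.
move=> y /andP[y0]; rewrite le_min => /andP[y1 y2].
have -> : e = Num.sqrt (r ^+ 2) + Num.sqrt (r ^+ 2).
  by rewrite sqrtr_sqr gtr0_norm// /r; field.
apply: lerD; rewrite ler_wsqrtr//; first by rewrite mulrC -ler_pdivlMr.
have yc : Num.sqrt y <= c by rewrite -(ger0_norm (ltW c0)) -sqrtr_sqr ler_wsqrtr.
rewrite mulrA; apply: (@le_trans _ _ ((E1 * (4 * K) + 1) * c)).
  by apply: ler_pM; rewrite ?sqrtr_ge0// ?lerDl// !mulr_ge0// ltW.
by rewrite /c mulrC divfK// gt_eqF.
Qed.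

End conclusion.

Theorem theorem1p3 (R : realType) (p : R) (f V : R -> R)
  (hp : 1 < p < 5)
  (hf : exists C : R, forall s : R, 0 <= s -> `|f s| <= C * s `^ ((p - 1) / 2))
  (hflip : locally_lipschitz (fun s => f (s ^+ 2)))
  (hV0 : V <> (fun=> 0))
  (hVeven : forall x, V (- x) = V x)
  (hVschwartz : schwartz V)
  (hVint : (\int[@lebesgue_measure R]_x
      ((`|V x| + `|(V^`())%classic x|) * cosh (2 * x))%:E < +oo)%E) :
  exists eps mu0 : R, [/\ 0 < eps, 0 < mu0 &
    forall mu : R, 0 < mu < mu0 ->
    forall u : R -> R -> R[i], global_odd_solution mu V f u ->
    (H1norm (u 0%R) <= eps%:E)%E ->
    forall I : set R, is_interval I -> bounded_set I ->
      (Lnorm_on 2%:E I (u t) + Lnorm_on +oo I (u t))%E @[t --> +oo] --> 0%E].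
Proof.
have [C hC] := hf; set th := (p - 1) / 2 in hC.
have [hp1 hp5] := andP hp.
have th0 : 0 < th by rewrite divr_gt0// subr_gt0.
have hth : 0 < th <= 2 by rewrite th0 /th ler_pdivrMr//; lra.
have C0 : 0 <= C := nlC_ge0 hC.
have hn := nonlin_nlprim hflip.
have hF := nlprim_bound th0 hC hflip.
have [v0 [v1 [v2 [aV b0 b1 v20 b2]]]] := schwartz_potential hVschwartz.
have hQ := cosh_weight (ac_meas aV) aV.1.1 hVint.
set V1 := (V^`())%classic in aV b1 b2 hQ.
pose Q := \int[@lebesgue_measure R]_x (`|V1 x| * expR (2 * `|x|)).
have Q0 : 0 <= Q by apply: int_ge0 => x; rewrite mulr_ge0 ?expR_ge0.
have v00 : 0 <= v0 by apply: le_trans (b0 0).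
pose K := expR 1 * (2 * C * (4 * (th + 1) ^+ 2 / th ^+ 2)).
have K0 : 0 <= K.
  apply: mulr_ge0; first exact: expR_ge0.
  apply: mulr_ge0; first exact: mulr_ge0.
  by rewrite divr_ge0 ?sqr_ge0// mulr_ge0// sqr_ge0.
have [s0 s00 hs0] := smallness K0 th0.
pose k := 3 + 4 * v0 + 12 * C; have k0 : 0 < k by rewrite /k; lra.
have c0 : 0 < 8 * C + 1 by lra.
(* The three requirements are [E <= 1], the absorption condition [8 C E <= 1] of [apriori], and
   [E k <= s0], where [E k] bounds the supremum of |u|^2 and [s0] makes the nonlinear flux at most
   half of the coercive term. *)
pose E := Num.min 1 (Num.min (8 * C + 1)^-1 (s0 / k)).
have E0 : 0 < E by rewrite !lt_min ltr01 invr_gt0 c0 divr_gt0.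
have /andP[E1 /andP[E2 E3]] : [&& E <= 1, E <= (8 * C + 1)^-1 & E <= s0 / k].
  by rewrite -!le_min.
have CE : 8 * C * E <= 1.
  have : E * (8 * C + 1) <= 1 by rewrite -ler_pdivlMr// mul1r.
  lra.
have sE : E * k <= s0 by rewrite -ler_pdivlMr.
have hs : expR 1 * (2 * C * (4 * (th + 1) ^+ 2 / th ^+ 2 * (E * k) `^ th)) <= 2^-1.
  apply: le_trans hs0.
  have -> : expR 1 * (2 * C * (4 * (th + 1) ^+ 2 / th ^+ 2 * (E * k) `^ th)) =
    K * (E * k) `^ th by rewrite /K; ring.
  rewrite ler_wpM2l// ge0_ler_powR ?nnegrE ?(ltW s00) ?(ltW th0)//.
  by rewrite mulr_ge0 ?(ltW E0)// ltW.
(* The bound on the initial H^1 norm is squared to give [E], and [m (16 Q + 1) <= 1] yields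
   [m (8 Q) <= 1/2], the share of the coercive term allotted to the potential. *)
exists (Num.sqrt E), (Num.min 1 (16 * Q + 1)^-1); split; first by rewrite sqrtr_gt0.
  by rewrite lt_min ltr01 invr_gt0; lra.
move=> m /andP[m0]; rewrite lt_min => /andP[m1 m2] u sol hu0 I itvI bI.
have m01 : 0 <= m <= 1 by rewrite (ltW m0) (ltW m1).
have hmQ : m * (8 * Q) <= 2^-1.
  have : m * (16 * Q + 1) <= 1 by rewrite -ler_pdivlMr ?mul1r ?(ltW m2)//; lra.
  lra.
have [A [B [rs eA eB AB0]]] := sol_rsol sol hn aV (ex_intro _ v0 b0) (ex_intro _ v1 b1).
have H1u t := sol_H1 sol t.
have A_0 t : A t 0 = 0 by have [] := AB0 t.
have B_0 t : B t 0 = 0 by have [] := AB0 t.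
have sA t := (rs_A rs).1 t; have sB t := (rs_B rs).1 t.
have hE : sqn (A 0) (B 0) + sqn (re (wderiv (u 0))) (im (wderiv (u 0))) <= E.
  have [r1 r2 _ _] := H1_L2 (H1u 0); have [a2 _ _] := sA 0; have [b_2 _ _] := sB 0.
  have -> : sqn (A 0) (B 0) = sqn (re (u 0)) (im (u 0)).
    by rewrite /sqn -!nrm_sq (nrm_ae a2.1 r1.1 (eA 0)) (nrm_ae b_2.1 r2.1 (eB 0)).
  move: hu0; rewrite H1normE// lee_fin ler_sqrt//; exact: ltW.
have [M0 [_ hM0]] := bI; pose M := M0 + 1.
have hM x : I x -> `|x| <= M by apply: hM0; rewrite ltrDl.
have fs s : 0 <= s -> `|f s| <= C * s `^ th by exact: hC.
(* Each of two norms x is bounded by [1 + x^2], whence the 2; the squares are bounded by the two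
   conclusions of [apriori]. *)
pose Kn := 2 + E + 2 * E * (1 + 2 * v0 + 6 * C).
have bound t : 0 <= t -> nrm (A t) + nrm (re (wderiv (u t))) <= Kn /\
   nrm (B t) + nrm (im (wderiv (u t))) <= Kn.
  move=> t0; have [h1 h2] := apriori rs m01 b0 hth C0 hF E1 CE hE t0.
  move: h1 h2; rewrite /sqn -!nrm_sq /Kn.
  move: (2 * E * _) => z h1 h2.
  have xs (x : R) : x <= 1 + x ^+ 2.
    by have := sqr_ge0 (x - 1); have := sqr_ge0 x; rewrite sqrrB; lra.
  have := sqr_ge0 (nrm (A t)); have := sqr_ge0 (nrm (B t)).
  have := sqr_ge0 (nrm (re (wderiv (u t)))); have := sqr_ge0 (nrm (im (wderiv (u t)))).
  have := xs (nrm (A t)); have := xs (nrm (B t)).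
  have := xs (nrm (re (wderiv (u t)))); have := xs (nrm (im (wderiv (u t)))).
  by move=> *; split; lra.
have Kn0 : 0 <= Kn.
  by have [h _] := bound 0 (lexx 0); apply: le_trans h; rewrite addr_ge0 ?nrm_ge0.
apply: cvge0_intro => [t|e e0].
  by rewrite adde_ge0// Lnorm_ge0.
have [d d0 hd] := sqrt_small (expR_gt0 (2 * M)) Kn0 e0.
have [T hT] := locmass_decay rs A_0 B_0 m01 b0 b1 v20 b2 hQ hth C0 fs hF E1 CE hE hmQ hs d0.
exists (Num.max 0 T) => t; rewrite ge_max => /andP[t0 Tt].
have [nA nB] := bound t t0.
have := local_norms itvI hM (sA t) (sB t) (eA t) (eB t) (H1u t).1 (lexx _) nA nB.
move=> /le_trans; apply; rewrite lee_fin; apply: hd; apply/andP; split.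
  exact: (locmass_ge0 A B t).
exact: ltW (hT t Tt).
Qed.
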